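(* Let $T>0$. Suppose that $u=u(x,y,t)$ is sufficiently smooth on $\mathbb{R}\times\mathbb{R}_+\times(0,T)$ up to the boundary and decays sufficiently fast as $|(x,y)|\to\infty$; that is, the following holds for some sufficiently large integer $N$: $u\in C^N(\mathbb{R}\times[0,\infty)\times[0,T])$ and all partial derivatives of $u$ of order at most $N$ are bounded by $C(1+|x|+|y|)^{-N}$ for some constant $C$. Suppose that $u$ solves $$u_t-u_{xx}-2u_{xy}-u_{yy}=0\ \text{ in }\mathbb{R}\times\mathbb{R}_+\times(0,T),$$ $$u(x,0,t)=g_0(x,t),\qquad u(x,y,0)=u_0(x,y).$$ Then for all $(x,y,t)\in\mathbb{R}\times\mathbb{R}_+\times(0,T)$, $$u(x,y,t)=\frac{1}{(2\pi)^2}\int_{-\infty}^\infty\int_{-\infty}^{\infty}E(\kappa,\lambda;x,y,t)\,\widehat{u_0}(\kappa,\lambda)\,d\lambda\, d\kappa$$ $$-\frac{1}{(2\pi)^2}\int_{-\infty}^\infty\int_{\partial D_\kappa^+}E(\kappa,\lambda;x,y,t)\,\widehat{u_0}(\kappa,-(\lambda+2\kappa))\,d\lambda\, d\kappa$$ $$-\frac{i}{2\pi^2}\int_{-\infty}^\infty\int_{\partial D_\kappa^+}(\lambda+\kappa)\,E(\kappa,\lambda;x,y,t)\,\widetilde{g_0}(\kappa,(\kappa+\lambda)^2,t)\,d\lambda\, d\kappa,$$ where $E(\kappa,\lambda;x,y,t)=\exp(-(\kappa+\lambda)^2t+i\kappa x+i\lambda y)$.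
   Context: Notation: $\mathbb{R}_+=(0,\infty)$, $\mathbb{C}_+=\{\lambda\in\mathbb{C}:\operatorname{Im}\lambda>0\}$. Half space Fourier transform: for $\kappa\in\mathbb{R}$ and $\operatorname{Im}\lambda\le 0$, $$\widehat{u_0}(\kappa,\lambda)=\int_{-\infty}^\infty\int_0^\infty e^{-ix\kappa-iy\lambda}u_0(x,y)\,dy\,dx.$$ $t$-transform: for $\kappa\in\mathbb{R}$, $\eta\in\mathbb{C}$, $$\widetilde{g_0}(\kappa,\eta,t)=\int_0^t e^{\eta\tau}\Big(\int_{-\infty}^\infty e^{-ix\kappa}g_0(x,\tau)\,dx\Big)d\tau.$$ For $\kappa\in\mathbb{R}$, $D_\kappa=\{\lambda\in\mathbb{C}:\operatorname{Re}(\kappa+\lambda)^2<0\}$ and $D_\kappa^+=D_\kappa\cap\mathbb{C}_+$. The contour $\partial D_\kappa^+$ is the boundary of $D_\kappa^+$ oriented so that $D_\kappa^+$ lies to its left. All double integrals are iterated (inner integral in $\lambda$, outer in $\kappa$). Integrals in $\lambda$ over unbounded contours are understood, where necessary, as improper integrals, i.e. limits as $R\to\infty$ of the integrals over the part of the contour in $|\lambda|\le R$. ''Sufficiently large $N$'' means: there exists an absolute integer $N$ for which the statement is true. *)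

(* Defs.v *)
From Stdlib Require Export Reals.
From Stdlib Require Import Lra.
From Coquelicot Require Export Coquelicot.
Open Scope R_scope.

Definition Cexp (z : C) : C :=
  (RtoC (exp (Re z)) * (cos (Im z), sin (Im z)))%C.

(** Improper Riemann integrals; the two ends of the line go to infinity
    independently. If the limit in this sense exists, so does the limit as
    [R -> +oo] of the integrals over the part of modulus at most [R], both for
    the real line and for the rays of [contour_int], and the values agree. *)
Definition int_R (f : R -> C) : C :=
  RInt_gen (V := C_R_CompleteNormedModule) f
    (Rbar_locally m_infty) (Rbar_locally p_infty).

Definition ex_int_R (f : R -> C) : Prop :=
  ex_RInt_gen (V := C_R_NormedModule) f
    (Rbar_locally m_infty) (Rbar_locally p_infty).

Definition int_pos (f : R -> C) : C :=
  RInt_gen (V := C_R_CompleteNormedModule) f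
    (at_point 0) (Rbar_locally p_infty).

Definition ex_int_pos (f : R -> C) : Prop :=
  ex_RInt_gen (V := C_R_NormedModule) f
    (at_point 0) (Rbar_locally p_infty).

Definition hat_integrand (u0 : R -> R -> C) (kappa : R) (lambda : C) (x y : R) : C :=
  (Cexp (- (Ci * x * kappa) - Ci * y * lambda) * u0 x y)%C.

Definition half_space_hat (u0 : R -> R -> C) (kappa : R) (lambda : C) : C :=
  int_R (fun x => int_pos (fun y => hat_integrand u0 kappa lambda x y)).

Definition ex_half_space_hat (u0 : R -> R -> C) (kappa : R) (lambda : C) : Prop :=
  (forall x, ex_int_pos (fun y => hat_integrand u0 kappa lambda x y)) /\
  ex_int_R (fun x => int_pos (fun y => hat_integrand u0 kappa lambda x y)).

Definition x_integrand (g0 : R -> R -> C) (kappa tau x : R) : C :=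
  (Cexp (- (Ci * x * kappa)) * g0 x tau)%C.

Definition tilde_integrand (g0 : R -> R -> C) (kappa : R) (eta : C) (tau : R) : C :=
  (Cexp (eta * tau) * int_R (fun x => x_integrand g0 kappa tau x))%C.

Definition t_tilde (g0 : R -> R -> C) (kappa : R) (eta : C) (t : R) : C :=
  RInt (V := C_R_CompleteNormedModule) (tilde_integrand g0 kappa eta) 0 t.

(** The value [tau = 0], where [g0] need not be controlled, does not affect the
    integral over [[0, t]]. *)
Definition ex_t_tilde (g0 : R -> R -> C) (kappa : R) (eta : C) (t : R) : Prop :=
  (forall tau, 0 < tau <= t -> ex_int_R (fun x => x_integrand g0 kappa tau x)) /\
  ex_RInt (V := C_R_NormedModule) (tilde_integrand g0 kappa eta) 0 t.

Definition E (kappa : R) (lambda : C) (x y t : R) : C :=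
  Cexp (- ((kappa + lambda) ^ 2 * t) + Ci * kappa * x + Ci * lambda * y)%C.

Definition D (kappa : R) (lambda : C) : Prop := Re ((kappa + lambda) ^ 2)%C < 0.

Definition Dplus (kappa : R) (lambda : C) : Prop := D kappa lambda /\ 0 < Im lambda.

(** [Dplus kappa] is the open sector [|Re lambda + kappa| < Im lambda], with
    vertex [- kappa]. Its boundary, oriented with the sector on the left, comes
    in from infinity along the ray of direction [3 PI / 4] and goes out to
    infinity along the ray of direction [PI / 4]; see [boundary_Dplus],
    [Dplus_left_out] and [Dplus_left_in] below. *)

Definition dir (theta : R) : C := (cos theta, sin theta).

Definition ray (kappa theta r : R) : C := (- kappa + r * dir theta)%C.

Definition ray_integrand (kappa theta : R) (f : C -> C) (r : R) : C :=
  (f (ray kappa theta r) * dir theta)%C.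

Definition contour_int (kappa : R) (f : C -> C) : C :=
  (int_pos (ray_integrand kappa (PI / 4) f)
   - int_pos (ray_integrand kappa (3 * (PI / 4)) f))%C.

Definition ex_contour_int (kappa : R) (f : C -> C) : Prop :=
  ex_int_pos (ray_integrand kappa (PI / 4) f) /\
  ex_int_pos (ray_integrand kappa (3 * (PI / 4)) f).

Definition int_R_R (f : R -> C -> C) : C :=
  int_R (fun kappa : R => int_R (fun lambda : R => f kappa lambda)).

Definition ex_int_R_R (f : R -> C -> C) : Prop :=
  (forall kappa : R, ex_int_R (fun lambda : R => f kappa lambda)) /\
  ex_int_R (fun kappa : R => int_R (fun lambda : R => f kappa lambda)).

Definition int_R_contour (f : R -> C -> C) : C :=
  int_R (fun kappa : R => contour_int kappa (f kappa)).

Definition ex_int_R_contour (f : R -> C -> C) : Prop :=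
  (forall kappa, ex_contour_int kappa (f kappa)) /\
  ex_int_R (fun kappa : R => contour_int kappa (f kappa)).

Definition interior_dom (T x y t : R) : Prop := 0 < y /\ 0 < t < T.

Definition closed_dom (T x y t : R) : Prop := 0 <= y /\ 0 <= t <= T.

Definition continuous_on_closed_dom (T : R) (f : R -> R -> R -> C) : Prop :=
  forall x y t, closed_dom T x y t ->
    filterlim (fun p : R * R * R => f (fst (fst p)) (snd (fst p)) (snd p))
      (within (fun p : R * R * R => closed_dom T (fst (fst p)) (snd (fst p)) (snd p))
              (locally (x, y, t)))
      (locally (f x y t)).

Definition is_derive_C (f : R -> C) (s : R) (l : C) : Prop :=
  is_derive (K := R_AbsRing) (V := C_R_NormedModule) f s l.

(** [u] is of class [C^N] up to the boundary: for [i + j + k <= N], [Du i j k] is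
    the partial derivative of [u] of order [i] in [x], [j] in [y] and [k] in [t],
    extended continuously from the open domain to the closed one. *)
Definition CN_up_to_boundary (N : nat) (T : R) (u : R -> R -> R -> C)
    (Du : nat -> nat -> nat -> R -> R -> R -> C) : Prop :=
  (forall x y t, closed_dom T x y t -> Du 0%nat 0%nat 0%nat x y t = u x y t) /\
  (forall i j k, (i + j + k <= N)%nat -> continuous_on_closed_dom T (Du i j k)) /\
  (forall i j k, (i + j + k < N)%nat ->
    forall x y t, interior_dom T x y t ->
      is_derive_C (fun s => Du i j k s y t) x (Du (S i) j k x y t) /\
      is_derive_C (fun s => Du i j k x s t) y (Du i (S j) k x y t) /\
      is_derive_C (fun s => Du i j k x y s) t (Du i j (S k) x y t)).

Definition decays (N : nat) (T : R)
    (Du : nat -> nat -> nat -> R -> R -> R -> C) : Prop :=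
  exists M : R, forall i j k, (i + j + k <= N)%nat ->
    forall x y t, closed_dom T x y t ->
      Cmod (Du i j k x y t) <= M * / (1 + Rabs x + Rabs y) ^ N.

Definition boundary (A : C -> Prop) (z : C) : Prop :=
  forall eps : R, 0 < eps ->
    (exists w, Cmod (w - z)%C < eps /\ A w) /\
    (exists w, Cmod (w - z)%C < eps /\ ~ A w).

Lemma Dplus_sector (kappa : R) (l : C) :
  Dplus kappa l <-> Rabs (Re l + kappa) < Im l.
Proof.
destruct l as [a b]; unfold Dplus, D, Re, Im; simpl.
replace (_ < 0) with ((kappa + a) * (kappa + a) - b * b < 0)
  by (f_equal; ring).
split.
- intros [H1 H2]; apply Rabs_def1; nra.
- intros H; apply Rabs_def2 in H; nra.
Qed.

Lemma sqrt2_inv_pos : 0 < 1 / sqrt 2.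
Proof. apply Rdiv_lt_0_compat; [lra | apply sqrt_lt_R0; lra]. Qed.

Lemma dir_out : dir (PI / 4) = (1 / sqrt 2, 1 / sqrt 2).
Proof. unfold dir; now rewrite cos_PI4, sin_PI4. Qed.

Lemma dir_in : dir (3 * (PI / 4)) = (- (1 / sqrt 2), 1 / sqrt 2).
Proof.
unfold dir; rewrite cos_3PI4, sin_3PI4; f_equal; unfold Rdiv; ring.
Qed.

Lemma Dplus_left_out (kappa r delta : R) : 0 < r -> 0 < delta ->
  Dplus kappa (ray kappa (PI / 4) r + delta * (Ci * dir (PI / 4)))%C.
Proof.
intros Hr Hd; apply Dplus_sector; unfold ray; rewrite dir_out; unfold Re, Im; simpl.
pose proof sqrt2_inv_pos; apply Rabs_def1; nra.
Qed.

Lemma Dplus_left_in (kappa r delta : R) : 0 < r -> 0 < delta ->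
  Dplus kappa
    (ray kappa (3 * (PI / 4)) r + delta * (Ci * - dir (3 * (PI / 4))))%C.
Proof.
intros Hr Hd; apply Dplus_sector; unfold ray; rewrite dir_in; unfold Re, Im; simpl.
pose proof sqrt2_inv_pos; apply Rabs_def1; nra.
Qed.

Lemma boundary_Dplus (kappa : R) (l : C) :
  boundary (Dplus kappa) l <->
  exists r, 0 <= r /\
    (l = ray kappa (PI / 4) r \/ l = ray kappa (3 * (PI / 4)) r).
Proof.
transitivity (Rabs (Re l + kappa) = Im l).
- split.
  + intros H.
    assert (K : forall w, Rabs (Re w + kappa) - Im w
                 <= Rabs (Re l + kappa) - Im l + 2 * Cmod (w - l)%C /\
               Rabs (Re l + kappa) - Im l
                 <= Rabs (Re w + kappa) - Im w + 2 * Cmod (w - l)%C).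
    { intros w.
      pose proof (Rmax_Cmod (w - l)%C) as Hm.
      pose proof (Rle_trans _ _ _ (Rmax_l _ _) Hm) as H1.
      pose proof (Rle_trans _ _ _ (Rmax_r _ _) Hm) as H2.
      destruct w as [a b], l as [c d]; unfold Re, Im; simpl in *.
      apply Rabs_le_between in H1; apply Rabs_le_between in H2.
      split; unfold Rabs; repeat destruct Rcase_abs; lra. }
    destruct (Rtotal_order (Rabs (Re l + kappa)) (Im l)) as [Hl | [Hl | Hl]];
      [exfalso | exact Hl | exfalso].
    * destruct (H ((Im l - Rabs (Re l + kappa)) / 2)) as [_ [w [Hw Hn]]]; [lra |].
      apply Hn, Dplus_sector; specialize (K w); lra.
    * destruct (H ((Rabs (Re l + kappa) - Im l) / 2)) as [[w [Hw Hn]] _]; [lra |].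
      apply Dplus_sector in Hn; specialize (K w); lra.
  + intros H eps He; split.
    * exists (l + RtoC (eps / 2) * Ci)%C; split.
      -- replace (l + RtoC (eps / 2) * Ci - l)%C with (RtoC (eps / 2) * Ci)%C
           by ring.
         rewrite Cmod_mult, Cmod_R, Cmod_Ci, Rabs_pos_eq; lra.
      -- apply Dplus_sector; destruct l as [a b]; unfold Re, Im in *; simpl in *.
         replace (a + (eps / 2 * 0 - 0 * 1) + kappa) with (a + kappa) by ring; lra.
    * exists l; split.
      -- replace (l - l)%C with (RtoC 0) by ring. rewrite Cmod_0; exact He.
      -- intros Hn; apply Dplus_sector in Hn; lra.
- pose proof sqrt2_inv_pos as Hs; split.
  + intros H; exists (Im l / (1 / sqrt 2)); split.
    * apply Rdiv_le_0_compat; [rewrite <- H; apply Rabs_pos | exact Hs].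
    * unfold ray; rewrite dir_out, dir_in.
      destruct l as [a b]; unfold Re, Im in *; simpl in *.
      set (s := 1 / sqrt 2) in *.
      unfold Rabs in H; destruct Rcase_abs; [right | left];
        apply injective_projections; simpl; subst b; field; lra.
  + intros [r [Hr [-> | ->]]]; unfold ray; [rewrite dir_out | rewrite dir_in];
      unfold Re, Im; simpl; set (s := 1 / sqrt 2) in *.
    * rewrite Rabs_pos_eq; nra.
    * rewrite Rabs_left1; nra.
Qed.

(* Main.v *)
Require Import Defs.
From Stdlib Require Import Reals.
From Coquelicot Require Import Coquelicot.
From Stdlib Require Import Lra Lia Psatz ClassicalEpsilon FunctionalExtensionality
  PropExtensionality.
Open Scope R_scope.

(** Put [lambda = z - kappa]: then [E] becomes [exp (i kappa (x - y)) exp (- z^2 t + i z y)], the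
    contour becomes a fixed pair of rays in [z], and the problem is, for each value [c] of [x - y],
    the heat equation on a half line for [v (s, t) = u (c + s, s, t)], Fourier transformed in [c].
    For [z] real, respectively on the contour and [a > 0], the integral of [exp (- z^2 t + i z a)]
    is [2 PI] times the heat kernel at [a]; on the contour this follows by rotating each ray to the
    real axis. By Fubini the inner integrals thus turn into integrals of [v (s, 0)] and [v (0, tau)]
    against heat kernels, and Fourier inversion in [kappa] replaces the transforms by [v] itself.
    The formula becomes the classical representation of the half-line Dirichlet problem by image
    charges, which is Green's identity for [v] and the reflected heat kernel.

    All integrands are dominated by [M / (1 + x^2)], whose primitive is [M atan x]; Cauchy criterion,
    dominated convergence and Fubini for improper Riemann integrals are derived from this. *)

(** * Continuity and derivatives of complex-valued functions *)

(** With [z = lambda + kappa], [z^2] is purely imaginary on the two rays, so [exp (- z^2 s)] has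
    modulus 1 there for every [s], and convergence comes from [exp (i z a)] with [a >= y > 0] alone.
    Hence the contour integrals are dominated uniformly in [tau] up to [tau = t], where the heat
    kernel degenerates: Fubini is applied on the rays themselves, and they are rotated only
    afterwards, at fixed positive times.

    Two limits remain, in Fourier inversion and in Green's identity near the final time. Both are
    regularised at time [d^2]; a substitution with scale [2 d] then gives integrals that are
    continuous in [d] up to [d = 0], so that evaluation at 0 takes the place of an approximate
    identity.

    The decay [(1 + |x| + |y|)^-4] splits into the weights of [x] and of [y], and two derivatives in
    [x] give the transform the weight of [kappa]. Since the derivative relations hold in the open
    domain only, the solution is composed with a retraction and estimates are carried to the
    boundary by continuity. *)

Definition cts {T : UniformSpace} (f : T -> C) : Prop := forall p, continuous f p.
Definition ctsR {T : UniformSpace} (f : T -> R) : Prop := forall p, continuous f p.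

Lemma norm_Cmod (z : C) : norm (V := C_R_NormedModule) z = Cmod z.
Proof.
change (sqrt (Rabs (fst z) ^ 2 + Rabs (snd z) ^ 2) = sqrt (fst z ^ 2 + snd z ^ 2)).
now rewrite !RPow_abs, !Rabs_pos_eq by apply pow2_ge_0.
Qed.

Lemma cts_pair {T : UniformSpace} (f g : T -> R) :
  ctsR f -> ctsR g -> cts (fun p => (f p, g p) : C).
Proof.
intros Hf Hg p.
apply (continuous_comp_2 f g (fun x y => (x, y) : C)); [apply Hf | apply Hg |].
apply (continuous_ext (fun q : R * R => q)); [now intros [a b] | apply continuous_id].
Qed.

Lemma ctsR_fst {T : UniformSpace} (f : T -> C) : cts f -> ctsR (fun p => fst (f p)).
Proof.
intros Hf p; apply (continuous_comp f fst); [apply Hf |].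
destruct (f p); apply continuous_fst.
Qed.

Lemma ctsR_snd {T : UniformSpace} (f : T -> C) : cts f -> ctsR (fun p => snd (f p)).
Proof.
intros Hf p; apply (continuous_comp f snd); [apply Hf |].
destruct (f p); apply continuous_snd.
Qed.

Lemma ctsR_const {T : UniformSpace} (c : R) : ctsR (fun _ : T => c).
Proof. intros p; apply continuous_const. Qed.

Lemma ctsR_id : ctsR (fun x : R => x).
Proof. intros p; apply continuous_id. Qed.

Lemma ctsR_plus {T : UniformSpace} (f g : T -> R) :
  ctsR f -> ctsR g -> ctsR (fun p => f p + g p).
Proof. intros Hf Hg p; apply (continuous_plus f g); auto. Qed.

Lemma ctsR_opp {T : UniformSpace} (f : T -> R) : ctsR f -> ctsR (fun p => - f p).
Proof. intros Hf p; apply (continuous_opp f); auto. Qed.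

Lemma ctsR_minus {T : UniformSpace} (f g : T -> R) :
  ctsR f -> ctsR g -> ctsR (fun p => f p - g p).
Proof. intros Hf Hg p; apply (continuous_minus f g); auto. Qed.

Lemma ctsR_mult {T : UniformSpace} (f g : T -> R) :
  ctsR f -> ctsR g -> ctsR (fun p => f p * g p).
Proof. intros Hf Hg p; apply (continuous_mult f g); auto. Qed.

Lemma ctsR_comp {T : UniformSpace} (h : R -> R) (f : T -> R) :
  ctsR h -> ctsR f -> ctsR (fun p => h (f p)).
Proof. intros Hh Hf p; apply (continuous_comp f h); auto. Qed.

Lemma ctsR_inv {T : UniformSpace} (f : T -> R) :
  (forall p, f p <> 0) -> ctsR f -> ctsR (fun p => / f p).
Proof.
intros H Hf p; apply (continuous_comp f Rinv); [apply Hf |].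
apply continuity_pt_filterlim, continuity_pt_inv; [| apply H].
apply continuity_pt_filterlim, continuous_id.
Qed.

Lemma ctsR_pow {T : UniformSpace} (f : T -> R) n : ctsR f -> ctsR (fun p => f p ^ n).
Proof.
intros H; induction n as [| n IH]; simpl; [apply ctsR_const | now apply ctsR_mult].
Qed.

Lemma ctsR_exp {T : UniformSpace} (f : T -> R) : ctsR f -> ctsR (fun p => exp (f p)).
Proof. apply (ctsR_comp exp); intros x; apply continuous_exp. Qed.

Lemma ctsR_cos {T : UniformSpace} (f : T -> R) : ctsR f -> ctsR (fun p => cos (f p)).
Proof. apply (ctsR_comp cos); intros x; apply continuous_cos. Qed.

Lemma ctsR_sin {T : UniformSpace} (f : T -> R) : ctsR f -> ctsR (fun p => sin (f p)).
Proof. apply (ctsR_comp sin); intros x; apply continuous_sin. Qed.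

Lemma ctsR_Rabs {T : UniformSpace} (f : T -> R) : ctsR f -> ctsR (fun p => Rabs (f p)).
Proof. apply (ctsR_comp Rabs); intros x; apply continuous_Rabs. Qed.

(** Reduces the continuity of [Rmax] to that of [Rabs]; likewise for [Rmin] below. *)
Lemma Rmax_abs (a b : R) : Rmax a b = (a + b + Rabs (a - b)) / 2.
Proof. unfold Rmax, Rabs; destruct Rle_dec, Rcase_abs; lra. Qed.

Lemma Rmin_abs (a b : R) : Rmin a b = (a + b - Rabs (a - b)) / 2.
Proof. unfold Rmin, Rabs; destruct Rle_dec, Rcase_abs; lra. Qed.

Lemma ctsR_ext {T : UniformSpace} (f g : T -> R) :
  (forall p, f p = g p) -> ctsR f -> ctsR g.
Proof. intros H Hf p; apply (continuous_ext f); auto. Qed.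

Lemma ctsR_Rmax {T : UniformSpace} (f g : T -> R) :
  ctsR f -> ctsR g -> ctsR (fun p => Rmax (f p) (g p)).
Proof.
intros Hf Hg; eapply ctsR_ext; [intros; symmetry; apply Rmax_abs |].
apply ctsR_mult; [| apply ctsR_const].
apply ctsR_plus; [now apply ctsR_plus | now apply ctsR_Rabs, ctsR_minus].
Qed.

Lemma ctsR_Rmin {T : UniformSpace} (f g : T -> R) :
  ctsR f -> ctsR g -> ctsR (fun p => Rmin (f p) (g p)).
Proof.
intros Hf Hg; eapply ctsR_ext; [intros; symmetry; apply Rmin_abs |].
apply ctsR_mult; [| apply ctsR_const].
apply ctsR_minus; [now apply ctsR_plus | now apply ctsR_Rabs, ctsR_minus].
Qed.

Lemma cts_const {T : UniformSpace} (c : C) : cts (fun _ : T => c).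
Proof. intros p; apply continuous_const. Qed.

Lemma cts_RtoC {T : UniformSpace} (f : T -> R) : ctsR f -> cts (fun p => RtoC (f p)).
Proof. intros H; apply cts_pair; [exact H | apply ctsR_const]. Qed.

Lemma cts_plus {T : UniformSpace} (f g : T -> C) :
  cts f -> cts g -> cts (fun p => f p + g p)%C.
Proof.
intros Hf Hg; apply cts_pair; apply ctsR_plus; auto using @ctsR_fst, @ctsR_snd.
Qed.

Lemma cts_opp {T : UniformSpace} (f : T -> C) : cts f -> cts (fun p => - f p)%C.
Proof.
intros Hf; apply cts_pair; apply ctsR_opp; auto using @ctsR_fst, @ctsR_snd.
Qed.

Lemma cts_minus {T : UniformSpace} (f g : T -> C) :
  cts f -> cts g -> cts (fun p => f p - g p)%C.
Proof. intros Hf Hg; apply cts_plus; [exact Hf | now apply cts_opp]. Qed.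

Lemma cts_mult {T : UniformSpace} (f g : T -> C) :
  cts f -> cts g -> cts (fun p => f p * g p)%C.
Proof.
intros Hf Hg; apply cts_pair; [apply ctsR_minus | apply ctsR_plus]; apply ctsR_mult;
  auto using @ctsR_fst, @ctsR_snd.
Qed.

Lemma cts_pow {T : UniformSpace} (f : T -> C) n : cts f -> cts (fun p => Cpow (f p) n).
Proof.
intros H; induction n as [| n IH]; simpl; [apply cts_const | now apply cts_mult].
Qed.

Lemma cts_Cexp {T : UniformSpace} (f : T -> C) : cts f -> cts (fun p => Cexp (f p)).
Proof.
intros H; apply cts_mult; [apply cts_RtoC, ctsR_exp, ctsR_fst, H |].
apply cts_pair; [apply ctsR_cos | apply ctsR_sin]; apply ctsR_snd, H.
Qed.

Lemma ctsR_Cmod {T : UniformSpace} (f : T -> C) : cts f -> ctsR (fun p => Cmod (f p)).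
Proof.
intros H; apply (ctsR_comp sqrt).
- intros x; apply continuous_sqrt.
- apply ctsR_plus; apply ctsR_pow; [apply ctsR_fst | apply ctsR_snd]; exact H.
Qed.

Lemma cts_comp1 {T : UniformSpace} (h : R -> C) (a : T -> R) :
  cts h -> ctsR a -> cts (fun p => h (a p)).
Proof. intros Hh Ha p; apply (continuous_comp a h); auto. Qed.

Lemma cts_comp2 {T : UniformSpace} (h : R -> R -> C) (a b : T -> R) :
  cts (fun q : R * R => h (fst q) (snd q)) -> ctsR a -> ctsR b ->
  cts (fun p => h (a p) (b p)).
Proof. intros Hh Ha Hb p; apply (continuous_comp_2 a b h); auto. Qed.

Lemma cts_comp3 {T : UniformSpace} (h : R -> R -> R -> C) (a b c : T -> R) :
  cts (fun q : R * R * R => h (fst (fst q)) (snd (fst q)) (snd q)) ->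
  ctsR a -> ctsR b -> ctsR c -> cts (fun p => h (a p) (b p) (c p)).
Proof.
intros Hh Ha Hb Hc p.
apply (continuous_comp_2 (fun p => (a p, b p)) c
  (fun q z => h (fst q) (snd q) z)); auto.
apply cts_pair; auto.
Qed.

Lemma proj_continuous {T : UniformSpace} {U V : UniformSpace} (f : T -> U * V) :
  (forall p, continuous f p) ->
  (forall p, continuous (fun q => fst (f q)) p) /\
  (forall p, continuous (fun q => snd (f q)) p).
Proof.
intros H; split; intros p.
- apply (continuous_comp f fst); [apply H | destruct (f p); apply continuous_fst].
- apply (continuous_comp f snd); [apply H | destruct (f p); apply continuous_snd].
Qed.

(** Continuity of composites such as [fst (fst p)]: projections are peeled off until the identity is
    left. *)
Ltac cts_proj :=
  let p := fresh "p" in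
  intros p;
  repeat first
    [ apply continuous_id
    | refine (proj1 (proj_continuous _ _) _); clear p; intros p
    | refine (proj2 (proj_continuous _ _) _); clear p; intros p ].

(** One step of a syntax-directed proof of continuity. Hypotheses on functions of two or three
    variables are recognised in uncurried form, which is why joint continuity is always stated with
    [fst] and [snd]. Nonvanishing of denominators is left as a side goal. *)
Ltac cts_step :=
  first [match goal with H : ?P |- ?P => exact H end |
  lazymatch goal with
  | |- ctsR (fun _ => ?c) => apply ctsR_const
  | |- cts (fun _ => ?c) => apply cts_const
  | |- ctsR (fun p => p) => apply ctsR_id
  | |- ctsR (fun p => _ + _) => apply ctsR_plus
  | |- ctsR (fun p => _ - _) => apply ctsR_minus
  | |- ctsR (fun p => _ * _) => apply ctsR_mult
  | |- ctsR (fun p => _ / _) => apply ctsR_mult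
  | |- ctsR (fun p => - _) => apply ctsR_opp
  | |- ctsR (fun p => / _) => apply ctsR_inv
  | |- ctsR (fun p => _ ^ _) => apply ctsR_pow
  | |- ctsR (fun p => exp _) => apply ctsR_exp
  | |- ctsR (fun p => cos _) => apply ctsR_cos
  | |- ctsR (fun p => sin _) => apply ctsR_sin
  | |- ctsR (fun p => Rabs _) => apply ctsR_Rabs
  | |- ctsR (fun p => Rmax _ _) => apply ctsR_Rmax
  | |- ctsR (fun p => Rmin _ _) => apply ctsR_Rmin
  | |- ctsR (fun p => Cmod _) => apply ctsR_Cmod
  | |- cts (fun p => Cplus _ _) => apply cts_plus
  | |- cts (fun p => Cminus _ _) => apply cts_minus
  | |- cts (fun p => Cmult _ _) => apply cts_mult
  | |- cts (fun p => Copp _) => apply cts_opp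
  | |- cts (fun p => RtoC _) => apply cts_RtoC
  | |- cts (fun p => Cexp _) => apply cts_Cexp
  | |- cts (fun p => Cpow _ _) => apply cts_pow
  | |- cts (fun p => (_, _)) => apply cts_pair
  | |- ctsR (fun p => fst _) => first [solve [cts_proj] | apply ctsR_fst]
  | |- ctsR (fun p => snd _) => first [solve [cts_proj] | apply ctsR_snd]
  | H : cts (fun q => ?h (fst (fst q)) (snd (fst q)) (snd q)) |- cts (fun p => ?h _ _ _) =>
      apply (cts_comp3 h); [exact H | | |]
  | H : cts (fun q => ?h (fst q) (snd q)) |- cts (fun p => ?h _ _) =>
      apply (cts_comp2 h); [exact H | |]
  | H : cts (fun q => ?h q) |- cts (fun p => ?h _) => apply (cts_comp1 h); [exact H |]
  | H : cts ?h |- cts (fun p => ?h _) => apply (cts_comp1 h); [exact H |]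
  | H : ctsR ?h |- ctsR (fun p => ?h _) => apply (ctsR_comp h); [exact H |]
  | |- ctsR (Rmult ?x) => change (ctsR (fun p : R => x * p))
  | |- ctsR (Rplus ?x) => change (ctsR (fun p : R => x + p))
  | |- ctsR (Rminus ?x) => change (ctsR (fun p : R => x - p))
  | |- ctsR Ropp => exact (ctsR_opp (fun x : R => x) ctsR_id)
  | |- ctsR Rabs => exact (ctsR_Rabs (fun x : R => x) ctsR_id)
  | |- cts RtoC => exact (cts_RtoC (fun x : R => x) ctsR_id)
  | |- ctsR fst => cts_proj
  | |- ctsR snd => cts_proj
  | _ => assumption
  end].

Ltac cts_tac := repeat cts_step.



(** * Derivatives of complex-valued functions of a real variable *)

Lemma dC_pair (f g : R -> R) (x l m : R) :
  is_derive f x l -> is_derive g x m -> is_derive_C (fun t => (f t, g t)) x (l, m).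
Proof.
intros Hf Hg; unfold is_derive_C, is_derive.
apply (filterdiff_ext_lin _ (fun y : R => (scal y l, scal y m) : C)); [| easy].
apply (filterdiff_comp'_2 (W := C_R_NormedModule) f g (fun u v => (u, v)) x
  (fun y => scal y l) (fun y => scal y m) (fun u v => (u, v))); try assumption.
apply (filterdiff_ext (fun t : R * R => t)); [now intros [a b] |].
apply (filterdiff_ext_lin _ (fun t : R * R => t)); [| now intros [a b]].
apply filterdiff_id.
Qed.

Lemma dC_fst (f : R -> C) (x : R) (l : C) :
  is_derive_C f x l -> is_derive (fun t => fst (f t)) x (fst l).
Proof.
intros H; unfold is_derive.
apply (filterdiff_comp (V := C_R_NormedModule) f fst (fun y => scal y l) fst H).
apply filterdiff_linear, is_linear_fst.
Qed.

Lemma dC_snd (f : R -> C) (x : R) (l : C) :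
  is_derive_C f x l -> is_derive (fun t => snd (f t)) x (snd l).
Proof.
intros H; unfold is_derive.
apply (filterdiff_comp (V := C_R_NormedModule) f snd (fun y => scal y l) snd H).
apply filterdiff_linear, is_linear_snd.
Qed.

Lemma dC_ext (f g : R -> C) (x : R) (l : C) :
  (forall t, f t = g t) -> is_derive_C f x l -> is_derive_C g x l.
Proof. intros H; apply is_derive_ext, H. Qed.

Lemma dC_eq (f : R -> C) (x : R) (l m : C) :
  is_derive_C f x l -> l = m -> is_derive_C f x m.
Proof. now intros H <-. Qed.

Lemma dC_const (c : C) (x : R) : is_derive_C (fun _ => c) x 0.
Proof. apply (is_derive_const (V := C_R_NormedModule)). Qed.

Lemma dC_RtoC (f : R -> R) (x l : R) :
  is_derive f x l -> is_derive_C (fun t => RtoC (f t)) x l.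
Proof. intros H; apply dC_pair; [exact H | apply (is_derive_const (V := R_NormedModule))]. Qed.

Lemma dC_plus (f g : R -> C) (x : R) (l m : C) :
  is_derive_C f x l -> is_derive_C g x m ->
  is_derive_C (fun t => f t + g t)%C x (l + m)%C.
Proof. apply (is_derive_plus (V := C_R_NormedModule)). Qed.

Lemma dC_minus (f g : R -> C) (x : R) (l m : C) :
  is_derive_C f x l -> is_derive_C g x m ->
  is_derive_C (fun t => f t - g t)%C x (l - m)%C.
Proof. apply (is_derive_minus (V := C_R_NormedModule)). Qed.

Lemma dC_opp (f : R -> C) (x : R) (l : C) :
  is_derive_C f x l -> is_derive_C (fun t => - f t)%C x (- l)%C.
Proof. apply (is_derive_opp (V := C_R_NormedModule)). Qed.

Lemma dR_mult (f g : R -> R) (x l m : R) :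
  is_derive f x l -> is_derive g x m ->
  is_derive (fun t => f t * g t) x (l * g x + f x * m).
Proof. intros Hf Hg; apply (is_derive_mult f g); auto; apply Rmult_comm. Qed.

Lemma dC_mult (f g : R -> C) (x : R) (l m : C) :
  is_derive_C f x l -> is_derive_C g x m ->
  is_derive_C (fun t => f t * g t)%C x (l * g x + f x * m)%C.
Proof.
intros Hf Hg.
pose proof (dC_fst _ _ _ Hf) as F1; pose proof (dC_snd _ _ _ Hf) as F2.
pose proof (dC_fst _ _ _ Hg) as G1; pose proof (dC_snd _ _ _ Hg) as G2.
apply (dC_eq (fun t => f t * g t)%C x
  (fst l * fst (g x) + fst (f x) * fst m - (snd l * snd (g x) + snd (f x) * snd m),
   fst l * snd (g x) + fst (f x) * snd m + (snd l * fst (g x) + snd (f x) * fst m))).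
- apply dC_pair.
  + apply (is_derive_minus (V := R_NormedModule)); now apply dR_mult.
  + apply (is_derive_plus (V := R_NormedModule)); now apply dR_mult.
- apply injective_projections; simpl; ring.
Qed.

Lemma dC_Cexp (f : R -> C) (x : R) (l : C) :
  is_derive_C f x l -> is_derive_C (fun t => Cexp (f t)) x (l * Cexp (f x))%C.
Proof.
intros Hf.
pose proof (dC_fst _ _ _ Hf) as F1; pose proof (dC_snd _ _ _ Hf) as F2.
apply dC_eq with
  (Cplus (Cmult (RtoC (fst l * exp (fst (f x)))) (cos (snd (f x)), sin (snd (f x))))
   (Cmult (RtoC (exp (fst (f x)))) (- (snd l * sin (snd (f x))), snd l * cos (snd (f x))))).
- apply (dC_mult (fun t => RtoC (exp (fst (f t))))
    (fun t => (cos (snd (f t)), sin (snd (f t)))) x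
    (RtoC (fst l * exp (fst (f x)))) (- (snd l * sin (snd (f x))), snd l * cos (snd (f x))));
    [apply dC_RtoC | apply dC_pair].
  + apply (is_derive_comp exp (fun t => fst (f t))); [apply is_derive_exp | exact F1].
  + replace (- (snd l * sin (snd (f x)))) with (scal (snd l) (- sin (snd (f x))))
      by (unfold scal; simpl; unfold mult; simpl; ring).
    apply (is_derive_comp cos (fun t => snd (f t))); [apply is_derive_cos | exact F2].
  + apply (is_derive_comp sin (fun t => snd (f t))); [apply is_derive_sin | exact F2].
- unfold Cexp, Re, Im; apply injective_projections; simpl; ring.
Qed.

Lemma dC_comp (f : R -> C) (g : R -> R) (x m : R) (l : C) :
  is_derive_C f (g x) l -> is_derive g x m ->
  is_derive_C (fun t => f (g t)) x (m * l)%C.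
Proof.
intros Hf Hg; eapply dC_eq; [exact (is_derive_comp (V := C_R_NormedModule) f g x l m Hf Hg) |].
apply injective_projections; simpl; unfold scal; simpl; unfold mult; simpl; ring.
Qed.

Lemma Cexp_plus (z w : C) : Cexp (z + w)%C = (Cexp z * Cexp w)%C.
Proof.
unfold Cexp, Re, Im; simpl; rewrite exp_plus, cos_plus, sin_plus.
apply injective_projections; simpl; ring.
Qed.

Lemma Cmod_Cexp (z : C) : Cmod (Cexp z) = exp (Re z).
Proof.
unfold Cexp; rewrite Cmod_mult, Cmod_R, Rabs_pos_eq by (left; apply exp_pos).
replace (Cmod (cos (Im z), sin (Im z))) with 1; [ring |].
unfold Cmod; simpl; rewrite <- sqrt_1 at 1; f_equal.
pose proof (sin2_cos2 (Im z)); unfold Rsqr in *; lra.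
Qed.

Lemma Cexp_0 : Cexp 0 = 1.
Proof.
unfold Cexp; simpl; rewrite exp_0, cos_0, sin_0; apply injective_projections; simpl; ring.
Qed.

(** * Integrals over compact intervals *)

Lemma norm_RInt_le_const_V {V : NormedModule R_AbsRing} (f : R -> V) (a b M : R) (l : V) :
  a <= b -> (forall x, a <= x <= b -> norm (f x) <= M) -> is_RInt f a b l ->
  norm l <= M * (b - a).
Proof.
intros Hab H Hl.
apply (norm_RInt_le f (fun _ => M) a b l _ Hab H Hl).
replace (M * (b - a)) with (scal (b - a) M) by (unfold scal; simpl; unfold mult; simpl; ring).
apply (is_RInt_const (V := R_NormedModule)).
Qed.

Lemma norm_minus_le {V : NormedModule R_AbsRing} (x y z : V) :
  norm (minus x y) <= norm (minus x z) + norm (minus y z).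
Proof.
rewrite (minus_trans z x y); eapply Rle_trans; [apply norm_triangle |].
rewrite <- (norm_opp (minus z y)), opp_minus; apply Rle_refl.
Qed.

(** Uniform continuity by compactness: near [p] the integrand varies by at most [2 eta]
    simultaneously for all points of [[a, b]]. The general target [V] serves real and complex
    integrands at once. *)
Lemma continuous_RInt_param_V {T : UniformSpace} {V : CompleteNormedModule R_AbsRing}
    (f : T -> R -> V) (a b : R) (p : T) :
  a <= b -> (forall q, continuous (fun q : T * R => f (fst q) (snd q)) q) ->
  continuous (fun p => RInt (f p) a b) p.
Proof.
intros Hab Hf.
assert (Hs : forall q x, continuous (f q) x).
{ intros q x; apply (continuous_comp_2 (fun _ => q) (fun x => x) f);
    [apply continuous_const | apply continuous_id | apply Hf]. }
assert (Hi : forall q, is_RInt (f q) a b (RInt (f q) a b)).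
{ intros q; apply (RInt_correct (V := V)), ex_RInt_continuous; intros; apply Hs. }
apply filterlim_locally; intros eps.
(* Chosen so that [2 eta (b - a) < eps], also when [a = b]. *)
set (eta := eps / (2 * (b - a) + 1)).
assert (Heta : 0 < eta) by (apply Rdiv_lt_0_compat; [apply cond_pos | lra]).
(* Balls and norms of [V] agree only up to [norm_factor]. *)
assert (Hk : 0 < eta / norm_factor (V := V))
  by (apply Rdiv_lt_0_compat; [exact Heta | apply norm_factor_gt_0]).
assert (Hloc : forall t : R, exists d : posreal, forall q x, ball p d q -> ball t d x ->
    norm (minus (f q x) (f p t)) < eta).
{ intros t.
  destruct (proj1 (filterlim_locally _ _) (Hf (p, t)) (mkposreal _ Hk)) as [d Hd].
  exists d; intros q x Hq Hx.
  assert (Hb : ball (p, t) d (q, x)) by now split.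
  eapply Rlt_le_trans; [exact (norm_compat2 (V := V) _ _ (mkposreal _ Hk) (Hd (q, x) Hb)) |].
  simpl; apply Req_le; field; apply Rgt_not_eq, norm_factor_gt_0. }
set (delta := fun t => proj1_sig (constructive_indefinite_description _ (Hloc t))).
assert (Hdelta : forall t q x, ball p (delta t) q -> ball t (delta t) x ->
    norm (minus (f q x) (f p t)) < eta).
{ intros t; exact (proj2_sig (constructive_indefinite_description _ (Hloc t))). }
destruct (compactness_value_1d a b delta) as [d Hd].
exists d; intros q Hq.
apply (norm_compat1 (V := V)).
apply Rle_lt_trans with (2 * eta * (b - a)).
- apply (norm_RInt_le_const_V (fun x => minus (f q x) (f p x)) a b); [exact Hab | |].
  (* [compactness_value_1d] gives its covering point under a double negation, hence the argument by
     contradiction. *)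
  + intros x Hx; apply Rnot_lt_le; intros Hlt; apply (Hd x Hx); intros [t [Ht [Hxt Hdt]]].
    assert (B : ball t (delta t) x) by exact Hxt.
    pose proof (Hdelta t q x (ball_le _ _ _ Hdt _ Hq) B) as H1.
    pose proof (Hdelta t p x (ball_center _ _) B) as H2.
    apply (Rlt_not_le _ _ Hlt).
    apply (Rle_trans _ _ _ (norm_minus_le (V := V) (f q x) (f p x) (f p t))).
    apply Rle_trans with (eta + eta); [apply Rplus_le_compat; left; assumption | lra].
  + exact (is_RInt_minus (V := V) (f q) (f p) a b _ _ (Hi q) (Hi p)).
- unfold eta; pose proof (cond_pos eps).
  apply (Rmult_lt_reg_r (2 * (b - a) + 1)); [lra |]; field_simplify; nra.
Qed.

(** As functions of the upper bound [b], both sides vanish at [a] and have the same derivative; for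
    the right side this is differentiation under the integral sign. *)
Lemma Fubini_rect_R (f : R -> R -> R) (a b c d : R) :
  a <= b -> c <= d -> ctsR (fun q : R * R => f (fst q) (snd q)) ->
  RInt (fun x => RInt (fun y => f x y) c d) a b = RInt (fun y => RInt (fun x => f x y) a b) c d.
Proof.
intros Hab Hcd Hf.
assert (Hf' : ctsR (fun q : R * R => f (snd q) (fst q))).
{ intros q; apply (continuous_comp_2 snd fst f); [apply (proj2 (proj_continuous (fun q : R * R => q) (fun p => continuous_id p))) | apply (proj1 (proj_continuous (fun q : R * R => q) (fun p => continuous_id p))) | apply Hf]. }
assert (Hx : forall y x, continuous (fun x => f x y) x).
{ intros y x; apply (continuous_comp_2 (fun x => x) (fun _ => y) f);
    [apply continuous_id | apply continuous_const | apply Hf]. }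
assert (Hy : forall x y, continuous (fun y => f x y) y).
{ intros x y; apply (continuous_comp_2 (fun _ => x) (fun y => y) f);
    [apply continuous_const | apply continuous_id | apply Hf]. }
assert (Hin : forall x, continuous (fun x => RInt (fun y => f x y) c d) x).
{ intros x; apply (continuous_RInt_param_V (V := R_CompleteNormedModule) f); [exact Hcd | exact Hf]. }
set (A := fun b => RInt (fun x => RInt (fun y => f x y) c d) a b).
set (B := fun b => RInt (fun y => RInt (fun x => f x y) a b) c d).
assert (HA : forall t, is_derive A t (RInt (fun y => f t y) c d)).
{ intros t; unfold A.
  apply (is_derive_RInt (V := R_NormedModule) (fun x => RInt (fun y => f x y) c d) _ a).
  - apply filter_forall; intros x; apply (RInt_correct (V := R_CompleteNormedModule)), (ex_RInt_continuous (V := R_CompleteNormedModule)).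
    intros; apply Hin.
  - apply Hin. }
assert (HD : forall t y, is_derive (fun b => RInt (fun x => f x y) a b) t (f t y)).
{ intros t y; apply (is_derive_RInt (V := R_NormedModule) (fun x => f x y) _ a); [| apply Hx].
  apply filter_forall; intros x; apply (RInt_correct (V := R_CompleteNormedModule)), (ex_RInt_continuous (V := R_CompleteNormedModule)).
  intros; apply Hx. }
assert (HB : forall t, a <= t -> is_derive B t (RInt (fun y => f t y) c d)).
{ intros t Hat; unfold B.
  replace (RInt (fun y => f t y) c d)
    with (RInt (fun y => Derive (fun b => RInt (fun x => f x y) a b) t) c d)
    by (apply RInt_ext; intros y _; apply is_derive_unique, HD).
  apply (is_derive_RInt_param (fun b y => RInt (fun x => f x y) a b)).
  - apply filter_forall; intros x y _; eexists; apply HD.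
  - intros y _; apply continuity_2d_pt_ext with (f := f).
    + intros u v; symmetry; apply is_derive_unique, HD.
    + apply continuity_2d_pt_filterlim, (Hf (t, y)).
  - apply filter_forall; intros x.
    apply (ex_RInt_continuous (V := R_CompleteNormedModule)); intros y _.
    (* [continuous_RInt_param_V] wants ordered bounds, while [x] ranges over all reals here. *)
    destruct (Rle_dec a x) as [Hle | Hle].
    + apply (continuous_RInt_param_V (V := R_CompleteNormedModule) (fun y x => f x y)); [exact Hle | exact Hf'].
    + apply (continuous_ext (fun y => opp (RInt (fun x => f x y) x a))).
      * intros z; apply (opp_RInt_swap (V := R_CompleteNormedModule)).
        apply (ex_RInt_continuous (V := R_CompleteNormedModule)); intros; apply Hx.
      * apply (continuous_opp (V := R_NormedModule)).
        apply (continuous_RInt_param_V (V := R_CompleteNormedModule) (fun y x => f x y)); [lra | exact Hf']. }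
assert (HAa : A a = 0) by apply (RInt_point (V := R_CompleteNormedModule)).
assert (HBa : B a = 0).
{ unfold B; rewrite (RInt_ext (V := R_CompleteNormedModule) _ (fun _ => 0)).
  - rewrite (RInt_const (V := R_CompleteNormedModule)); unfold scal; simpl; unfold mult; simpl; ring.
  - intros y _; apply (RInt_point (V := R_CompleteNormedModule)). }
change (A b = B b).
destruct (MVT_gen (fun t => A t - B t) a b (fun _ => 0)) as [z [_ Hz]].
- intros t Ht; rewrite Rmin_left, Rmax_right in Ht by lra.
  replace 0 with (RInt (fun y => f t y) c d - RInt (fun y => f t y) c d) by ring.
  apply (is_derive_minus (V := R_NormedModule)); [apply HA | apply HB; lra].
- intros t Ht; rewrite Rmin_left, Rmax_right in Ht by lra.
  apply continuity_pt_minus; apply continuity_pt_filterlim;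
    apply (ex_derive_continuous (V := R_NormedModule)); eexists; [apply HA | apply HB; lra].
- lra.
Qed.

(** * Integrals of complex-valued functions over compact intervals *)

Definition RIC (f : R -> C) (a b : R) : C := RInt (V := C_R_CompleteNormedModule) f a b.
Definition is_RIC (f : R -> C) (a b : R) (l : C) : Prop :=
  is_RInt (V := C_R_NormedModule) f a b l.

Lemma ball_Cmod (x y : C) (eps : posreal) : Cmod (y - x) < eps -> ball x eps y.
Proof. rewrite <- norm_Cmod; apply (norm_compat1 (V := C_R_NormedModule)). Qed.

(** The balls of [C] are those of the maximum norm; the modulus costs a factor [sqrt 2], rounded up
    to 2. *)
Lemma Cmod_ball (x y : C) (eps : posreal) : ball x eps y -> Cmod (y - x) <= 2 * eps.
Proof.
intros [H1 H2]; unfold ball in H1, H2; simpl in H1, H2; unfold AbsRing_ball in *; simpl in *.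
apply Rle_trans with (1 := Cmod_2Rmax _).
assert (sqrt 2 <= 2).
{ rewrite <- (sqrt_square 2) at 2 by lra; apply sqrt_le_1; lra. }
assert (Rmax (Rabs (fst (y - x)%C)) (Rabs (snd (y - x)%C)) <= eps)
  by (apply Rmax_lub; left; assumption).
apply Rmult_le_compat; try lra; [apply sqrt_pos |].
eapply Rle_trans; [apply Rabs_pos | apply Rmax_l].
Qed.

Lemma cts_slice {T : UniformSpace} (f : T -> R -> C) :
  cts (fun q : T * R => f (fst q) (snd q)) -> forall p, cts (f p).
Proof.
intros Hf p x; apply (continuous_comp_2 (fun _ => p) (fun x => x) f);
  [apply continuous_const | apply continuous_id | apply Hf].
Qed.

Lemma RIC_correct (f : R -> C) (a b : R) : cts f -> is_RIC f a b (RIC f a b).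
Proof.
intros Hf; apply (RInt_correct (V := C_R_CompleteNormedModule)).
apply (ex_RInt_continuous (V := C_R_CompleteNormedModule)); intros; apply Hf.
Qed.

Lemma RIC_unique (f : R -> C) (a b : R) (l : C) : is_RIC f a b l -> RIC f a b = l.
Proof. apply (is_RInt_unique (V := C_R_CompleteNormedModule)). Qed.

Lemma RIC_ext (f g : R -> C) (a b : R) :
  (forall x, Rmin a b < x < Rmax a b -> f x = g x) -> RIC f a b = RIC g a b.
Proof. apply (RInt_ext (V := C_R_CompleteNormedModule)). Qed.

Lemma RIC_swap (f : R -> C) (a b : R) : cts f -> RIC f b a = (- RIC f a b)%C.
Proof.
intros Hf; apply RIC_unique, (is_RInt_swap (V := C_R_NormedModule)), RIC_correct, Hf.
Qed.

Lemma RIC_Chasles (f : R -> C) (a b c : R) :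
  cts f -> RIC f a c = (RIC f a b + RIC f b c)%C.
Proof.
intros Hf; apply RIC_unique.
apply (is_RInt_Chasles (V := C_R_NormedModule) f a b c); apply RIC_correct, Hf.
Qed.

Lemma RIC_minus (f g : R -> C) (a b : R) : cts f -> cts g ->
  RIC (fun x => f x - g x)%C a b = (RIC f a b - RIC g a b)%C.
Proof.
intros Hf Hg; apply RIC_unique.
apply (is_RInt_minus (V := C_R_NormedModule)); apply RIC_correct; assumption.
Qed.

Lemma is_RIC_pair (f : R -> C) (a b : R) (u v : R) :
  is_RInt (fun t => fst (f t)) a b u -> is_RInt (fun t => snd (f t)) a b v ->
  is_RIC f a b (u, v).
Proof. apply (is_RInt_fct_extend_pair f a b u v). Qed.

Lemma RIC_fst (f : R -> C) (a b : R) : cts f -> fst (RIC f a b) = RInt (fun t => fst (f t)) a b.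
Proof.
intros Hf; symmetry; apply is_RInt_unique.
apply (is_RInt_fct_extend_fst (U := R_NormedModule) (V := R_NormedModule)), RIC_correct, Hf.
Qed.

Lemma RIC_snd (f : R -> C) (a b : R) : cts f -> snd (RIC f a b) = RInt (fun t => snd (f t)) a b.
Proof.
intros Hf; symmetry; apply is_RInt_unique.
apply (is_RInt_fct_extend_snd (U := R_NormedModule) (V := R_NormedModule)), RIC_correct, Hf.
Qed.

Lemma is_RIC_Cmult (f : R -> C) (a b : R) (k l : C) :
  is_RIC f a b l -> is_RIC (fun x => k * f x)%C a b (k * l)%C.
Proof.
intros H.
pose proof (is_RInt_fct_extend_fst (U := R_NormedModule) (V := R_NormedModule) _ _ _ _ H) as H1.
pose proof (is_RInt_fct_extend_snd (U := R_NormedModule) (V := R_NormedModule) _ _ _ _ H) as H2.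
apply is_RIC_pair.
- apply (is_RInt_minus (V := R_NormedModule)); apply (is_RInt_scal (V := R_NormedModule)); assumption.
- apply (is_RInt_plus (V := R_NormedModule)); apply (is_RInt_scal (V := R_NormedModule)); assumption.
Qed.

Lemma RIC_bound_const (f : R -> C) (a b M : R) :
  a <= b -> cts f -> (forall x, a <= x <= b -> Cmod (f x) <= M) ->
  Cmod (RIC f a b) <= M * (b - a).
Proof.
intros Hab Hf H; rewrite <- norm_Cmod.
apply (norm_RInt_le_const_V (V := C_R_NormedModule) f a b); [exact Hab | | apply RIC_correct, Hf].
intros x Hx; rewrite norm_Cmod; auto.
Qed.

Lemma weight_pos (x : R) : 0 < 1 + x ^ 2.
Proof. pose proof (pow2_ge_0 x); lra. Qed.

Lemma is_RInt_weight (a b M : R) :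
  is_RInt (fun x => M / (1 + x ^ 2)) a b (M * (atan b - atan a)).
Proof.
apply (is_RInt_scal (V := R_NormedModule) (fun x => / (1 + x ^ 2)) a b M (atan b - atan a)).
apply (is_RInt_derive (V := R_CompleteNormedModule) atan (fun x => / (1 + x ^ 2))).
- intros x _; rewrite <- Rsqr_pow2; apply is_derive_atan.
- intros x _; apply ctsR_inv; [intros; apply Rgt_not_eq, weight_pos |].
  cts_tac.
Qed.

(** The bounds may come in either order, because the Cauchy criterion compares two candidates for
    the same end without knowing which is larger. *)
Lemma RIC_bound (f : R -> C) (a b M : R) :
  cts f -> (forall x, Rmin a b <= x <= Rmax a b -> Cmod (f x) <= M / (1 + x ^ 2)) ->
  Cmod (RIC f a b) <= M * Rabs (atan b - atan a).
Proof.
intros Hf.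
assert (K : forall a b, a <= b ->
  (forall x, a <= x <= b -> Cmod (f x) <= M / (1 + x ^ 2)) ->
  Cmod (RIC f a b) <= M * Rabs (atan b - atan a)).
{ clear a b; intros a b Hab H.
  rewrite Rabs_pos_eq.
  - rewrite <- norm_Cmod.
    apply (norm_RInt_le (V := C_R_NormedModule) f (fun x => M / (1 + x ^ 2)) a b); try assumption.
    + intros x Hx; rewrite norm_Cmod; auto.
    + apply RIC_correct, Hf.
    + apply is_RInt_weight.
  - destruct (Req_dec a b) as [-> | Hn]; [lra |].
    left; apply Rlt_0_minus, atan_increasing; lra. }
intros H; destruct (Rle_dec a b) as [Hab | Hab].
- rewrite Rmin_left, Rmax_right in H by lra; now apply K.
- rewrite Rmin_right, Rmax_left in H by lra.
  rewrite (RIC_swap f b a) by exact Hf; rewrite Cmod_opp, Rabs_minus_sym.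
  apply K; [lra | exact H].
Qed.

Lemma cts_RIC_param {T : UniformSpace} (f : T -> R -> C) (a b : R) :
  a <= b -> cts (fun q : T * R => f (fst q) (snd q)) -> cts (fun p => RIC (f p) a b).
Proof.
intros Hab Hf p; apply (continuous_RInt_param_V (V := C_R_CompleteNormedModule) f); assumption.
Qed.

Lemma cts_swap (f : R -> R -> C) :
  cts (fun q : R * R => f (fst q) (snd q)) -> cts (fun q : R * R => f (snd q) (fst q)).
Proof. intros H; cts_tac. Qed.

Lemma Fubini_rect (f : R -> R -> C) (a b c d : R) :
  a <= b -> c <= d -> cts (fun q : R * R => f (fst q) (snd q)) ->
  RIC (fun x => RIC (fun y => f x y) c d) a b = RIC (fun y => RIC (fun x => f x y) a b) c d.
Proof.
intros Hab Hcd Hf.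
assert (H1 : cts (fun x => RIC (fun y => f x y) c d)) by now apply (cts_RIC_param f).
assert (H2 : cts (fun y => RIC (fun x => f x y) a b))
  by now apply (cts_RIC_param (fun y x => f x y)); [| apply cts_swap].
assert (Hx := cts_slice f Hf).
assert (Hy := cts_slice (fun y x => f x y) (cts_swap f Hf)); simpl in Hy.
apply injective_projections.
- rewrite !RIC_fst by assumption.
  rewrite (RInt_ext (V := R_CompleteNormedModule) _ (fun x => RInt (fun y => fst (f x y)) c d))
    by (intros; apply RIC_fst, Hx).
  rewrite Fubini_rect_R by (try assumption; now apply ctsR_fst).
  apply (RInt_ext (V := R_CompleteNormedModule)); intros; symmetry; apply RIC_fst, Hy.
- rewrite !RIC_snd by assumption.
  rewrite (RInt_ext (V := R_CompleteNormedModule) _ (fun x => RInt (fun y => snd (f x y)) c d))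
    by (intros; apply RIC_snd, Hx).
  rewrite Fubini_rect_R by (try assumption; now apply ctsR_snd).
  apply (RInt_ext (V := R_CompleteNormedModule)); intros; symmetry; apply RIC_snd, Hy.
Qed.

Lemma MVT_zero (f : R -> R) (a b : R) :
  a <= b -> ctsR f -> (forall x, a < x < b -> is_derive f x 0) -> f b = f a.
Proof.
intros Hab Hf H.
destruct (MVT_gen f a b (fun _ => 0)) as [z [_ Hz]].
- intros x Hx; rewrite Rmin_left, Rmax_right in Hx by lra; auto.
- intros x _; apply continuity_pt_filterlim, Hf.
- lra.
Qed.

(** The derivative is asked for in the open interval, since the solution has derivatives in the
    interior of its domain and mere continuity up to the boundary. *)
Lemma FTC (F f : R -> C) (a b : R) :
  a <= b -> cts F -> cts f -> (forall x, a < x < b -> is_derive_C F x (f x)) ->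
  RIC f a b = (F b - F a)%C.
Proof.
intros Hab HF Hf H.
assert (Hd : forall x, is_derive_C (fun x => RIC f a x) x (f x)).
{ intros x; apply (is_derive_RInt (V := C_R_NormedModule) f _ a); [| apply Hf].
  apply filter_forall; intros; now apply RIC_correct. }
assert (Hc : cts (fun x => RIC f a x)).
{ intros x; apply (ex_derive_continuous (V := C_R_NormedModule)); eexists; apply Hd. }
assert (E : (RIC f a b - F b = RIC f a a - F a)%C).
{ assert (K : forall x, a < x < b -> is_derive_C (fun x => RIC f a x - F x)%C x 0).
  { intros x Hx; eapply dC_eq; [apply dC_minus; [apply Hd | now apply H] | ring]. }
  assert (Kc := cts_minus _ _ Hc HF).
  apply injective_projections.
  - apply (MVT_zero (fun x => fst (RIC f a x - F x)%C) a b Hab (ctsR_fst _ Kc)).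
    intros x Hx; exact (dC_fst _ _ _ (K x Hx)).
  - apply (MVT_zero (fun x => snd (RIC f a x - F x)%C) a b Hab (ctsR_snd _ Kc)).
    intros x Hx; exact (dC_snd _ _ _ (K x Hx)). }
assert (E0 : RIC f a a = 0) by apply (RInt_point (V := C_R_CompleteNormedModule)).
rewrite E0 in E.
replace (RIC f a b) with (RIC f a b - F b + F b)%C by ring; rewrite E; ring.
Qed.

(** Both sides are the integral of [S] over the rectangle, evaluated in the two orders. *)
Lemma Green_rect (P Q S : R -> R -> C) (a b c d : R) :
  a <= b -> c <= d ->
  cts (fun q : R * R => P (fst q) (snd q)) -> cts (fun q : R * R => Q (fst q) (snd q)) ->
  cts (fun q : R * R => S (fst q) (snd q)) ->
  (forall x y, a < x < b -> c < y < d -> is_derive_C (fun y => P x y) y (S x y)) ->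
  (forall x y, a < x < b -> c < y < d -> is_derive_C (fun x => Q x y) x (S x y)) ->
  (RIC (fun x => P x d) a b - RIC (fun x => P x c) a b
   = RIC (fun y => Q b y) c d - RIC (fun y => Q a y) c d)%C.
Proof.
intros Hab Hcd HP HQ HS H1 H2.
assert (HP' := cts_swap P HP); assert (HQ' := cts_swap Q HQ).
rewrite <- !RIC_minus by cts_tac.
rewrite (RIC_ext (fun x => P x d - P x c)%C (fun x => RIC (fun y => S x y) c d)).
- rewrite (RIC_ext (fun y => Q b y - Q a y)%C (fun y => RIC (fun x => S x y) a b)).
  + now apply Fubini_rect.
  + intros y Hy; rewrite Rmin_left, Rmax_right in Hy by lra.
    symmetry; apply (FTC (fun x => Q x y)); auto; cts_tac.
- intros x Hx; rewrite Rmin_left, Rmax_right in Hx by lra.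
  symmetry; apply (FTC (fun y => P x y)); auto; cts_tac.
Qed.

(** * Improper integrals with a dominated integrand *)

(* [line], [half] and [seg] below share one theory: [dlo] and [dhi] are the filters of the two ends
   of the domain [din], [dint] leaves out its finite end points, and [dret] is a continuous
   retraction onto [din], with which integrands are extended so as to be continuous on [R]. *)
Record int_domain := {
  dlo : (R -> Prop) -> Prop;
  dhi : (R -> Prop) -> Prop;
  din : R -> Prop;
  dint : R -> Prop;
  dret : R -> R;
  dlo_proper : ProperFilter dlo;
  dhi_proper : ProperFilter dhi;
  dom_ends : filter_prod dlo dhi (fun ab =>
    fst ab <= snd ab /\ din (fst ab) /\ din (snd ab) /\
    forall x, fst ab < x < snd ab -> dint x);
  din_convex : forall a b x, din a -> din b -> a <= x <= b -> din x;
  dret_cts : ctsR dret;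
  dret_in : forall x, din (dret x);
  dret_id : forall x, din x -> dret x = x;
  dint_in : forall x, dint x -> din x;
  dlo_atan : exists l, filterlim atan dlo (locally l);
  dhi_atan : exists l, filterlim atan dhi (locally l) }.

#[global] Existing Instance dlo_proper | 0.
#[global] Existing Instance dhi_proper | 0.

Definition is_int (D : int_domain) (f : R -> C) (l : C) : Prop :=
  is_RInt_gen (V := C_R_NormedModule) f (dlo D) (dhi D) l.

Definition int (D : int_domain) (f : R -> C) : C :=
  RInt_gen (V := C_R_CompleteNormedModule) f (dlo D) (dhi D).

Definition dominated (D : int_domain) (f : R -> C) (M : R) : Prop :=
  forall x, din D x -> Cmod (f x) <= M / (1 + x ^ 2).

Lemma is_int_unique (D : int_domain) (f : R -> C) (l : C) : is_int D f l -> int D f = l.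
Proof.
exact (is_RInt_gen_unique (V := C_R_CompleteNormedModule) (Fa := dlo D) (Fb := dhi D) f l).
Qed.

Lemma is_int_ext (D : int_domain) (f g : R -> C) (l : C) :
  (forall x, dint D x -> f x = g x) -> is_int D f l -> is_int D g l.
Proof.
intros H Hf; refine (is_RInt_gen_ext (V := C_R_NormedModule) (Fa := dlo D) (Fb := dhi D) f g l _ Hf).
apply (filter_imp (F := filter_prod (dlo D) (dhi D))) with (2 := dom_ends D).
intros [a b] [Hab [_ [_ Hi]]] x; simpl in *.
rewrite Rmin_left, Rmax_right by exact Hab; auto.
Qed.

(** [RInt_gen] selects its value by the predicate of being an integral; this predicate is the same
    for [f] and [g], so the values agree whether or not the integrals converge. *)
Lemma int_ext (D : int_domain) (f g : R -> C) :
  (forall x, dint D x -> f x = g x) -> int D f = int D g.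
Proof.
intros H; unfold int, RInt_gen; f_equal.
apply functional_extensionality; intros l; apply propositional_extensionality.
split; apply is_int_ext; intros; [| symmetry]; auto.
Qed.

Lemma int_ext_in (D : int_domain) (f g : R -> C) :
  (forall x, din D x -> f x = g x) -> int D f = int D g.
Proof. intros H; apply int_ext; intros x Hx; apply H, dint_in, Hx. Qed.

(** Passage to the limit in an identity between integrals over compact intervals. It yields complex
    constant factors, whereas [C] is a module over the reals here. *)
Lemma is_int_map (D : int_domain) (f g : R -> C) (L : C -> C) (l : C) :
  continuous L l -> (forall a b v, is_RIC f a b v -> is_RIC g a b (L v)) ->
  is_int D f l -> is_int D g (L l).
Proof.
intros HL H Hf P HP.
refine (filter_imp (F := filter_prod (dlo D) (dhi D)) _ _ _ (Hf (fun v => P (L v)) (HL P HP))).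
intros [a b] [v [Hv HPv]]; exists (L v); split; [now apply H | exact HPv].
Qed.

Lemma is_int_Cmult (D : int_domain) (f : R -> C) (k l : C) :
  is_int D f l -> is_int D (fun x => k * f x)%C (k * l)%C.
Proof.
intros Hf; refine (is_int_map D f _ (fun v => k * v)%C l _ _ Hf).
- assert (K : cts (fun v : C => k * v)%C)
    by (apply cts_mult; [apply cts_const | intros p; apply continuous_id]).
  apply K.
- intros a b v; apply is_RIC_Cmult.
Qed.

Lemma is_int_minus (D : int_domain) (f g : R -> C) (l m : C) :
  is_int D f l -> is_int D g m -> is_int D (fun x => f x - g x)%C (l - m)%C.
Proof. exact (is_RInt_gen_minus (V := C_R_NormedModule) (Fa := dlo D) (Fb := dhi D) f g l m). Qed.

Lemma is_int_plus (D : int_domain) (f g : R -> C) (l m : C) :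
  is_int D f l -> is_int D g m -> is_int D (fun x => f x + g x)%C (l + m)%C.
Proof. exact (is_RInt_gen_plus (V := C_R_NormedModule) (Fa := dlo D) (Fb := dhi D) f g l m). Qed.

(** Each filter is proper, so a witness at one end turns the statement about pairs of end points
    into one about the other end. *)
Lemma dom_sep (D : int_domain) : dlo D (din D) /\ dhi D (din D).
Proof.
destruct (dom_ends D) as [Q1 Q2 H1 H2 H].
destruct (filter_ex _ H1) as [a0 Ha0]; destruct (filter_ex _ H2) as [b0 Hb0].
split.
- eapply filter_imp; [| exact H1]; intros a Ha; apply (H a b0 Ha Hb0).
- eapply filter_imp; [| exact H2]; intros b Hb; apply (H a0 b Ha0 Hb).
Qed.

Lemma din_between (D : int_domain) (a b x : R) :
  din D a -> din D b -> Rmin a b <= x <= Rmax a b -> din D x.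
Proof.
intros Ha Hb; unfold Rmin, Rmax; destruct Rle_dec; [now apply din_convex | now apply din_convex].
Qed.

Lemma is_int_of_filterlim (D : int_domain) (f : R -> C) (l : C) : cts f ->
  filterlim (fun ab => RIC f (fst ab) (snd ab)) (filter_prod (dlo D) (dhi D)) (locally l) ->
  is_int D f l.
Proof.
intros Hf H P HP.
refine (filter_imp (F := filter_prod (dlo D) (dhi D)) _ _ _ (H P HP)).
intros [a b] Hab; exists (RIC f a b); split; [now apply RIC_correct | exact Hab].
Qed.

(* Cauchy criterion and tail estimate at once: the exceptional set of end points depends
   on [eps] only, not on the integrand. *)
Lemma uniform_tail (D : int_domain) (eps : R) : 0 < eps ->
  exists P, filter_prod (dlo D) (dhi D) P /\
  (forall ab, P ab -> fst ab <= snd ab /\ forall x, fst ab <= x <= snd ab -> din D x) /\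
  forall f M, cts f -> 0 <= M -> dominated D f M ->
    is_int D f (int D f) /\
    forall ab, P ab -> Cmod (int D f - RIC f (fst ab) (snd ab)) <= M * eps.
Proof.
assert (Hcauchy : forall eps, 0 < eps ->
  exists P, filter_prod (dlo D) (dhi D) P /\
  (forall ab, P ab -> fst ab <= snd ab /\ forall x, fst ab <= x <= snd ab -> din D x) /\
  forall f M, cts f -> 0 <= M -> dominated D f M ->
    forall ab cd, P ab -> P cd ->
      Cmod (RIC f (fst cd) (snd cd) - RIC f (fst ab) (snd ab)) <= M * eps).
{ clear eps; intros eps He.
  destruct (dlo_atan D) as [la Hla]; destruct (dhi_atan D) as [lb Hlb].
  (* Two admissible values of the same end differ by less than [eps / 2] in [atan], and there are
     two ends. *)
  assert (He4 : 0 < eps / 4) by lra.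
  set (PA := fun a => Rabs (atan a - la) < eps / 4 /\ din D a).
  set (PB := fun b => Rabs (atan b - lb) < eps / 4 /\ din D b).
  assert (HA : dlo D PA).
  { apply filter_and; [| apply dom_sep].
    apply (Hla (fun y => Rabs (y - la) < eps / 4)).
    exists (mkposreal _ He4); intros y Hy; exact Hy. }
  assert (HB : dhi D PB).
  { apply filter_and; [| apply dom_sep].
    apply (Hlb (fun y => Rabs (y - lb) < eps / 4)).
    exists (mkposreal _ He4); intros y Hy; exact Hy. }
  exists (fun ab => (PA (fst ab) /\ PB (snd ab)) /\ fst ab <= snd ab).
  split; [| split].
  - apply filter_and.
    + exists PA PB; auto.
    + eapply filter_imp; [| exact (dom_ends D)]; intros ab [H _]; exact H.
  - intros [a b] [[[_ Ha] [_ Hb]] Hab]; simpl in *; split; [exact Hab |].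
    intros x Hx; now apply (din_convex D a b).
  - intros f M Hf HM Hd [a b] [a' b'] [[[Ha Da] [Hb Db]] _] [[[Ha' Da'] [Hb' Db']] _]; simpl in *.
    (* The two integrals differ by the pieces between [a'] and [a] and between [b] and [b'], which
       [RIC_bound] controls by differences of [atan]. *)
    rewrite (RIC_Chasles f a' a b' Hf), (RIC_Chasles f a b b' Hf).
    replace (RIC f a' a + (RIC f a b + RIC f b b') - RIC f a b)%C
      with (RIC f a' a + RIC f b b')%C by ring.
    eapply Rle_trans; [apply Cmod_triangle |].
    apply Rle_trans with (M * Rabs (atan a - atan a') + M * Rabs (atan b' - atan b)).
    + apply Rplus_le_compat; apply RIC_bound; try assumption; intros x Hx; apply Hd;
        eapply din_between; try exact Hx; assumption.
    + rewrite <- Rmult_plus_distr_l; apply Rmult_le_compat_l; [exact HM |].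
      apply Rabs_def2 in Ha; apply Rabs_def2 in Hb;
        apply Rabs_def2 in Ha'; apply Rabs_def2 in Hb'.
      unfold Rabs; destruct Rcase_abs; destruct Rcase_abs; lra. }
intros He; destruct (Hcauchy eps He) as [P [HP [HP1 HP2]]].
exists P; split; [exact HP | split; [exact HP1 |]].
intros f M Hf HM Hd.
set (F := fun ab : R * R => RIC f (fst ab) (snd ab)).
assert (HF : exists l : C, filterlim F (filter_prod (dlo D) (dhi D)) (locally l)).
{ apply (filterlim_locally_cauchy (U := C_R_CompleteNormedModule)); intros e.
  (* The divisor is [M + 1] because [M] may be 0. *)
  assert (He' : 0 < e / (M + 1)) by (apply Rdiv_lt_0_compat; [apply cond_pos | lra]).
  destruct (Hcauchy _ He') as [P' [HP' [_ HP2']]].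
  exists P'; split; [exact HP' |]; intros u v Hu Hv.
  apply ball_Cmod; refine (Rle_lt_trans _ _ _ (HP2' f M Hf HM Hd u v Hu Hv) _).
  apply (Rmult_lt_reg_r (M + 1)); [lra |]; pose proof (cond_pos e); field_simplify; nra. }
destruct HF as [l Hl].
pose proof (is_int_of_filterlim D f l Hf Hl) as Hi.
rewrite (is_int_unique D f l Hi); split; [exact Hi |].
intros ab Hab; apply le_epsilon; intros eta Heta.
assert (Heta2 : 0 < eta / 2) by lra.
(* Some [cd] in [P] has its integral within [eta] of the limit: the radius is [eta / 2], and
   [Cmod_ball] doubles it. Comparing [ab] with this [cd] gives the tail estimate. *)
assert (Hloc : filter_prod (dlo D) (dhi D) (fun cd => ball l (mkposreal _ Heta2) (F cd) /\ P cd)).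
{ apply filter_and; [| exact HP]. apply (Hl (fun y => ball l (mkposreal _ Heta2) y)).
  now exists (mkposreal _ Heta2). }
destruct (filter_ex _ Hloc) as [cd [Hcd HPcd]].
apply Cmod_ball in Hcd; simpl in Hcd.
specialize (HP2 f M Hf HM Hd ab cd Hab HPcd).
replace (l - RIC f (fst ab) (snd ab))%C
  with ((F cd - RIC f (fst ab) (snd ab)) + - (F cd - l))%C by ring.
eapply Rle_trans; [apply Cmod_triangle |]; rewrite Cmod_opp; unfold F in *; lra.
Qed.

Lemma int_correct (D : int_domain) (f : R -> C) (M : R) :
  cts f -> dominated D f M -> is_int D f (int D f).
Proof.
intros Hf Hd.
destruct (uniform_tail D 1 Rlt_0_1) as [P [_ [_ H]]].
apply (H f (Rmax M 0) Hf (Rmax_r _ _)).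
intros x Hx; eapply Rle_trans; [now apply Hd |].
apply Rmult_le_compat_r; [left; apply Rinv_0_lt_compat, weight_pos | apply Rmax_l].
Qed.

(** The domain is not empty: [dret D 0] is one of its points. *)
Lemma dominated_nonneg (D : int_domain) (f : R -> C) (M : R) : dominated D f M -> 0 <= M.
Proof.
intros H; specialize (H _ (dret_in D 0)).
apply Rmult_le_reg_r with (/ (1 + dret D 0 ^ 2)).
- apply Rinv_0_lt_compat, weight_pos.
- rewrite Rmult_0_l; eapply Rle_trans; [apply Cmod_ge_0 | exact H].
Qed.

(** [PI] bounds the variation of [atan], the primitive of the weight, over every domain. *)
Lemma int_bound (D : int_domain) (f : R -> C) (M : R) :
  cts f -> dominated D f M -> Cmod (int D f) <= M * PI.
Proof.
intros Hf Hd; pose proof (dominated_nonneg _ _ _ Hd) as HM.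
apply le_epsilon; intros eps He.
assert (He' : 0 < eps / (M + 1)) by (apply Rdiv_lt_0_compat; lra).
destruct (uniform_tail D _ He') as [P [HP [HP1 H]]].
destruct (H f M Hf HM Hd) as [_ H'].
destruct (filter_ex _ HP) as [ab Hab].
specialize (H' ab Hab); destruct (HP1 ab Hab) as [Hle Hin].
replace (int D f) with (int D f - RIC f (fst ab) (snd ab) + RIC f (fst ab) (snd ab))%C by ring.
eapply Rle_trans; [apply Cmod_triangle |].
rewrite Rplus_comm; apply Rplus_le_compat.
- eapply Rle_trans; [apply (RIC_bound f _ _ M Hf) |].
  + rewrite Rmin_left, Rmax_right by exact Hle; intros x Hx; now apply Hd, Hin.
  + apply Rmult_le_compat_l; [exact HM |].
    pose proof (atan_bound (fst ab)); pose proof (atan_bound (snd ab)).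
    apply Rabs_le; lra.
- eapply Rle_trans; [exact H' |].
  apply (Rmult_le_reg_r (M + 1)); [lra |]; field_simplify; nra.
Qed.

(** By [uniform_tail] one compact interval approximates the integrals for all parameters near [p],
    and over that interval the integral is continuous in the parameter. *)
Lemma int_continuous {T : UniformSpace} (D : int_domain) (f : T -> R -> C) (p : T) :
  cts (fun q : T * R => f (fst q) (snd q)) ->
  (exists M, locally p (fun q => dominated D (f q) M)) ->
  continuous (fun q => int D (f q)) p.
Proof.
intros Hf [M HM].
assert (Hs := cts_slice f Hf).
pose proof (dominated_nonneg _ _ _ (locally_singleton _ _ HM)) as HM0.
apply filterlim_locally; intros eps.
(* The two tails and the compact part contribute at most [eps / 4] each; the radius [eps / 8] below
   is doubled by [Cmod_ball]. *)
assert (He' : 0 < eps / (4 * (M + 1)))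
  by (apply Rdiv_lt_0_compat; [apply cond_pos | lra]).
destruct (uniform_tail D _ He') as [P [HP [HP1 H]]].
destruct (filter_ex _ HP) as [ab Hab].
destruct (HP1 ab Hab) as [Hle _].
assert (HR := cts_RIC_param f (fst ab) (snd ab) Hle Hf p).
assert (He8 : 0 < eps / 8) by (pose proof (cond_pos eps); lra).
assert (HR' := proj1 (filterlim_locally _ _) HR (mkposreal _ He8)).
eapply filter_imp; [| apply (filter_and _ _ HM HR')].
intros q [Hq Hb]; apply Cmod_ball in Hb; simpl in Hb.
apply ball_Cmod.
pose proof (proj2 (H _ M (Hs q) HM0 Hq) ab Hab) as E1.
pose proof (proj2 (H _ M (Hs p) HM0 (locally_singleton _ _ HM)) ab Hab) as E2.
assert (E3 : M * (eps / (4 * (M + 1))) < eps / 4).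
{ apply (Rmult_lt_reg_r (4 * (M + 1))); [lra |]; pose proof (cond_pos eps); field_simplify; nra. }
replace (int D (f q) - int D (f p))%C with
  ((int D (f q) - RIC (f q) (fst ab) (snd ab)) +
   ((RIC (f q) (fst ab) (snd ab) - RIC (f p) (fst ab) (snd ab))
    + - (int D (f p) - RIC (f p) (fst ab) (snd ab))))%C by ring.
eapply Rle_lt_trans; [apply Cmod_triangle |].
eapply Rle_lt_trans; [apply Rplus_le_compat_l, Cmod_triangle |].
rewrite Cmod_opp; pose proof (cond_pos eps); lra.
Qed.

Lemma cts_int {T : UniformSpace} (D : int_domain) (f : T -> R -> C) :
  cts (fun q : T * R => f (fst q) (snd q)) ->
  (forall p, exists M, locally p (fun q => dominated D (f q) M)) ->
  cts (fun q => int D (f q)).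
Proof. intros Hf H p; now apply int_continuous. Qed.

Lemma cts_int_unif {T : UniformSpace} (D : int_domain) (f : T -> R -> C) (M : R) :
  cts (fun q : T * R => f (fst q) (snd q)) ->
  (forall p, dominated D (f p) M) -> cts (fun q => int D (f q)).
Proof. intros Hf H; apply cts_int; [exact Hf |]; intros p; exists M; now apply filter_forall. Qed.

Lemma dominated_swap_factor (D1 D2 : int_domain) (f : R -> R -> C) (M : R) :
  (forall x y, din D1 x -> din D2 y -> Cmod (f x y) <= M / (1 + x ^ 2) / (1 + y ^ 2)) ->
  forall y x, din D2 y -> din D1 x -> Cmod (f x y) <= M / (1 + y ^ 2) / (1 + x ^ 2).
Proof.
intros H y x Hy Hx; eapply Rle_trans; [now apply H |].
apply Req_le; unfold Rdiv; ring.
Qed.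

(** Half of the proof of [Fubini]: an iterated integral is approximated by an integral over a
    rectangle, with end points from sets that are large for the filters. [Fubini] applies it in both
    orders and meets in a common rectangle. The single-weight bounds hold for all real values of the
    other variable, so that the inner integral is continuous on the whole line. *)
Lemma Fubini_aux (D1 D2 : int_domain) (f : R -> R -> C) (M : R) :
  cts (fun q : R * R => f (fst q) (snd q)) ->
  (forall x y, din D1 x -> Cmod (f x y) <= M / (1 + x ^ 2)) ->
  (forall x y, din D2 y -> Cmod (f x y) <= M / (1 + y ^ 2)) ->
  (forall x y, din D1 x -> din D2 y -> Cmod (f x y) <= M / (1 + x ^ 2) / (1 + y ^ 2)) ->
  cts (fun x => int D2 (f x)) /\
  dominated D1 (fun x => int D2 (f x)) (M * PI) /\
  forall eps, 0 < eps -> exists P1 P2,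
    filter_prod (dlo D1) (dhi D1) P1 /\ filter_prod (dlo D2) (dhi D2) P2 /\
    (forall ab, P1 ab -> fst ab <= snd ab) /\ (forall ab, P2 ab -> fst ab <= snd ab) /\
    forall ab cd, P1 ab -> P2 cd ->
    Cmod (int D1 (fun x => int D2 (f x))
          - RIC (fun x => RIC (f x) (fst cd) (snd cd)) (fst ab) (snd ab)) <= eps.
Proof.
intros Hf H1 H2 H12.
assert (Hs := cts_slice f Hf).
assert (Hc : cts (fun x => int D2 (f x))).
{ apply (cts_int_unif D2 f M Hf); intros x y Hy; now apply H2. }
assert (HM : 0 <= M).
{ apply (dominated_nonneg D2 (f 0)); intros y Hy; now apply H2. }
assert (Hd : dominated D1 (fun x => int D2 (f x)) (M * PI)).
{ intros x Hx.
  replace (M * PI / (1 + x ^ 2)) with (M / (1 + x ^ 2) * PI) by (unfold Rdiv; ring).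
  apply int_bound; [apply Hs |]; intros y Hy; now apply H12. }
split; [exact Hc | split; [exact Hd |]].
intros eps He.
assert (HMP : 0 <= M * PI) by (apply Rmult_le_pos; [exact HM | left; apply PI_RGT_0]).
assert (He' : 0 < eps / (2 * (M * PI + 1))) by (apply Rdiv_lt_0_compat; lra).
destruct (uniform_tail D1 _ He') as [P1 [HP1 [HP1i K1]]].
destruct (uniform_tail D2 _ He') as [P2 [HP2 [HP2i K2]]].
exists P1, P2; repeat (split; [assumption || (intros ab Hab; now apply HP1i) || (intros ab Hab; now apply HP2i) |]).
intros ab cd Hab Hcd.
destruct (HP1i ab Hab) as [Lab Iab]; destruct (HP2i cd Hcd) as [Lcd _].
pose proof (proj2 (K1 _ _ Hc HMP Hd) ab Hab) as E1.
assert (Hr : cts (fun x => RIC (f x) (fst cd) (snd cd))) by now apply cts_RIC_param.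
(* The inner tail at [x] is proportional to [M / (1 + x^2)], so integrating it over [x] costs at
   most a factor [PI]. *)
assert (E2 : Cmod (RIC (fun x => int D2 (f x) - RIC (f x) (fst cd) (snd cd))%C (fst ab) (snd ab))
   <= M * (eps / (2 * (M * PI + 1))) * Rabs (atan (snd ab) - atan (fst ab))).
{ apply RIC_bound; [cts_tac |].
  rewrite Rmin_left, Rmax_right by exact Lab; intros x Hx.
  pose proof (proj2 (K2 (f x) (M / (1 + x ^ 2)) (Hs x)
    (Rmult_le_pos _ _ HM (Rlt_le _ _ (Rinv_0_lt_compat _ (weight_pos x))))
    (fun y Hy => H12 x y (Iab x Hx) Hy)) cd Hcd) as E.
  eapply Rle_trans; [exact E |]; apply Req_le; unfold Rdiv; ring. }
rewrite RIC_minus in E2 by assumption.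
replace (int D1 (fun x => int D2 (f x)) - RIC (fun x => RIC (f x) (fst cd) (snd cd)) (fst ab) (snd ab))%C
 with ((int D1 (fun x => int D2 (f x)) - RIC (fun x => int D2 (f x)) (fst ab) (snd ab)) +
   (RIC (fun x => int D2 (f x)) (fst ab) (snd ab)
     - RIC (fun x => RIC (f x) (fst cd) (snd cd)) (fst ab) (snd ab)))%C by ring.
eapply Rle_trans; [apply Cmod_triangle |].
assert (E3 : Rabs (atan (snd ab) - atan (fst ab)) <= PI).
{ pose proof (atan_bound (fst ab)); pose proof (atan_bound (snd ab)); apply Rabs_le; lra. }
set (e := eps / (2 * (M * PI + 1))) in *.
assert (E4 : M * PI * e <= eps / 2).
{ unfold e; apply (Rmult_le_reg_r (2 * (M * PI + 1))); [lra |]; field_simplify; nra. }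
assert (E5 : M * e * Rabs (atan (snd ab) - atan (fst ab)) <= M * e * PI).
{ apply Rmult_le_compat_l; [apply Rmult_le_pos; lra | exact E3]. }
replace (M * e * PI) with (M * PI * e) in E5 by ring.
apply Rle_trans with (M * PI * e + M * PI * e); [| lra].
apply Rplus_le_compat; [exact E1 | exact (Rle_trans _ _ _ E2 E5)].
Qed.

Lemma div_weight_le (M x : R) : 0 <= M -> M / (1 + x ^ 2) <= M.
Proof.
intros HM; apply (Rmult_le_reg_r (1 + x ^ 2)); [apply weight_pos |].
unfold Rdiv; rewrite Rmult_assoc, Rinv_l, Rmult_1_r by (apply Rgt_not_eq, weight_pos).
pose proof (pow2_ge_0 x); nra.
Qed.

Lemma Fubini (D1 D2 : int_domain) (f : R -> R -> C) (M : R) :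
  cts (fun q : R * R => f (fst q) (snd q)) ->
  (forall x y, din D1 x -> din D2 y -> Cmod (f x y) <= M / (1 + x ^ 2) / (1 + y ^ 2)) ->
  is_int D1 (fun x => int D2 (f x)) (int D2 (fun y => int D1 (fun x => f x y))).
Proof.
intros Hf H12.
(* After composition with the retractions the bounds of [f] on the domains hold for [g] on all of
   the plane, as [Fubini_aux] requires. *)
set (g := fun x y => f (dret D1 x) (dret D2 y)).
assert (Hg : cts (fun q : R * R => g (fst q) (snd q))).
{ pose proof (dret_cts D1); pose proof (dret_cts D2); unfold g; cts_tac. }
assert (HM : 0 <= M).
{ pose proof (dominated_nonneg D2 (f (dret D1 0)) (M / (1 + dret D1 0 ^ 2))
    (fun y Hy => H12 _ y (dret_in D1 0) Hy)) as H.
  apply (Rmult_le_reg_r (/ (1 + dret D1 0 ^ 2)));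
    [apply Rinv_0_lt_compat, weight_pos | rewrite Rmult_0_l; exact H]. }
assert (G12 : forall x y, din D1 x -> din D2 y -> Cmod (g x y) <= M / (1 + x ^ 2) / (1 + y ^ 2)).
{ intros x y Hx Hy; unfold g; rewrite !dret_id by assumption; auto. }
assert (G1 : forall x y, din D1 x -> Cmod (g x y) <= M / (1 + x ^ 2)).
{ intros x y Hx; unfold g; rewrite (dret_id D1) by assumption.
  eapply Rle_trans; [apply H12; [assumption | apply dret_in] | apply div_weight_le].
  apply Rmult_le_pos; [exact HM | left; apply Rinv_0_lt_compat, weight_pos]. }
assert (G2 : forall x y, din D2 y -> Cmod (g x y) <= M / (1 + y ^ 2)).
{ intros x y Hy; unfold g; rewrite (dret_id D2) by assumption.
  eapply Rle_trans; [apply H12; [apply dret_in | assumption] |].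
  apply Rmult_le_compat_r; [left; apply Rinv_0_lt_compat, weight_pos | now apply div_weight_le]. }
destruct (Fubini_aux D1 D2 g M Hg G1 G2 G12) as [A1 [A2 A3]].
destruct (Fubini_aux D2 D1 (fun y x => g x y) M (cts_swap g Hg)
  (fun x y => G2 y x) (fun x y => G1 y x) (dominated_swap_factor _ _ _ _ G12)) as [_ [_ B3]].
assert (E : int D1 (fun x => int D2 (g x)) = int D2 (fun y => int D1 (fun x => g x y))).
(* Both iterated integrals lie within [eps / 2] of one integral over a common rectangle, where
   [Fubini_rect] applies. *)
{ assert (Z : Cmod (int D1 (fun x => int D2 (g x)) - int D2 (fun y => int D1 (fun x => g x y)))%C <= 0).
  { apply le_epsilon; intros eps He; rewrite Rplus_0_l.
    destruct (A3 (eps / 2)) as [P1 [P2 [HP1 [HP2 [L1 [L2 K]]]]]]; [lra |].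
    destruct (B3 (eps / 2)) as [Q2 [Q1 [HQ2 [HQ1 [_ [_ K']]]]]]; [lra |].
    destruct (filter_ex _ (filter_and _ _ HP1 HQ1)) as [ab [Pab Qab]].
    destruct (filter_ex _ (filter_and _ _ HP2 HQ2)) as [cd [Pcd Qcd]].
    specialize (K ab cd Pab Pcd); specialize (K' cd ab Qcd Qab).
    rewrite (Fubini_rect g) in K by (auto; exact Hg).
    set (z := RIC (fun y => RIC (fun x => g x y) (fst ab) (snd ab)) (fst cd) (snd cd)) in *.
    replace (int D1 (fun x => int D2 (g x)) - int D2 (fun y => int D1 (fun x => g x y)))%C
      with ((int D1 (fun x => int D2 (g x)) - z)
            + - (int D2 (fun y => int D1 (fun x => g x y)) - z))%C by ring.
    eapply Rle_trans; [apply Cmod_triangle |]; rewrite Cmod_opp; lra. }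
  pose proof (Cmod_ge_0 (int D1 (fun x => int D2 (g x)) - int D2 (fun y => int D1 (fun x => g x y)))%C).
  assert (Z' := Cmod_eq_0 _ (Rle_antisym _ _ Z H)).
  rewrite <- (Cplus_0_r (int D2 _)), <- Z'; ring. }
assert (R1 : forall x, din D1 x -> int D2 (g x) = int D2 (f x)).
{ intros x Hx; apply int_ext_in; intros y Hy; unfold g; now rewrite !dret_id. }
apply (is_int_ext D1 (fun x => int D2 (g x))).
- intros x Hx; apply R1, dint_in, Hx.
- assert (R2 : int D2 (fun y => int D1 (fun x => f x y)) = int D1 (fun x => int D2 (g x))).
  { rewrite E; apply int_ext_in; intros y Hy; apply int_ext_in; intros x Hx.
    unfold g; now rewrite !dret_id. }
  rewrite R2.
  apply (int_correct D1 _ (M * PI)); assumption.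
Qed.

Lemma filterlim_C {T : Type} (F : (T -> Prop) -> Prop) {FF : Filter F} (f : T -> C) (l : C) :
  (forall eps, 0 < eps -> F (fun x => Cmod (f x - l) < eps)) -> filterlim f F (locally l).
Proof.
intros H; apply filterlim_locally; intros eps.
refine (filter_imp _ _ _ (H eps (cond_pos eps))); intros x Hx; now apply ball_Cmod.
Qed.

Lemma filterlim_C_inv {T : Type} (F : (T -> Prop) -> Prop) {FF : Filter F} (f : T -> C) (l : C) :
  filterlim f F (locally l) -> forall eps, 0 < eps -> F (fun x => Cmod (f x - l) < eps).
Proof.
intros H eps He; assert (He' : 0 < eps / 4) by lra.
refine (filter_imp _ _ _ (proj1 (filterlim_locally _ _) H (mkposreal _ He'))).
intros x Hx; apply Cmod_ball in Hx; simpl in Hx; lra.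
Qed.

(** * The line, the half line and compact intervals as domains of integration *)

(** From the continuity of [atan] at 0 and [atan (/ x) = PI / 2 - atan x]. *)
Lemma atan_lim_p : filterlim atan (Rbar_locally p_infty) (locally (PI / 2)).
Proof.
apply filterlim_locally; intros eps.
assert (Ha : continuous atan 0).
{ apply (ex_derive_continuous (V := R_NormedModule)); eexists; apply is_derive_atan. }
destruct (proj1 (filterlim_locally _ _) Ha eps) as [d Hd].
exists (/ d); intros x Hx.
pose proof (Rinv_0_lt_compat _ (cond_pos d)) as Hd0.
assert (Hx0 : 0 < x) by lra.
assert (B : ball 0 d (/ x)).
{ unfold ball; simpl; unfold AbsRing_ball, abs, minus, plus, opp; simpl.
  rewrite Ropp_0, Rplus_0_r, Rabs_pos_eq by (left; now apply Rinv_0_lt_compat).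
  rewrite <- (Rinv_inv d); apply Rinv_lt_contravar; [nra | exact Hx]. }
specialize (Hd _ B); rewrite atan_0 in Hd.
unfold ball in *; simpl in *; unfold AbsRing_ball, abs, minus, plus, opp in *; simpl in *.
rewrite atan_inv in Hd by exact Hx0.
rewrite <- Rabs_Ropp; replace (- (atan x + - (PI / 2))) with (PI / 2 - atan x + - 0) by ring.
exact Hd.
Qed.

Lemma filterlim_opp_m : filterlim Ropp (Rbar_locally m_infty) (Rbar_locally p_infty).
Proof. intros P [M HM]; exists (- M); intros x Hx; apply HM; lra. Qed.

Lemma atan_lim_m : filterlim atan (Rbar_locally m_infty) (locally (- (PI / 2))).
Proof.
apply filterlim_ext with (fun x => - atan (- x)); [intros x; rewrite atan_opp; ring |].
apply (filterlim_comp _ _ _ (fun x => atan (- x)) Ropp _ (locally (PI / 2))).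
- exact (filterlim_comp _ _ _ Ropp atan _ _ _ filterlim_opp_m atan_lim_p).
- apply (filterlim_opp (PI / 2)).
Qed.

Definition line : int_domain.
Proof.
refine {| dlo := Rbar_locally m_infty; dhi := Rbar_locally p_infty; din := fun _ => True;
  dint := fun _ => True; dret := fun x => x |}; auto.
- exists (fun x => x < 0) (fun x => 0 < x); [now exists 0 | now exists 0 |].
  intros x y Hx Hy; simpl; repeat split; lra.
- apply ctsR_id.
- eexists; apply atan_lim_m.
- eexists; apply atan_lim_p.
Defined.

Definition half : int_domain.
Proof.
refine {| dlo := at_point 0; dhi := Rbar_locally p_infty; din := fun x => 0 <= x;
  dint := fun x => 0 < x; dret := Rabs |}.
- exists (fun x => x = 0) (fun x => 0 < x); [reflexivity | now exists 0 |].
  intros x y Hx Hy; simpl; repeat split; try lra; intros z Hz; lra.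
- intros; lra.
- intros x; apply continuous_Rabs.
- apply Rabs_pos.
- intros x Hx; now apply Rabs_pos_eq.
- intros x Hx; lra.
- exists (atan 0); intros P HP; exact (locally_singleton _ _ HP).
- eexists; apply atan_lim_p.
Defined.

Definition clamp (a b x : R) : R := Rmax a (Rmin b x).

Lemma clamp_in (a b x : R) : a <= b -> a <= clamp a b x <= b.
Proof. intros H; unfold clamp, Rmax, Rmin; repeat destruct Rle_dec; lra. Qed.

Lemma clamp_id (a b x : R) : a <= x <= b -> clamp a b x = x.
Proof. intros H; unfold clamp, Rmax, Rmin; repeat destruct Rle_dec; lra. Qed.

Lemma ctsR_clamp {T : UniformSpace} (a b : R) (f : T -> R) :
  ctsR f -> ctsR (fun p => clamp a b (f p)).
Proof. intros H; unfold clamp; cts_tac. Qed.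

Definition seg (a b : R) (Hab : a <= b) : int_domain.
Proof.
refine {| dlo := at_point a; dhi := at_point b; din := fun x => a <= x <= b;
  dint := fun x => a < x < b; dret := clamp a b |}.
- exists (fun x => x = a) (fun x => x = b); [reflexivity | reflexivity |].
  intros x y -> ->; simpl; repeat split; try lra; intros z Hz; lra.
- intros; lra.
- apply (ctsR_clamp a b (fun x => x)), ctsR_id.
- intros x; now apply clamp_in.
- intros x Hx; now apply clamp_id.
- intros x Hx; lra.
- exists (atan a); intros P HP; exact (locally_singleton _ _ HP).
- exists (atan b); intros P HP; exact (locally_singleton _ _ HP).
Defined.

Lemma is_int_ex_R (f : R -> C) (l : C) : is_int line f l -> ex_int_R f.
Proof. intros H; now exists l. Qed.

Lemma is_int_ex_pos (f : R -> C) (l : C) : is_int half f l -> ex_int_pos f.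
Proof. intros H; now exists l. Qed.

Lemma is_int_seg (a b : R) (Hab : a <= b) (f : R -> C) (l : C) :
  is_int (seg a b Hab) f l <-> is_RIC f a b l.
Proof. exact (is_RInt_gen_at_point (V := C_R_NormedModule) f a b l). Qed.

Lemma int_seg (a b : R) (Hab : a <= b) (f : R -> C) : cts f ->
  int (seg a b Hab) f = RIC f a b.
Proof. intros Hf; now apply is_int_unique, is_int_seg, RIC_correct. Qed.

Lemma int_filterlim (D : int_domain) (f : R -> C) (M : R) :
  cts f -> dominated D f M ->
  filterlim (fun ab => RIC f (fst ab) (snd ab)) (filter_prod (dlo D) (dhi D))
    (locally (int D f)).
Proof.
intros Hf Hd; pose proof (dominated_nonneg _ _ _ Hd) as HM.
apply filterlim_C; [apply filter_prod_filter; typeclasses eauto |]; intros eps He.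
assert (He' : 0 < eps / (M + 1)) by (apply Rdiv_lt_0_compat; lra).
destruct (uniform_tail D _ He') as [P [HP [_ H]]].
refine (filter_imp (F := filter_prod (dlo D) (dhi D)) _ _ _ HP); intros ab Hab.
pose proof (proj2 (H f M Hf HM Hd) ab Hab) as E.
rewrite <- Cmod_opp.
replace (- (RIC f (fst ab) (snd ab) - int D f))%C
  with (int D f - RIC f (fst ab) (snd ab))%C by ring.
refine (Rle_lt_trans _ _ _ E _).
apply (Rmult_lt_reg_r (M + 1)); [lra |]; field_simplify; nra.
Qed.

Lemma filterlim_sub {T : Type} (F : (T -> Prop) -> Prop) {FF : Filter F} (f g : T -> C) (l m : C) :
  filterlim f F (locally l) -> filterlim g F (locally m) ->
  filterlim (fun x => f x - g x)%C F (locally (l - m)%C).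
Proof.
intros Hf Hg; apply filterlim_C; [exact FF |]; intros eps He.
assert (He' : 0 < eps / 2) by lra.
refine (filter_imp _ _ _ (filter_and _ _ (filterlim_C_inv F f l Hf _ He')
  (filterlim_C_inv F g m Hg _ He'))).
intros x [H1 H2].
replace (f x - g x - (l - m))%C with ((f x - l) + - (g x - m))%C by ring.
eapply Rle_lt_trans; [apply Cmod_triangle |]; rewrite Cmod_opp; lra.
Qed.

(** * Boundary values at the ends of a domain: primitives, Green's identity and homotopy *)

Lemma filterlim_ends (D : int_domain) (F : R -> C) (la lb : C) :
  filterlim F (dlo D) (locally la) -> filterlim F (dhi D) (locally lb) ->
  filterlim (fun ab => F (snd ab) - F (fst ab))%C (filter_prod (dlo D) (dhi D))
    (locally (lb - la)%C).
Proof.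
intros Ha Hb; apply filterlim_sub; [apply filter_prod_filter; typeclasses eauto | |].
- exact (filterlim_comp _ _ _ snd F _ _ _ filterlim_snd Hb).
- exact (filterlim_comp _ _ _ fst F _ _ _ filterlim_fst Ha).
Qed.

Lemma filterlim_ext_ends (D : int_domain) (f g : R * R -> C) (l : C) :
  (forall a b, a <= b -> din D a -> din D b -> (forall x, a < x < b -> dint D x) ->
     f (a, b) = g (a, b)) ->
  filterlim f (filter_prod (dlo D) (dhi D)) (locally l) ->
  filterlim g (filter_prod (dlo D) (dhi D)) (locally l).
Proof.
intros H; apply filterlim_ext_loc.
refine (filter_imp (F := filter_prod (dlo D) (dhi D)) _ _ _ (dom_ends D)).
intros [a b] [H1 [H2 [H3 H4]]]; now apply H.
Qed.

Lemma is_int_FTC (D : int_domain) (F f : R -> C) (la lb : C) :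
  cts F -> cts f -> (forall x, dint D x -> is_derive_C F x (f x)) ->
  filterlim F (dlo D) (locally la) -> filterlim F (dhi D) (locally lb) ->
  is_int D f (lb - la)%C.
Proof.
intros HF Hf H Ha Hb; apply is_int_of_filterlim; [exact Hf |].
refine (filterlim_ext_ends D _ _ _ _ (filterlim_ends D F la lb Ha Hb)).
intros a b Hab _ _ Hi; simpl; symmetry; apply FTC; auto.
Qed.

(** [Green_rect] on [[a, b] x [c, d]] as [a] and [b] tend to the ends of the domain; [la] and [lb]
    are the limits of the flux of [Q] through the two sides. *)
Lemma int_Green (D : int_domain) (P Q S : R -> R -> C) (c d M M' : R) (la lb : C) :
  c <= d ->
  cts (fun q : R * R => P (fst q) (snd q)) -> cts (fun q : R * R => Q (fst q) (snd q)) ->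
  cts (fun q : R * R => S (fst q) (snd q)) ->
  (forall x y, dint D x -> c < y < d -> is_derive_C (fun y => P x y) y (S x y)) ->
  (forall x y, dint D x -> c < y < d -> is_derive_C (fun x => Q x y) x (S x y)) ->
  dominated D (fun x => P x c) M -> dominated D (fun x => P x d) M' ->
  filterlim (fun a => RIC (Q a) c d) (dlo D) (locally la) ->
  filterlim (fun b => RIC (Q b) c d) (dhi D) (locally lb) ->
  (int D (fun x => P x d) - int D (fun x => P x c))%C = (lb - la)%C.
Proof.
intros Hcd HP HQ HS H1 H2 D1 D2 L1 L2.
assert (C1 : cts (fun x => P x c)) by cts_tac.
assert (C2 : cts (fun x => P x d)) by cts_tac.
pose proof (int_filterlim D _ _ C1 D1) as E1.
pose proof (int_filterlim D _ _ C2 D2) as E2.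
assert (E3 := filterlim_sub (filter_prod (dlo D) (dhi D)) _ _ _ _ E2 E1).
assert (E4 := filterlim_ends D (fun a => RIC (Q a) c d) _ _ L1 L2).
assert (E5 : filterlim (fun ab => RIC (Q (snd ab)) c d - RIC (Q (fst ab)) c d)%C
   (filter_prod (dlo D) (dhi D)) (locally (int D (fun x => P x d) - int D (fun x => P x c))%C)).
{ refine (filterlim_ext_ends D _ _ _ _ E3); intros a b Hab _ _ Hi; simpl.
  apply (Green_rect P Q S); auto. }
exact (filterlim_locally_unique (V := C_R_NormedModule) (F := filter_prod (dlo D) (dhi D)) _ _ _ E5 E4).
Qed.

(* Cauchy's theorem for a homotopy of paths [y -> (x -> g x y)]: with [P = f(g) g_x] and
   [Q = f(g) g_y] one has [P_y = Q_x]. *)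
Lemma int_homotopy (D : int_domain) (P Q S : R -> R -> C) (c d M M' : R) :
  c <= d ->
  cts (fun q : R * R => P (fst q) (snd q)) -> cts (fun q : R * R => Q (fst q) (snd q)) ->
  cts (fun q : R * R => S (fst q) (snd q)) ->
  (forall x y, dint D x -> c < y < d -> is_derive_C (fun y => P x y) y (S x y)) ->
  (forall x y, dint D x -> c < y < d -> is_derive_C (fun x => Q x y) x (S x y)) ->
  dominated D (fun x => P x c) M -> dominated D (fun x => P x d) M' ->
  filterlim (fun a => RIC (Q a) c d) (dlo D) (locally (RtoC 0)) ->
  filterlim (fun b => RIC (Q b) c d) (dhi D) (locally (RtoC 0)) ->
  int D (fun x => P x d) = int D (fun x => P x c).
Proof.
intros Hcd HP HQ HS H1 H2 D1 D2 L1 L2.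
pose proof (int_Green D P Q S c d M M' _ _ Hcd HP HQ HS H1 H2 D1 D2 L1 L2) as E.
replace (int D (fun x => P x d))
  with (int D (fun x => P x d) - int D (fun x => P x c) + int D (fun x => P x c))%C by ring.
rewrite E; ring.
Qed.

Lemma decay_lim_p (F : R -> C) (M : R) :
  (forall x, 0 <= x -> Cmod (F x) <= M / (1 + x ^ 2)) ->
  filterlim F (Rbar_locally p_infty) (locally (RtoC 0)).
Proof.
intros H; apply filterlim_C; [typeclasses eauto |]; intros eps He.
assert (HM : 0 <= M).
{ specialize (H 0 (Rle_refl 0)); pose proof (Cmod_ge_0 (F 0)); lra. }
(* For [x > M / eps] one has [M < eps x <= eps (1 + x^2)]. *)
exists (M / eps); intros x Hx.
assert (Hx0 : 0 <= x).
{ apply Rle_trans with (M / eps); [apply Rdiv_le_0_compat | ]; lra. }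
replace (F x - RtoC 0)%C with (F x) by ring.
refine (Rle_lt_trans _ _ _ (H x Hx0) _).
apply (Rmult_lt_reg_r (1 + x ^ 2)); [apply weight_pos |].
unfold Rdiv; rewrite Rmult_assoc, Rinv_l, Rmult_1_r by (apply Rgt_not_eq, weight_pos).
apply (Rmult_lt_compat_r eps) in Hx; [| exact He].
unfold Rdiv in Hx; rewrite Rmult_assoc, Rinv_l, Rmult_1_r in Hx by lra.
nra.
Qed.

Lemma decay_lim_m (F : R -> C) (M : R) :
  (forall x, x <= 0 -> Cmod (F x) <= M / (1 + x ^ 2)) ->
  filterlim F (Rbar_locally m_infty) (locally (RtoC 0)).
Proof.
intros H.
apply filterlim_ext with (fun x => F (- - x)); [intros x; now rewrite Ropp_involutive |].
apply (filterlim_comp _ _ _ Ropp (fun x => F (- x)) _ (Rbar_locally p_infty)).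
- apply filterlim_opp_m.
- apply (decay_lim_p _ M); intros x Hx.
  replace (x ^ 2) with ((- x) ^ 2) by ring; apply H; lra.
Qed.

Lemma filterlim_at_point (F : R -> C) (a : R) :
  filterlim F (at_point a) (locally (F a)).
Proof. intros P HP; exact (locally_singleton _ _ HP). Qed.

(** * Substitutions on the line *)

Lemma is_int_line_scal (f : R -> C) (u v : R) (l : C) : 0 < u ->
  is_int line f l -> is_int line (fun x => RtoC u * f (u * x + v)%R)%C l.
Proof.
intros Hu Hf P HP; destruct (Hf P HP) as [Q1 Q2 [M1 H1] [M2 H2] H].
exists (fun x => Q1 (u * x + v)) (fun x => Q2 (u * x + v)).
- exists ((M1 - v) / u); intros x Hx; apply H1.
  apply (Rmult_lt_compat_l u) in Hx; [| exact Hu].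
  replace (u * ((M1 - v) / u)) with (M1 - v) in Hx by (field; lra); lra.
- exists ((M2 - v) / u); intros x Hx; apply H2.
  apply (Rmult_lt_compat_l u) in Hx; [| exact Hu].
  replace (u * ((M2 - v) / u)) with (M2 - v) in Hx by (field; lra); lra.
- intros x y Hx Hy; destruct (H _ _ Hx Hy) as [w [Hw Hw']]; exists w; split; [| exact Hw'].
  simpl in Hw |- *.
  apply (is_RInt_ext (V := C_R_NormedModule) (fun y => scal u (f (u * y + v)))).
  + intros z _; apply injective_projections; simpl; unfold scal; simpl; unfold mult; simpl; ring.
  + apply (is_RInt_comp_lin (V := C_R_NormedModule)), Hw.
Qed.

Lemma int_line_shift (f : R -> C) (v : R) (l : C) :
  is_int line f l -> is_int line (fun x => f (x + v)) l.
Proof.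
intros H; apply (is_int_ext line (fun x => RtoC 1 * f (1 * x + v)%R)%C).
- intros x _; rewrite Rmult_1_l; ring.
- apply is_int_line_scal; [lra | exact H].
Qed.

Lemma is_int_line_halves (f : R -> C) (l m : C) :
  is_int half f l -> is_int half (fun x => f (- x)) m -> is_int line f (l + m)%C.
Proof.
intros Hl Hm; rewrite Cplus_comm.
apply (is_RInt_gen_Chasles (V := C_R_NormedModule) (Fa := Rbar_locally m_infty)
  (Fc := Rbar_locally p_infty) f 0 m l); [| exact Hl].
intros P HP; destruct (Hm P HP) as [Q1 Q2 H1 [M H2] H].
exists (fun x => Q2 (- x)) (fun x => x = 0).
- exists (- M); intros x Hx; apply H2; lra.
- reflexivity.
- intros x y Hx ->; destruct (H _ _ H1 Hx) as [w [Hw Hw']]; exists w; split; [| exact Hw'].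
  simpl in Hw |- *.
  apply (is_RInt_swap (V := C_R_NormedModule)) in Hw.
  apply (is_RInt_ext (V := C_R_NormedModule) (fun y => opp (scal (-1) (f (- (-1 * y + 0)))))).
  + intros z _; replace (- (-1 * z + 0)) with z by ring.
    apply injective_projections; simpl; unfold opp, scal; simpl; unfold mult, opp; simpl; ring.
  + replace w with (opp (opp w)) by apply opp_opp.
    apply (is_RInt_opp (V := C_R_NormedModule)).
    apply (is_RInt_comp_lin (V := C_R_NormedModule) (fun y => f (- y)) (-1) 0 x 0).
    replace (-1 * x + 0) with (- x) by ring; replace (-1 * 0 + 0) with 0 by ring; exact Hw.
Qed.

(** * Gaussians and exponentials dominated by the weight *)

(** From [exp q >= 1 + q] and [(1 + t x^2) (1 + / t) >= 1 + x^2]. *)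
Lemma gauss_weight (t x : R) : 0 < t -> exp (- (t * x ^ 2)) <= (1 + / t) / (1 + x ^ 2).
Proof.
intros Ht; pose proof (pow2_ge_0 x) as Hx; pose proof (weight_pos x) as Hw.
pose proof (exp_ineq1_le (t * x ^ 2)) as He.
assert (Hi : 0 < / t) by now apply Rinv_0_lt_compat.
rewrite exp_Ropp; apply (Rmult_le_reg_r (1 + x ^ 2)); [exact Hw |].
unfold Rdiv; rewrite Rmult_assoc, Rinv_l, Rmult_1_r by lra.
apply (Rmult_le_reg_l (exp (t * x ^ 2))); [apply exp_pos |].
rewrite <- Rmult_assoc, Rinv_r, Rmult_1_l by (apply Rgt_not_eq, exp_pos).
apply Rle_trans with ((1 + t * x ^ 2) * (1 + / t)).
- replace ((1 + t * x ^ 2) * (1 + / t)) with (1 + x ^ 2 + (/ t + t * x ^ 2)) by (field; lra).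
  assert (0 <= t * x ^ 2) by (apply Rmult_le_pos; lra); lra.
- apply Rmult_le_compat_r; lra.
Qed.

(** From [exp (a x) >= (1 + a x / 3)^3] and [(1 + 3 / a) (1 + a x / 3) >= 1 + x]. The third power
    leaves room for the factor [1 + x], which accounts for the velocity of the rotating rays and for
    the factor [z] in the boundary term. *)
Lemma exp_weight (a x : R) : 0 < a -> 0 <= x ->
  (1 + x) * exp (- (a * x)) <= (1 + 3 / a) ^ 3 / (1 + x ^ 2).
Proof.
intros Ha Hx; pose proof (weight_pos x) as Hw.
assert (Hi : 0 < 3 / a) by (apply Rdiv_lt_0_compat; lra).
assert (He : (1 + a * x / 3) ^ 3 <= exp (a * x)).
{ replace (a * x) with (a * x / 3 + (a * x / 3 + a * x / 3)) at 2 by field.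
  rewrite !exp_plus; simpl; rewrite Rmult_1_r.
  assert (0 <= a * x / 3) by (apply Rdiv_le_0_compat; [apply Rmult_le_pos |]; lra).
  pose proof (exp_ineq1_le (a * x / 3)).
  repeat apply Rmult_le_compat; try lra; apply Rmult_le_pos; lra. }
assert (Hk : (1 + x) ^ 3 <= ((1 + 3 / a) * (1 + a * x / 3)) ^ 3).
{ apply pow_incr; split; [lra |].
  replace ((1 + 3 / a) * (1 + a * x / 3)) with (1 + x + (3 / a + a * x / 3)) by (field; lra).
  assert (0 <= a * x / 3) by (apply Rdiv_le_0_compat; [apply Rmult_le_pos |]; lra); lra. }
rewrite Rpow_mult_distr in Hk.
rewrite exp_Ropp; apply (Rmult_le_reg_r (1 + x ^ 2)); [exact Hw |].
unfold Rdiv at 1; rewrite (Rmult_assoc _ (/ (1 + x ^ 2))), Rinv_l, Rmult_1_r by lra.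
apply (Rmult_le_reg_l (exp (a * x))); [apply exp_pos |].
replace (exp (a * x) * ((1 + x) * / exp (a * x) * (1 + x ^ 2)))
  with ((1 + x) * (1 + x ^ 2)) by (field; apply Rgt_not_eq, exp_pos).
apply Rle_trans with ((1 + x) ^ 3); [nra |].
apply Rle_trans with (1 := Hk); rewrite Rmult_comm.
apply Rmult_le_compat_r; [apply pow_le; lra | exact He].
Qed.

(** * Gaussian integrals on the line and on the contour *)

Definition gauss1 (x : R) : C := RtoC (exp (- x ^ 2)).

Lemma cts_gauss1 : cts gauss1.
Proof. unfold gauss1; cts_tac. Qed.

Lemma dC_RIC (f : R -> C) (a x : R) : cts f -> is_derive_C (fun x => RIC f a x) x (f x).
Proof.
intros Hf; apply (is_derive_RInt (V := C_R_NormedModule) f _ a); [| apply Hf].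
apply filter_forall; intros; now apply RIC_correct.
Qed.

Lemma cts_of_dC (f g : R -> C) : (forall x, is_derive_C f x (g x)) -> cts f.
Proof.
intros H x; apply (ex_derive_continuous (V := C_R_NormedModule)); eexists; apply H.
Qed.

(** The function [2 x exp (- x^2 (1 + s^2))] is, up to sign, integrated over [[0, r] x [0, 1]] in
    both orders: [s] first gives the square of the primitive of the Gaussian, [x] first gives
    [atan 1 = PI / 4] minus an error that vanishes as [r] grows. *)
Lemma gauss_square (r : R) : 0 <= r ->
  (RIC gauss1 0 r * RIC gauss1 0 r)%C =
  (RtoC (PI / 4) - RIC (fun s => RtoC (exp (- (r ^ 2 * (1 + s ^ 2))) / (1 + s ^ 2))%R) 0 1)%C.
Proof.
intros Hr.
set (J := fun x => RIC gauss1 0 x).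
assert (dJ : forall x, is_derive_C J x (gauss1 x)) by (intros x; apply dC_RIC, cts_gauss1).
assert (cJ : cts J) by exact (cts_of_dC _ _ dJ).
assert (J0 : J 0 = 0) by apply (RInt_point (V := C_R_CompleteNormedModule)).
assert (cg := cts_gauss1).
set (S := fun x s => RtoC (- (2 * x * exp (- (x ^ 2 * (1 + s ^ 2)))))).
assert (cS : cts (fun q : R * R => S (fst q) (snd q))) by (unfold S; cts_tac).
pose proof (Fubini_rect S 0 r 0 1 Hr Rle_0_1 cS) as HF.
assert (E1 : RIC (fun x => RIC (fun s => S x s) 0 1) 0 r = (- (J r * J r))%C).
{ rewrite (RIC_ext _ (fun x => - (RtoC 2 * (gauss1 x * J x)))%C).
  - rewrite (FTC (fun x => - (J x * J x))%C); [| exact Hr | cts_tac | cts_tac |].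
    + rewrite J0; ring.
    + intros x _; eapply dC_eq; [apply dC_opp, dC_mult; apply dJ | ring].
  - intros x _.
    rewrite (FTC (fun s => - (RtoC 2 * (gauss1 x * J (x * s)%R)))%C).
    + rewrite Rmult_0_r, Rmult_1_r, J0; ring.
    + lra.
    + cts_tac.
    + unfold S; cts_tac.
    + intros s _; eapply dC_eq.
      * apply dC_opp, dC_mult; [apply dC_const | apply dC_mult; [apply dC_const |]].
        apply (dC_comp J (fun s => x * s) s x); [apply dJ |].
        auto_derive; [easy | ring].
      * unfold S, gauss1; rewrite <- !RtoC_mult, <- ?RtoC_plus.
        replace (- (x ^ 2 * (1 + s ^ 2))) with (- x ^ 2 + - (x * s) ^ 2) by ring.
        rewrite exp_plus; apply injective_projections; simpl; ring. }
assert (E2 : RIC (fun s => RIC (fun x => S x s) 0 r) 0 1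
  = (RIC (fun s => RtoC (exp (- (r ^ 2 * (1 + s ^ 2))) / (1 + s ^ 2))%R) 0 1 - RtoC (PI / 4))%C).
{ assert (Hw : forall s : R, 1 + s ^ 2 <> 0) by (intros s; apply Rgt_not_eq, weight_pos).
  rewrite (RIC_ext _ (fun s => RtoC (exp (- (r ^ 2 * (1 + s ^ 2))) / (1 + s ^ 2))%R
     - RtoC (/ (1 + s ^ 2))%R)%C).
  - rewrite RIC_minus by (cts_tac; intros; apply Hw); f_equal; f_equal.
    rewrite (FTC (fun s => RtoC (atan s))).
    + rewrite atan_1, atan_0; apply injective_projections; simpl; ring.
    + lra.
    + apply cts_RtoC; intros s; apply (ex_derive_continuous (V := R_NormedModule)).
      eexists; apply is_derive_atan.
    + cts_tac; intros; apply Hw.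
    + intros s _; apply dC_RtoC; rewrite <- Rsqr_pow2; apply is_derive_atan.
  - intros s _.
    rewrite (FTC (fun x => RtoC (exp (- (x ^ 2 * (1 + s ^ 2))) / (1 + s ^ 2)))).
    + f_equal; f_equal; f_equal.
      replace (- (0 ^ 2 * (1 + s ^ 2))) with 0 by ring; rewrite exp_0; unfold Rdiv; ring.
    + exact Hr.
    + cts_tac.
    + unfold S; cts_tac.
    + intros x _; apply dC_RtoC; auto_derive; [exact I |].
      replace (x * (x * 1) * (1 + s * (s * 1))) with (x ^ 2 * (1 + s ^ 2)) by ring.
      replace (1 + s * (s * 1)) with (1 + s ^ 2) by ring; field; exact (Hw s). }
rewrite E1, E2 in HF; fold (J r).
replace (J r * J r)%C with (- - (J r * J r))%C by ring; rewrite HF; ring.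
Qed.

Lemma gauss1_dominated (D : int_domain) : dominated D gauss1 2.
Proof.
intros x _; unfold gauss1; rewrite Cmod_R, Rabs_pos_eq by (left; apply exp_pos).
pose proof (gauss_weight 1 x Rlt_0_1) as H.
rewrite Rmult_1_l, Rinv_1 in H; replace (1 + 1) with 2 in H by ring; exact H.
Qed.

Lemma is_int_half_gauss1 : is_int half gauss1 (RtoC (sqrt PI / 2)).
Proof.
pose proof PI_RGT_0 as HPI.
apply is_int_of_filterlim; [apply cts_gauss1 |].
set (err := fun r => RIC (fun s => RtoC (exp (- (r ^ 2 * (1 + s ^ 2))) / (1 + s ^ 2))%R) 0 1).
assert (Hw : forall s : R, 1 + s ^ 2 <> 0) by (intros s; apply Rgt_not_eq, weight_pos).
assert (Herr : filterlim err (Rbar_locally p_infty) (locally (RtoC 0))).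
{ apply (decay_lim_p _ 2); intros r Hr.
  pose proof (gauss_weight 1 r Rlt_0_1) as H.
  rewrite Rmult_1_l, Rinv_1 in H; replace (1 + 1) with 2 in H by ring.
  eapply Rle_trans; [| exact H].
  replace (exp (- r ^ 2)) with (exp (- r ^ 2) * (1 - 0)) by ring.
  unfold err; apply (RIC_bound_const _ 0 1 (exp (- r ^ 2))); [lra | cts_tac; intros; apply Hw |].
  intros s _; rewrite Cmod_R, Rabs_pos_eq.
  - apply Rle_trans with (exp (- (r ^ 2 * (1 + s ^ 2)))).
    + apply div_weight_le; left; apply exp_pos.
    + destruct (Req_dec (- (r ^ 2 * (1 + s ^ 2))) (- r ^ 2)) as [-> | Hn]; [lra |].
      left; apply exp_increasing.
      pose proof (pow2_ge_0 r); pose proof (pow2_ge_0 s); nra.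
  - apply Rdiv_le_0_compat; [left; apply exp_pos | apply weight_pos]. }
(* [gauss_square] determines the integral up to sign, and the integral is real and nonnegative. *)
assert (Hsq : forall r, 0 <= r -> RIC gauss1 0 r = RtoC (sqrt (PI / 4 - fst (err r)))).
{ intros r Hr; pose proof (gauss_square r Hr) as E.
  assert (S0 : snd (RIC gauss1 0 r) = 0).
  { rewrite RIC_snd by apply cts_gauss1; simpl.
    rewrite (RInt_const (V := R_CompleteNormedModule)).
    unfold scal; simpl; unfold mult; simpl; ring. }
  assert (F0 : 0 <= fst (RIC gauss1 0 r)).
  { rewrite RIC_fst by apply cts_gauss1; simpl.
    apply RInt_ge_0; [exact Hr | | intros; left; apply exp_pos].
    apply (ex_RInt_continuous (V := R_CompleteNormedModule)); intros z _.
    exact (ctsR_fst _ cts_gauss1 z). }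
  apply injective_projections; [| exact S0].
  apply (f_equal fst) in E.
  change (fst (RIC gauss1 0 r) * fst (RIC gauss1 0 r) - snd (RIC gauss1 0 r) * snd (RIC gauss1 0 r)
    = PI / 4 - fst (err r)) in E.
  rewrite S0, Rmult_0_r, Rminus_0_r in E.
  change (fst (RIC gauss1 0 r) = sqrt (PI / 4 - fst (err r))).
  replace (PI / 4 - fst (err r)) with (fst (RIC gauss1 0 r) * fst (RIC gauss1 0 r))
    by exact E.
  now rewrite sqrt_square. }
assert (Hlim : filterlim (fun r => RIC gauss1 0 r) (Rbar_locally p_infty)
   (locally (RtoC (sqrt PI / 2)))).
{ apply filterlim_ext_loc with (fun r => RtoC (sqrt (PI / 4 - fst (err r)))).
  - exists 0; intros r Hr; symmetry; apply Hsq; lra.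
  - replace (sqrt PI / 2) with (sqrt (PI / 4 - fst (RtoC 0))).
    + apply (filterlim_comp _ _ _ err (fun z => RtoC (sqrt (PI / 4 - fst z))) _ _ _ Herr).
      assert (K : cts (fun z : C => RtoC (sqrt (PI / 4 - fst z)))).
      { apply cts_RtoC, (ctsR_comp sqrt); [intros z; apply continuous_sqrt |].
        apply ctsR_minus; [apply ctsR_const | apply ctsR_fst]; intros z; apply continuous_id. }
      apply K.
    + simpl; rewrite Rminus_0_r, sqrt_div_alt by lra.
      replace 4 with (2 * 2) by ring; rewrite sqrt_square by lra; reflexivity. }
intros P HP; destruct (Hlim P HP) as [M HM].
exists (fun x => x = 0) (fun x => M < x); [reflexivity | now exists M |].
intros x y -> Hy; apply HM, Hy.
Qed.

Lemma is_int_line_gauss1 : is_int line gauss1 (RtoC (sqrt PI)).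
Proof.
replace (RtoC (sqrt PI)) with (RtoC (sqrt PI / 2) + RtoC (sqrt PI / 2))%C.
- apply is_int_line_halves; [apply is_int_half_gauss1 |].
  apply (is_int_ext half gauss1); [| apply is_int_half_gauss1].
  intros x _; unfold gauss1; f_equal; f_equal; ring.
- rewrite <- RtoC_plus; f_equal; field.
Qed.

Lemma is_int_line_gauss (t : R) : 0 < t ->
  is_int line (fun x => RtoC (exp (- (t * x ^ 2)))) (RtoC (sqrt (PI / t))).
Proof.
intros Ht; pose proof (sqrt_lt_R0 t Ht) as Hs.
pose proof (is_int_line_scal gauss1 (sqrt t) 0 _ Hs is_int_line_gauss1) as H.
apply (is_int_Cmult _ _ (RtoC (/ sqrt t))) in H.
rewrite <- RtoC_mult in H.
replace (/ sqrt t * sqrt PI) with (sqrt (PI / t)) in H.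
- revert H; apply is_int_ext; intros x _.
  unfold gauss1; rewrite <- !RtoC_mult; f_equal.
  rewrite <- Rmult_assoc, Rinv_l, Rmult_1_l by lra; f_equal.
  rewrite Rplus_0_r, Rpow_mult_distr, pow2_sqrt by lra; reflexivity.
- rewrite sqrt_div_alt by exact Ht; unfold Rdiv; ring.
Qed.

(** The factor of [E] that depends on [z = lambda + kappa], see [E_shift]. Both [t] and [a] are
    parameters because the transforms of the data shift them, to [t - tau] and to [y - s] or
    [y + s]. *)
Definition gker (t a : R) (z : C) : C := Cexp (- (z ^ 2 * t) + Ci * z * a)%C.

Lemma cts_gker {T : UniformSpace} (t a : T -> R) (z : T -> C) :
  ctsR t -> ctsR a -> cts z -> cts (fun p => gker (t p) (a p) (z p)).
Proof. intros; unfold gker; cts_tac. Qed.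

Lemma dC_gker (t a x : R) (g : R -> C) (l : C) : is_derive_C g x l ->
  is_derive_C (fun x => gker t a (g x)) x
    (l * (- (2 * g x * t) + Ci * a) * gker t a (g x))%C.
Proof.
intros H; unfold gker; eapply dC_eq.
- apply dC_Cexp, dC_plus.
  + apply dC_opp, dC_mult; [| apply dC_const].
    apply (dC_ext (fun x => g x * g x)%C); [intros; simpl; ring |].
    apply dC_mult; exact H.
  + apply dC_mult; [| apply dC_const]; apply dC_mult; [apply dC_const | exact H].
- simpl; ring.
Qed.

Lemma Cmod_gker (t a x y : R) :
  Cmod (gker t a (x, y)) = exp (- (t * (x ^ 2 - y ^ 2)) - a * y).
Proof. unfold gker; rewrite Cmod_Cexp; f_equal; simpl; ring. Qed.

Lemma exp_le (x y : R) : x <= y -> exp x <= exp y.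
Proof.
intros [H | ->]; [left; now apply exp_increasing | apply Rle_refl].
Qed.

Lemma RIC_decay (Q : R -> R -> C) (c d K x : R) : c <= d ->
  cts (fun q : R * R => Q (fst q) (snd q)) ->
  (forall y, c <= y <= d -> Cmod (Q x y) <= K / (1 + x ^ 2)) ->
  Cmod (RIC (Q x) c d) <= K * (d - c) / (1 + x ^ 2).
Proof.
intros Hcd HQ H; replace (K * (d - c) / (1 + x ^ 2)) with (K / (1 + x ^ 2) * (d - c))
  by (unfold Rdiv; ring).
apply RIC_bound_const; [exact Hcd | now apply cts_slice | exact H].
Qed.

(** The real axis is moved to the height [b = a / (2 t)], which completes the square: there the
    exponent is [- t x^2 - a^2 / (4 t)]. The homotopy runs through the heights [y b] for [y] in
    [[0, 1]]. *)
Lemma gauss_FT (t a : R) : 0 < t ->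
  is_int line (fun r : R => gker t a r) (RtoC (sqrt (PI / t) * exp (- (a ^ 2 / (4 * t))))).
Proof.
intros Ht.
set (b := a / (2 * t)).
set (P := fun x y : R => gker t a (x, y * b)).
set (Q := fun x y : R => (Ci * b * P x y)%C).
set (S := fun x y : R => (Ci * b * ((- (2 * (x, Rmult y b) * t) + Ci * a) * P x y))%C).
assert (cz : cts (fun q : R * R => (fst q, snd q * b) : C)) by cts_tac.
assert (cP : cts (fun q : R * R => P (fst q) (snd q))).
{ unfold P; apply cts_gker; [apply ctsR_const | apply ctsR_const | exact cz]. }
assert (cQ : cts (fun q : R * R => Q (fst q) (snd q))).
{ unfold Q; apply cts_mult; [apply cts_const | exact cP]. }
assert (cS : cts (fun q : R * R => S (fst q) (snd q))).
{ unfold S; apply cts_mult; [apply cts_const |]; apply cts_mult; [| exact cP]; cts_tac. }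
(* In the strip swept by the homotopy the modulus exceeds that on the real axis by at most this
   exponential; [1 + / t] comes from [gauss_weight]. *)
set (K := exp (t * b ^ 2 + Rabs (b * a)) * (1 + / t)).
assert (bP : forall x y, 0 <= y <= 1 -> Cmod (P x y) <= K / (1 + x ^ 2)).
{ intros x y Hy; unfold P; rewrite Cmod_gker.
  apply Rle_trans with (exp (t * b ^ 2 + Rabs (b * a)) * exp (- (t * x ^ 2))).
  - rewrite <- exp_plus; apply exp_le.
    assert (- (a * (y * b)) <= Rabs (b * a)).
    { replace (- (a * (y * b))) with (y * (- (b * a))) by ring.
      pose proof (Rle_abs (- (b * a))) as H; rewrite Rabs_Ropp in H.
      pose proof (Rabs_pos (b * a)); nra. }
    assert (t * (y * b) ^ 2 <= t * b ^ 2).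
    { apply Rmult_le_compat_l; [lra |]; rewrite Rpow_mult_distr.
      pose proof (pow2_ge_0 b); assert (y ^ 2 <= 1) by nra; nra. }
    nra.
  - unfold K, Rdiv; rewrite Rmult_assoc; apply Rmult_le_compat_l; [left; apply exp_pos |].
    now apply gauss_weight. }
assert (bQ : forall x y, 0 <= y <= 1 -> Cmod (Q x y) <= Rabs b * K / (1 + x ^ 2)).
{ intros x y Hy; unfold Q; rewrite !Cmod_mult, Cmod_Ci, Cmod_R, Rmult_1_l.
  unfold Rdiv; rewrite Rmult_assoc; apply Rmult_le_compat_l; [apply Rabs_pos | now apply bP]. }
assert (E : int line (fun x => P x 1) = int line (fun x => P x 0)).
{ apply (int_homotopy line P Q S 0 1 K K); try assumption; try lra.
  - intros x y _ _; eapply dC_eq.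
    + apply (dC_gker t a y (fun y => (x, y * b)) (0, b)).
      apply dC_pair; [apply (is_derive_const (V := R_NormedModule)) | auto_derive; [easy | ring]].
    + unfold S; fold (P x y); replace ((0, b) : C) with (Ci * b)%C
        by (apply injective_projections; simpl; ring); ring.
  - intros x y _ _; eapply dC_eq.
    + unfold Q; apply dC_mult; [apply dC_const |].
      apply (dC_gker t a x (fun x => (x, y * b)) 1).
      apply dC_pair; [apply (is_derive_id (K := R_AbsRing)) | apply (is_derive_const (V := R_NormedModule))].
    + unfold S, P; ring.
  - intros x _; apply bP; lra.
  - intros x _; apply bP; lra.
  - apply (decay_lim_m _ (Rabs b * K * (1 - 0))); intros x _; apply RIC_decay; auto; lra.
  - apply (decay_lim_p _ (Rabs b * K * (1 - 0))); intros x _; apply RIC_decay; auto; lra. }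
assert (c0 : cts (fun x => P x 0)) by cts_tac.
assert (I0 : is_int line (fun x => P x 0) (int line (fun x => P x 0))).
{ apply (int_correct line _ K c0); intros x _; apply bP; lra. }
rewrite <- E in I0.
assert (I1 : is_int line (fun x => P x 1) (RtoC (sqrt (PI / t) * exp (- (a ^ 2 / (4 * t)))))).
{ rewrite Rmult_comm, RtoC_mult.
  pose proof (is_int_Cmult line _ (RtoC (exp (- (a ^ 2 / (4 * t))))) _ (is_int_line_gauss t Ht)) as H.
  revert H; apply is_int_ext; intros x _.
  rewrite <- RtoC_mult, <- exp_plus; unfold P, gker, Cexp.
  set (w := (- ((x, Rmult 1 b) ^ 2 * t) + Ci * (x, Rmult 1 b) * a)%C).
  replace (Re w) with (- (a ^ 2 / (4 * t)) + - (t * x ^ 2))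
    by (unfold w, b; simpl; field; lra).
  replace (Im w) with 0 by (unfold w, b; simpl; field; lra).
  rewrite cos_0, sin_0; apply injective_projections; simpl; ring. }
rewrite <- (is_int_unique _ _ _ I1).
revert I0; apply is_int_ext; intros x _; unfold P; f_equal.
apply injective_projections; simpl; ring.
Qed.

(* [s = 1] and [s = -1] describe the rays bounding the sector on the right and on the left. *)
Definition sdir (s theta : R) : C := (s * cos theta, sin theta).

Lemma sdir_out : sdir 1 (PI / 4) = dir (PI / 4).
Proof. unfold sdir, dir; now rewrite Rmult_1_l. Qed.

Lemma sdir_in : sdir (-1) (PI / 4) = dir (3 * (PI / 4)).
Proof.
unfold sdir; rewrite dir_in, cos_PI4, sin_PI4; f_equal; ring.
Qed.

Lemma sin_le_cos (y : R) : 0 <= y <= PI / 4 -> 0 <= sin y <= cos y.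
Proof.
intros Hy; pose proof PI_RGT_0; split.
- apply sin_ge_0; lra.
- apply Rle_trans with (sin (PI / 4)).
  + apply sin_incr_1; lra.
  + replace (sin (PI / 4)) with (cos (PI / 4)) by now rewrite cos_PI4, sin_PI4.
    apply cos_decr_1; lra.
Qed.

(** The two summands come from [exp_weight] with the rates [t] and [a / 2], for small and for large
    angles in [gker_sector_bound]. *)
Definition ray_const (t a : R) : R := exp (t / 2) * (1 + 3 / t) ^ 3 + (1 + 3 / (a / 2)) ^ 3.

(** No single factor decays over the whole sector: the Gaussian fails at the angle [PI / 4], the
    factor [exp (- a x sin y)] fails at the angle 0. Where [sin y <= 1 / 2] one has
    [cos^2 y - sin^2 y >= 1 / 2] and the Gaussian is used; elsewhere the other factor decays at rate
    [a / 2]. *)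
Lemma gker_sector_bound (t a s x y : R) : 0 < t -> 0 < a -> s * s = 1 -> 0 <= x ->
  0 <= y <= PI / 4 ->
  (1 + x) * Cmod (gker t a (x * sdir s y)%C) <= ray_const t a / (1 + x ^ 2).
Proof.
intros Ht Ha Hs Hx Hy; destruct (sin_le_cos y Hy) as [H0 H1].
replace (x * sdir s y)%C with ((x * (s * cos y), x * sin y) : C)
  by (unfold sdir; apply injective_projections; simpl; ring).
rewrite Cmod_gker.
replace ((x * (s * cos y)) ^ 2) with (x ^ 2 * cos y ^ 2)
  by (transitivity (x ^ 2 * cos y ^ 2 * (s * s)); [rewrite Hs; ring | ring]).
assert (Hc : cos y ^ 2 = 1 - sin y ^ 2) by (pose proof (sin2_cos2 y); unfold Rsqr in *; nra).
assert (Hp : 0 <= cos y ^ 2 - sin y ^ 2) by nra.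
pose proof (pow2_ge_0 x) as Hx2.
assert (Hexp : exp (- (t * (x ^ 2 * cos y ^ 2 - (x * sin y) ^ 2)) - a * (x * sin y))
  <= exp (t / 2) * exp (- (t * x)) + exp (- (a / 2 * x))).
{ destruct (Rle_dec (sin y) (1 / 2)) as [Hq | Hq].
  - apply Rle_trans with (exp (t / 2) * exp (- (t * x))).
    + rewrite <- exp_plus; apply exp_le.
      assert (0 <= a * (x * sin y)) by (apply Rmult_le_pos; [lra | apply Rmult_le_pos; lra]).
      assert (x ^ 2 * (1 / 2) <= x ^ 2 * cos y ^ 2 - (x * sin y) ^ 2).
      { replace (x ^ 2 * cos y ^ 2 - (x * sin y) ^ 2) with (x ^ 2 * (cos y ^ 2 - sin y ^ 2)) by ring.
        apply Rmult_le_compat_l; [exact Hx2 | nra]. }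
      assert (t * (x ^ 2 * (1 / 2)) <= t * (x ^ 2 * cos y ^ 2 - (x * sin y) ^ 2))
        by (apply Rmult_le_compat_l; lra).
      (* The inequality [x^2 / 2 >= x - 1 / 2] turns Gaussian decay into exponential decay of rate
         [t], at the price of [exp (t / 2)]. *)
      assert (0 <= t * (x - 1) ^ 2) by (apply Rmult_le_pos; [lra | apply pow2_ge_0]).
      lra.
    + pose proof (exp_pos (- (a / 2 * x))); lra.
  - apply Rle_trans with (exp (- (a / 2 * x))).
    + apply exp_le.
      assert (0 <= t * (x ^ 2 * cos y ^ 2 - (x * sin y) ^ 2)).
      { replace (x ^ 2 * cos y ^ 2 - (x * sin y) ^ 2) with (x ^ 2 * (cos y ^ 2 - sin y ^ 2)) by ring.
        apply Rmult_le_pos; [lra |]; now apply Rmult_le_pos. }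
      assert (a * x * (1 / 2) <= a * x * sin y)
        by (apply Rmult_le_compat_l; [apply Rmult_le_pos |]; lra).
      lra.
    + pose proof (Rmult_lt_0_compat _ _ (exp_pos (t / 2)) (exp_pos (- (t * x)))); lra. }
apply (Rmult_le_compat_l (1 + x)) in Hexp; [| lra].
eapply Rle_trans; [exact Hexp |].
pose proof (exp_weight t x Ht Hx) as E1.
pose proof (exp_weight (a / 2) x ltac:(lra) Hx) as E2.
apply (Rmult_le_compat_l (exp (t / 2))) in E1; [| left; apply exp_pos].
unfold ray_const, Rdiv in *; lra.
Qed.

Lemma Cmod_sdir (s y : R) : s * s = 1 -> Cmod (sdir s y) = 1.
Proof.
intros Hs; unfold Cmod, sdir; simpl; transitivity (sqrt 1); [f_equal | apply sqrt_1].
pose proof (sin2_cos2 y); unfold Rsqr in *.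
replace (s * cos y * (s * cos y * 1)) with (s * s * (cos y * cos y)) by ring.
rewrite Hs; lra.
Qed.

Lemma cts_gker_ray {T : UniformSpace} (t a x : T -> R) (d : T -> C) :
  ctsR t -> ctsR a -> ctsR x -> cts d -> cts (fun p => gker (t p) (a p) (x p * d p)%C).
Proof. intros; apply cts_gker; cts_tac. Qed.

Lemma Cmod_s (s : R) : s * s = 1 -> Cmod s = 1.
Proof.
intros Hs; rewrite Cmod_R.
assert (H : Rabs s * Rabs s = 1) by (rewrite <- Rabs_mult, Hs; apply Rabs_R1).
pose proof (Rabs_pos s); nra.
Qed.

(** The homotopy parameter is the angle, from 0 to [PI / 4]. Since [sdir s] has derivative
    [s Ci sdir s], the component [Q] is [s Ci x P]. *)
Lemma gker_ray_rotate (t a s : R) : 0 < t -> 0 < a -> s * s = 1 ->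
  int half (fun x => sdir s (PI / 4) * gker t a (x * sdir s (PI / 4)))%C
  = int half (fun x => s * gker t a (x * s)%R)%C.
Proof.
intros Ht Ha Hs; pose proof PI_RGT_0 as HPI.
set (P := fun x y : R => (sdir s y * gker t a (x * sdir s y))%C).
set (Q := fun x y : R => (s * Ci * (x * P x y))%C).
set (S := fun x y : R => (s * Ci * (P x y
   + x * sdir s y * ((- (2 * (x * sdir s y) * t) + Ci * a) * P x y)))%C).
assert (cd : cts (fun q : R * R => sdir s (snd q))) by (unfold sdir; cts_tac).
assert (cP : cts (fun q : R * R => P (fst q) (snd q))).
{ unfold P; apply cts_mult; [exact cd |].
  apply cts_gker_ray; try apply ctsR_const; [cts_tac | exact cd]. }
assert (cQ : cts (fun q : R * R => Q (fst q) (snd q))).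
{ unfold Q; apply cts_mult; [apply cts_const |]; apply cts_mult; [cts_tac | exact cP]. }
assert (cS : cts (fun q : R * R => S (fst q) (snd q))).
{ unfold S; apply cts_mult; [apply cts_const |]; apply cts_plus; [exact cP |].
  apply cts_mult; [apply cts_mult; [cts_tac | exact cd] |].
  apply cts_mult; [| exact cP].
  apply cts_plus; [| apply cts_const]; apply cts_opp, cts_mult; [| apply cts_const].
  apply cts_mult; [apply cts_const |]; apply cts_mult; [cts_tac | exact cd]. }
assert (bP : forall x y, 0 <= x -> 0 <= y <= PI / 4 ->
  Cmod (P x y) <= ray_const t a / (1 + x ^ 2) /\ Cmod (Q x y) <= ray_const t a / (1 + x ^ 2)).
{ intros x y Hx Hy; pose proof (gker_sector_bound t a s x y Ht Ha Hs Hx Hy) as B.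
  unfold Q, P; rewrite !Cmod_mult, (Cmod_sdir s y Hs), (Cmod_s s Hs), Cmod_Ci, !Rmult_1_l.
  rewrite Cmod_R, Rabs_pos_eq by exact Hx.
  pose proof (Cmod_ge_0 (gker t a (x * sdir s y))); nra. }
assert (dd : forall y, is_derive_C (sdir s) y (s * Ci * sdir s y)%C).
{ intros y; replace (s * Ci * sdir s y)%C with ((- (s * sin y), cos y) : C).
  - unfold sdir; apply dC_pair; auto_derive; auto; ring.
  - unfold sdir; apply injective_projections; simpl; [ring |].
    transitivity (cos y * (s * s)); [rewrite Hs |]; ring. }
assert (E : int half (fun x => P x (PI / 4)) = int half (fun x => P x 0)).
{ apply (int_homotopy half P Q S 0 (PI / 4) (ray_const t a) (ray_const t a));
    try assumption; try lra.
  - intros x y _ _; eapply dC_eq.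
    + unfold P; apply dC_mult; [apply dd |].
      apply (dC_gker t a y (fun y => x * sdir s y)%C); apply dC_mult; [apply dC_const | apply dd].
    + unfold S, P; ring.
  - intros x y _ _; eapply dC_eq.
    + unfold Q, P; apply dC_mult; [apply dC_const |]; apply dC_mult.
      * apply dC_RtoC, (is_derive_id (K := R_AbsRing)).
      * apply dC_mult; [apply dC_const |].
        apply (dC_gker t a x (fun x => x * sdir s y)%C); apply dC_mult; [| apply dC_const].
        apply dC_RtoC, (is_derive_id (K := R_AbsRing)).
    + unfold S, P; change (@one R_AbsRing) with 1; ring.
  - intros x Hx; apply bP; [exact Hx | lra].
  - intros x Hx; apply bP; [exact Hx | lra].
  (* All paths start at the vertex of the sector, so [Q] vanishes at [x = 0]. *)
  - assert (Z : RIC (Q 0) 0 (PI / 4) = 0).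
    { rewrite (RIC_ext _ (fun _ => RtoC 0)) by (intros y _; unfold Q; ring).
      rewrite (FTC (fun _ => RtoC 0)); [ring | lra | apply cts_const | apply cts_const |].
      intros; apply dC_const. }
    rewrite <- Z; apply (filterlim_at_point (fun x => RIC (Q x) 0 (PI / 4))).
  - apply (decay_lim_p _ (ray_const t a * (PI / 4 - 0))); intros x Hx.
    apply RIC_decay; [lra | exact cQ |]; intros y Hy; now apply bP. }
unfold P in E; rewrite E; apply int_ext; intros x _.
unfold sdir; rewrite cos_0, sin_0, Rmult_1_r; f_equal.
f_equal; apply injective_projections; simpl; ring.
Qed.

Lemma dominated_ray (t a s : R) : 0 < t -> 0 < a -> s * s = 1 ->
  dominated half (fun x => sdir s (PI / 4) * gker t a (x * sdir s (PI / 4)))%C (ray_const t a).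
Proof.
intros Ht Ha Hs x Hx; pose proof PI_RGT_0.
pose proof (gker_sector_bound t a s x (PI / 4) Ht Ha Hs Hx ltac:(lra)) as B.
rewrite Cmod_mult, (Cmod_sdir _ _ Hs), Rmult_1_l.
pose proof (Cmod_ge_0 (gker t a (x * sdir s (PI / 4)))); simpl in Hx; nra.
Qed.

(** The rotated rays are the two halves of the real axis; the minus sign of the incoming ray is
    compensated by its direction [-1], and [gauss_FT] gives the value. *)
Lemma contour_gauss (t a : R) : 0 < t -> 0 < a ->
  (int half (fun x => sdir 1 (PI / 4) * gker t a (x * sdir 1 (PI / 4)))
   - int half (fun x => sdir (-1) (PI / 4) * gker t a (x * sdir (-1) (PI / 4))))%C
  = RtoC (sqrt (PI / t) * exp (- (a ^ 2 / (4 * t)))).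
Proof.
intros Ht Ha.
rewrite !gker_ray_rotate by (assumption || ring).
assert (D : forall s, s * s = 1 ->
  cts (fun x : R => gker t a (x * s)%R) /\ dominated half (fun x : R => gker t a (x * s)%R) (1 + / t)).
{ intros s Hs; split; [apply cts_gker; cts_tac |].
  intros x _; change (RtoC (x * s)) with ((x * s, 0) : C); rewrite Cmod_gker.
  eapply Rle_trans; [| now apply gauss_weight]; apply exp_le.
  replace ((x * s) ^ 2) with (x ^ 2 * (s * s)) by ring; rewrite Hs; apply Req_le; ring. }
assert (I : forall s, s * s = 1 ->
  is_int half (fun x => s * gker t a (x * s)%R)%C (s * int half (fun x : R => gker t a (x * s)%R))%C).
{ intros s Hs; destruct (D s Hs) as [D1 D2].
  apply is_int_Cmult; exact (int_correct half _ _ D1 D2). }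
rewrite (is_int_unique _ _ _ (I 1 ltac:(ring))), (is_int_unique _ _ _ (I (-1) ltac:(ring))).
rewrite <- (is_int_unique _ _ _ (gauss_FT t a Ht)).
destruct (D 1 ltac:(ring)) as [A1 A2]; destruct (D (-1) ltac:(ring)) as [B1 B2].
assert (L : is_int line (fun r : R => gker t a r)
  (int half (fun x : R => gker t a (x * 1)%R) + int half (fun x : R => gker t a (x * -1)%R))%C).
{ apply is_int_line_halves.
  - apply (is_int_ext half (fun x : R => gker t a (x * 1)%R)); [intros x _; now rewrite Rmult_1_r |].
    exact (int_correct half _ _ A1 A2).
  - apply (is_int_ext half (fun x : R => gker t a (x * -1)%R)).
    + intros x _; do 2 f_equal; ring.
    + exact (int_correct half _ _ B1 B2). }
rewrite (is_int_unique _ _ _ L).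
replace (RtoC (-1)) with (- RtoC 1)%C by (rewrite <- RtoC_opp; f_equal; ring).
ring.
Qed.

(** Along each ray, [gker] has derivative [(- 2 z t + i a) gker] with respect to [z] and falls from
    1 at the vertex to 0 at infinity. This expresses the integral of [z gker] by that of [gker]; the
    boundary values 1 cancel between the two rays. *)
Lemma contour_gauss_z (t a : R) : 0 < t -> 0 < a ->
  (int half (fun x => sdir 1 (PI / 4) * (x * sdir 1 (PI / 4) * gker t a (x * sdir 1 (PI / 4))))
   - int half (fun x => sdir (-1) (PI / 4) * (x * sdir (-1) (PI / 4) * gker t a (x * sdir (-1) (PI / 4)))))%C
  = (Ci * (a / (2 * t) * (sqrt (PI / t) * exp (- (a ^ 2 / (4 * t)))))%R)%C.
Proof.
intros Ht Ha; pose proof PI_RGT_0 as HPI.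
assert (K : forall s, s * s = 1 -> let d := sdir s (PI / 4) in
  (RtoC (2 * t) * int half (fun x => d * (x * d * gker t a (x * d)))
   = 1 + Ci * a * int half (fun x => d * gker t a (x * d)))%C).
{ intros s Hs d.
  assert (c0 : cts (fun x : R => gker t a (x * d)%C))
    by (apply cts_gker_ray; try apply ctsR_const; try apply cts_const; cts_tac).
  assert (c1 : cts (fun x : R => d * gker t a (x * d))%C) by cts_tac.
  assert (c2 : cts (fun x : R => d * (x * d * gker t a (x * d)))%C) by cts_tac.
  assert (D0 : dominated half (fun x : R => gker t a (x * d)%C) (ray_const t a)).
  { intros x Hx; pose proof (dominated_ray t a s Ht Ha Hs x Hx) as B; fold d in B.
    cbv beta in B; rewrite Cmod_mult in B; unfold d in B at 1; rewrite (Cmod_sdir _ _ Hs), Rmult_1_l in B; exact B. }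
  assert (D2 : dominated half (fun x : R => d * (x * d * gker t a (x * d)))%C (ray_const t a)).
  { intros x Hx.
    pose proof (gker_sector_bound t a s x (PI / 4) Ht Ha Hs Hx ltac:(lra)) as B; fold d in B.
    cbv beta; rewrite !Cmod_mult; unfold d at 1 2; rewrite (Cmod_sdir _ _ Hs), Rmult_1_l, Rmult_1_r.
    simpl in Hx; rewrite Cmod_R, Rabs_pos_eq by exact Hx.
    pose proof (Cmod_ge_0 (gker t a (x * d))); nra. }
  pose proof (is_int_Cmult half _ (RtoC (2 * t)) _ (int_correct half _ _ c2 D2)) as I2.
  pose proof (is_int_Cmult half _ (Ci * a)%C _
    (int_correct half _ _ c1 (dominated_ray t a s Ht Ha Hs))) as I1.
  pose proof (is_int_minus half _ _ _ _ I1 I2) as I3; simpl in I3.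
  assert (F : is_int half (fun x : R => Ci * a * (d * gker t a (x * d))
       - RtoC (2 * t) * (d * (x * d * gker t a (x * d))))%C (0 - gker t a (RtoC 0 * d)%C)%C).
  { apply (is_int_FTC half (fun x : R => gker t a (x * d)%C)).
    - exact c0.
    - apply cts_minus; apply cts_mult; [apply cts_const | exact c1 | apply cts_const | exact c2].
    - intros x _; eapply dC_eq.
      + apply (dC_gker t a x (fun x => x * d)%C); apply dC_mult; [| apply dC_const].
        apply dC_RtoC, (is_derive_id (K := R_AbsRing)).
      + change (@one R_AbsRing) with 1; rewrite RtoC_mult; ring.
    - apply (filterlim_at_point (fun x : R => gker t a (x * d)%C)).
    - apply (decay_lim_p _ (ray_const t a)); exact D0. }
  pose proof (eq_trans (eq_sym (is_int_unique _ _ _ I3)) (is_int_unique _ _ _ F)) as E.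
  assert (G0 : gker t a (RtoC 0 * d)%C = 1).
  { unfold gker; rewrite <- Cexp_0; f_equal; simpl; ring. }
  rewrite G0 in E.
  set (X := int half (fun x => d * (x * d * gker t a (x * d)))%C) in *.
  set (Y := int half (fun x => d * gker t a (x * d))%C) in *.
  change ((Ci * a * Y - RtoC (2 * t) * X)%C = (0 - 1)%C) in E.
  replace (RtoC (2 * t) * X)%C with (Ci * a * Y - (Ci * a * Y - RtoC (2 * t) * X))%C by ring.
  rewrite E; ring. }
pose proof (K 1 ltac:(ring)) as K1; pose proof (K (-1) ltac:(ring)) as K2; simpl in K1, K2.
pose proof (contour_gauss t a Ht Ha) as G.
set (X1 := int half (fun x => sdir 1 (PI / 4) * (x * sdir 1 (PI / 4) * gker t a (x * sdir 1 (PI / 4))))%C) in *.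
set (X2 := int half (fun x => sdir (-1) (PI / 4) * (x * sdir (-1) (PI / 4) * gker t a (x * sdir (-1) (PI / 4))))%C) in *.
set (Y1 := int half (fun x => sdir 1 (PI / 4) * gker t a (x * sdir 1 (PI / 4)))%C) in *.
set (Y2 := int half (fun x => sdir (-1) (PI / 4) * gker t a (x * sdir (-1) (PI / 4)))%C) in *.
assert (H2 : RtoC (2 * t) <> 0) by (intros H; apply RtoC_inj in H; lra).
assert (E : (RtoC (2 * t) * (X1 - X2) = Ci * a * (Y1 - Y2))%C).
{ replace (RtoC (2 * t) * (X1 - X2))%C with (RtoC (2 * t) * X1 - RtoC (2 * t) * X2)%C by ring.
  rewrite K1, K2; ring. }
rewrite G in E.
replace (X1 - X2)%C with (/ RtoC (2 * t) * (RtoC (2 * t) * (X1 - X2)))%C by (field; exact H2).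
rewrite E.
set (w := sqrt (PI / t) * exp (- (a ^ 2 / (4 * t)))).
replace (RtoC (a / (2 * t) * w)) with (/ RtoC (2 * t) * (RtoC a * RtoC w))%C; [ring |].
rewrite <- RtoC_inv by lra; rewrite <- !RtoC_mult; f_equal; field; lra.
Qed.

(** * Fourier inversion *)

Lemma ctsR_closure (h : R -> R) (d : R) : ctsR h -> 0 < d ->
  (forall x, 0 < x < d -> h x <= 0) -> h 0 <= 0.
Proof.
intros Hh Hd H; apply Rnot_lt_le; intros H0.
destruct (proj1 (filterlim_locally _ _) (Hh 0) (mkposreal _ H0)) as [e He].
pose proof (cond_pos e) as He0.
set (x := Rmin d e / 2).
assert (Hx : 0 < x < d /\ x < e).
{ unfold x, Rmin; destruct Rle_dec; lra. }
assert (B : ball 0 e x).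
{ unfold ball; simpl; unfold AbsRing_ball, abs, minus, plus, opp; simpl.
  rewrite Ropp_0, Rplus_0_r, Rabs_pos_eq; lra. }
specialize (He x B); unfold ball in He; simpl in He.
unfold AbsRing_ball, abs, minus, plus, opp in He; simpl in He.
apply Rabs_def2 in He; specialize (H x ltac:(lra)); lra.
Qed.

(** The form in which the limit of a regularised identity is taken: the discrepancy is continuous at
    0 and of order [x] for small [x > 0]. *)
Lemma cts_zero_of_bound (f : R -> C) (K d : R) : cts f -> 0 < d ->
  (forall x, 0 < x < d -> Cmod (f x) <= K * x) -> f 0 = 0.
Proof.
intros Hf Hd H.
assert (E : Cmod (f 0) - K * 0 <= 0).
{ apply (ctsR_closure (fun x => Cmod (f x) - K * x) d); [cts_tac | exact Hd |].
  intros x Hx; specialize (H x Hx); lra. }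
apply Cmod_eq_0, Rle_antisym; [lra | apply Cmod_ge_0].
Qed.

Lemma cts_eq_at_0 (f g : R -> C) (d : R) : cts f -> cts g -> 0 < d ->
  (forall x, 0 < x < d -> f x = g x) -> f 0 = g 0.
Proof.
intros Hf Hg Hd H.
assert (E : (f 0 - g 0)%C = 0).
{ apply (cts_zero_of_bound (fun x => f x - g x)%C 0 d); [cts_tac | exact Hd |].
  intros x Hx; rewrite (H x Hx); replace (g x - g x)%C with (RtoC 0) by ring.
  rewrite Cmod_0; lra. }
replace (f 0) with (f 0 - g 0 + g 0)%C by ring; rewrite E; ring.
Qed.

Definition fourier (f : R -> C) (k : R) : C :=
  int line (fun x => Cexp (- (Ci * x * k)) * f x)%C.

Lemma Cmod_Cexp_imag (z : C) : Re z = 0 -> Cmod (Cexp z) = 1.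
Proof. intros H; rewrite Cmod_Cexp, H; apply exp_0. Qed.

Lemma dominated_mult (D : int_domain) (f g : R -> C) (A M : R) :
  (forall x, din D x -> Cmod (f x) <= A) -> dominated D g M ->
  dominated D (fun x => f x * g x)%C (A * M).
Proof.
intros Hf Hg x Hx; rewrite Cmod_mult; unfold Rdiv; rewrite Rmult_assoc.
apply Rmult_le_compat; try apply Cmod_ge_0; [now apply Hf | now apply Hg].
Qed.

Lemma dominated_mult_r (D : int_domain) (f g : R -> C) (A M : R) :
  dominated D f M -> (forall x, din D x -> Cmod (g x) <= A) ->
  dominated D (fun x => f x * g x)%C (M * A).
Proof.
intros Hf Hg x Hx; rewrite Cmod_mult.
replace (M * A / (1 + x ^ 2)) with (M / (1 + x ^ 2) * A) by (unfold Rdiv; ring).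
apply Rmult_le_compat; try apply Cmod_ge_0; [now apply Hf | now apply Hg].
Qed.

Lemma int_Cmult (D : int_domain) (f : R -> C) (k : C) (M : R) : cts f -> dominated D f M ->
  int D (fun x => k * f x)%C = (k * int D f)%C.
Proof. intros Hf Hd; eapply is_int_unique, is_int_Cmult, int_correct; eassumption. Qed.

Lemma Cmod_gker_real (t a x : R) : Cmod (gker t a (RtoC x)) = exp (- (t * x ^ 2)).
Proof. unfold RtoC; rewrite Cmod_gker; f_equal; ring. Qed.

(** At time [d^2], and with lengths measured in units of [2 d], the heat kernel is free of [d]; this
    is why the regularising time is written as a square. *)
Lemma gauss_scaled (d w : R) : 0 < d ->
  2 * d * (sqrt (PI / d ^ 2) * exp (- ((2 * d * w) ^ 2 / (4 * d ^ 2)))) = 2 * sqrt PI * exp (- w ^ 2).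
Proof.
intros Hd; pose proof PI_RGT_0.
rewrite sqrt_div_alt by nra; rewrite sqrt_pow2 by lra.
replace ((2 * d * w) ^ 2 / (4 * d ^ 2)) with (w ^ 2) by (field; lra); field; lra.
Qed.

Lemma int_line_gauss1_scal (z : C) :
  int line (fun w => RtoC (2 * sqrt PI) * (gauss1 w * z))%C = (2 * PI * z)%C.
Proof.
pose proof (is_int_Cmult line _ (RtoC (2 * sqrt PI) * z)%C _ is_int_line_gauss1) as H.
apply (is_int_ext _ _ (fun w => RtoC (2 * sqrt PI) * (gauss1 w * z))%C) in H;
  [| intros; ring].
rewrite (is_int_unique _ _ _ H).
replace (RtoC PI) with (RtoC (sqrt PI) * RtoC (sqrt PI))%C
  by (rewrite <- RtoC_mult, sqrt_sqrt; [reflexivity | left; apply PI_RGT_0]).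
rewrite RtoC_mult; ring.
Qed.

(* Gaussian regularisation: the factor [exp (- d^2 k^2)] makes Fubini applicable; both sides are
   continuous at [d = 0], on the physical side after the substitution [x = 2 d w + c]. *)
Lemma fourier_inversion (f : R -> C) (c M M' : R) :
  cts f -> dominated line f M -> cts (fourier f) -> dominated line (fourier f) M' ->
  int line (fun k => Cexp (Ci * k * c) * fourier f k)%C = (2 * PI * f c)%C.
Proof.
intros Hf Df Hh Dh.
set (Phi := fun d => int line (fun k : R => gker (d ^ 2) c k * fourier f k)%C).
set (Psi := fun d => int line (fun w => RtoC (2 * sqrt PI) * (gauss1 w * f (2 * d * w + c)%R))%C).
assert (cg := cts_gauss1).
assert (cPhi : cts Phi).
(* The Gaussian factor has modulus at most 1, so the bound of the transform is uniform in [d],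
   including [d = 0]. *)
{ apply (cts_int_unif line (fun d k => gker (d ^ 2) c (RtoC k) * fourier f k)%C (1 * M')).
  - apply cts_mult; [apply cts_gker; cts_tac |].
    apply (cts_comp1 (fourier f)); [exact Hh | cts_tac].
  - intros d; apply dominated_mult; [| exact Dh].
    intros k _; rewrite (Cmod_gker_real (d ^ 2) c k), <- exp_0; apply exp_le.
    assert (0 <= d ^ 2 * k ^ 2) by (apply Rmult_le_pos; apply pow2_ge_0); lra. }
assert (cPsi : cts Psi).
{ apply (cts_int_unif line (fun d w => RtoC (2 * sqrt PI) * (gauss1 w * f (2 * d * w + c)%R))%C
    (2 * sqrt PI * (2 * M))).
  - cts_tac.
  - intros d; apply dominated_mult.
    + intros w _; rewrite Cmod_R, Rabs_pos_eq; [lra |].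
      pose proof (sqrt_pos PI); lra.
    + apply dominated_mult_r; [apply gauss1_dominated |].
      intros w _; eapply Rle_trans; [now apply Df |].
      apply div_weight_le, (dominated_nonneg _ _ _ Df). }
assert (E : Phi 0 = Psi 0).
{ apply (cts_eq_at_0 Phi Psi 1 cPhi cPsi Rlt_0_1); intros d [Hd _].
  assert (Hd2 : 0 < d ^ 2) by nra.
  set (F := fun k x : R => (gker (d ^ 2) c (RtoC k) * (Cexp (- (Ci * x * k)) * f x))%C).
  assert (cF : cts (fun q : R * R => F (fst q) (snd q))).
  { unfold F; apply cts_mult; [apply cts_gker; cts_tac | cts_tac]. }
  assert (bF : forall k x : R, Cmod (F k x) <= (1 + / d ^ 2) * M / (1 + k ^ 2) / (1 + x ^ 2)).
  { intros k x; unfold F; rewrite !Cmod_mult, (Cmod_gker_real (d ^ 2) c k).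
    rewrite (Cmod_Cexp_imag (- (Ci * x * k))%C), Rmult_1_l by (simpl; ring).
    replace ((1 + / d ^ 2) * M / (1 + k ^ 2) / (1 + x ^ 2))
      with ((1 + / d ^ 2) / (1 + k ^ 2) * (M / (1 + x ^ 2))) by (unfold Rdiv; ring).
    apply Rmult_le_compat; try (left; apply exp_pos); try apply Cmod_ge_0; [| now apply Df].
    apply (gauss_weight (d ^ 2) k Hd2). }
  assert (E1 : Phi d = int line (fun k => int line (F k))).
  { unfold Phi; apply int_ext; intros k _; unfold F, fourier; symmetry.
    apply (int_Cmult line _ _ (1 * M)); [cts_tac |]; apply dominated_mult; [| exact Df].
    intros x _; rewrite Cmod_Cexp_imag by (simpl; ring); lra. }
  rewrite E1, (is_int_unique _ _ _ (Fubini line line F _ cF (fun k x _ _ => bF k x))).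
  (* Integration in [k] first leaves the heat kernel at time [d^2] centred at [c]. *)
  assert (E2 : forall x, int line (fun k => F k x)
    = (RtoC (sqrt (PI / d ^ 2) * exp (- ((c - x) ^ 2 / (4 * d ^ 2)))) * f x)%C).
  { intros x; rewrite Cmult_comm.
    apply is_int_unique.
    apply (is_int_ext line (fun k : R => f x * gker (d ^ 2) (c - x) k)%C).
    - intros k _; unfold F, gker; rewrite (Cmult_comm (f x)), Cmult_assoc, <- Cexp_plus.
      f_equal; f_equal; rewrite RtoC_minus; ring.
    - apply is_int_Cmult, gauss_FT, Hd2. }
  rewrite (int_ext line _ (fun x => RtoC (sqrt (PI / d ^ 2) * exp (- ((c - x) ^ 2 / (4 * d ^ 2)))) * f x)%C)
    by (intros x _; apply E2).
  assert (cE : cts (fun x => RtoC (sqrt (PI / d ^ 2) * exp (- ((c - x) ^ 2 / (4 * d ^ 2)))) * f x)%C)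
    by (cts_tac; intros; lra).
  assert (DE : dominated line (fun x => RtoC (sqrt (PI / d ^ 2) * exp (- ((c - x) ^ 2 / (4 * d ^ 2)))) * f x)%C
    (sqrt (PI / d ^ 2) * M)).
  { apply dominated_mult; [| exact Df]; intros x _.
    rewrite Cmod_R, Rabs_pos_eq.
    - rewrite <- (Rmult_1_r (sqrt (PI / d ^ 2))) at 2; apply Rmult_le_compat_l; [apply sqrt_pos |].
      rewrite <- exp_0; apply exp_le.
      assert (0 <= (c - x) ^ 2 / (4 * d ^ 2)) by (apply Rdiv_le_0_compat; [apply pow2_ge_0 | lra]); lra.
    - apply Rmult_le_pos; [apply sqrt_pos | left; apply exp_pos]. }
  pose proof (is_int_line_scal _ (2 * d) c _ ltac:(lra) (int_correct line _ _ cE DE)) as I.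
  refine (eq_trans (eq_sym (is_int_unique _ _ _ I)) _); unfold Psi; apply int_ext; intros w _.
  unfold gauss1; rewrite !Cmult_assoc, <- !RtoC_mult; f_equal; f_equal.
  rewrite <- (gauss_scaled d w Hd); f_equal; f_equal; f_equal; f_equal; f_equal; ring. }
unfold Phi, Psi in E.
assert (E0 : int line (fun w => RtoC (2 * sqrt PI) * (gauss1 w * f (2 * 0 * w + c)%R))%C
  = int line (fun w => RtoC (2 * sqrt PI) * (gauss1 w * f c))%C).
{ apply int_ext; intros w _; replace (2 * 0 * w + c) with c by ring; reflexivity. }
rewrite E0, int_line_gauss1_scal in E.
transitivity (int line (fun k : R => gker (0 ^ 2) c k * fourier f k)%C); [| exact E].
apply int_ext; intros k _; unfold gker; f_equal; f_equal.
replace (0 ^ 2)%R with 0 by ring; ring.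
Qed.

(** * The heat equation on the half line *)

(* [2 PI] times the heat kernel *)
Definition hk (s a : R) : R := sqrt (PI / s) * exp (- (a ^ 2 / (4 * s))).
Definition hk1 (s a : R) : R := - (a / (2 * s)) * hk s a.
Definition hk2 (s a : R) : R := (a ^ 2 / (4 * s ^ 2) - / (2 * s)) * hk s a.

Lemma hk_dx (s a : R) : 0 < s -> is_derive (hk s) a (hk1 s a).
Proof.
intros Hs; unfold hk1, hk; auto_derive; [lra |].
replace (a * (a * 1)) with (a ^ 2) by ring; unfold Rdiv; field; lra.
Qed.

Lemma hk1_dx (s a : R) : 0 < s -> is_derive (hk1 s) a (hk2 s a).
Proof.
intros Hs.
replace (hk2 s a) with (- / (2 * s) * hk s a + - (a / (2 * s)) * hk1 s a)
  by (unfold hk2, hk1; field; lra).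
apply (dR_mult (fun a => - (a / (2 * s))) (hk s)); [| now apply hk_dx].
auto_derive; [lra | field; lra].
Qed.

(** With [hk_dx] and [hk1_dx] this is the heat equation for the kernel: [hk2] is also its second
    derivative in [a]. *)
Lemma hk_dt (s a : R) : 0 < s -> is_derive (fun s => hk s a) s (hk2 s a).
Proof.
intros Hs; pose proof PI_RGT_0 as HPI.
assert (Hq : 0 < PI / s) by now apply Rdiv_lt_0_compat.
assert (D1 : is_derive (fun s => sqrt (PI / s)) s (- (sqrt (PI / s) / (2 * s)))).
{ auto_derive; [split; [lra | exact (conj Hq I)] |].
  pose proof (sqrt_lt_R0 _ Hq) as H1; pose proof (sqrt_sqrt _ (Rlt_le _ _ Hq)) as H2.
  unfold Rdiv in *; set (q := sqrt (PI * / s)) in *.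
  replace PI with (q * q * s) by (rewrite H2; field; lra); field; lra. }
assert (D2 : is_derive (fun s => exp (- (a ^ 2 / (4 * s)))) s
  (a ^ 2 / (4 * s ^ 2) * exp (- (a ^ 2 / (4 * s))))).
{ auto_derive; [lra |]; replace (a * (a * 1)) with (a ^ 2) by ring; unfold Rdiv; field; lra. }
replace (hk2 s a) with (- (sqrt (PI / s) / (2 * s)) * exp (- (a ^ 2 / (4 * s)))
  + sqrt (PI / s) * (a ^ 2 / (4 * s ^ 2) * exp (- (a ^ 2 / (4 * s)))))
  by (unfold hk2, hk; field; lra).
now apply (dR_mult (fun s => sqrt (PI / s)) (fun s => exp (- (a ^ 2 / (4 * s))))).
Qed.

Lemma ctsR_sqrt {T : UniformSpace} (f : T -> R) : ctsR f -> ctsR (fun p => sqrt (f p)).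
Proof. apply (ctsR_comp sqrt); intros x; apply continuous_sqrt. Qed.

Lemma ctsR_hk {T : UniformSpace} (s a : T -> R) : (forall p, 0 < s p) -> ctsR s -> ctsR a ->
  ctsR (fun p => hk (s p) (a p)).
Proof.
intros H Hs Ha; unfold hk; apply ctsR_mult.
- apply ctsR_sqrt; cts_tac; intros p; specialize (H p); lra.
- cts_tac; intros p; specialize (H p); lra.
Qed.

Lemma ctsR_hk1 {T : UniformSpace} (s a : T -> R) : (forall p, 0 < s p) -> ctsR s -> ctsR a ->
  ctsR (fun p => hk1 (s p) (a p)).
Proof.
intros H Hs Ha; unfold hk1; apply ctsR_mult; [| now apply ctsR_hk].
cts_tac; intros p; specialize (H p); lra.
Qed.

Lemma ctsR_hk2 {T : UniformSpace} (s a : T -> R) : (forall p, 0 < s p) -> ctsR s -> ctsR a ->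
  ctsR (fun p => hk2 (s p) (a p)).
Proof.
intros H Hs Ha; unfold hk2; apply ctsR_mult; [| now apply ctsR_hk].
cts_tac; intros p; specialize (H p); try apply Rgt_not_eq; nra.
Qed.

Lemma hk_pos (s a : R) : 0 < s -> 0 < hk s a.
Proof.
intros H; apply Rmult_lt_0_compat; [| apply exp_pos].
apply sqrt_lt_R0, Rdiv_lt_0_compat; [apply PI_RGT_0 | exact H].
Qed.

Lemma exp_opp_le (q : R) : 0 <= q -> exp (- q) <= / (1 + q).
Proof.
intros Hq; rewrite exp_Ropp; apply Rinv_le_contravar; [lra | apply exp_ineq1_le].
Qed.

Lemma hk_le (e s a : R) : 0 < e -> e <= s -> hk s a <= sqrt (PI / e).
Proof.
intros He Hs; unfold hk; rewrite <- (Rmult_1_r (sqrt (PI / e))).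
pose proof PI_RGT_0.
apply Rmult_le_compat; [apply sqrt_pos | left; apply exp_pos | |].
- apply sqrt_le_1_alt, Rmult_le_compat_l; [lra |]; apply Rinv_le_contravar; lra.
- rewrite <- exp_0; apply exp_le.
  assert (0 <= a ^ 2 / (4 * s)) by (apply Rdiv_le_0_compat; [apply pow2_ge_0 | lra]); lra.
Qed.

(** Away from its centre the kernel vanishes as time tends to 0. A linear rate in [d] suffices for
    [cts_zero_of_bound], and [exp (- q) <= / q] provides it. *)
Lemma hk_small (d a : R) : 0 < d -> 0 < a -> hk (d ^ 2) a <= 4 * sqrt PI / a ^ 2 * d.
Proof.
intros Hd Ha; unfold hk; pose proof PI_RGT_0 as HPI.
assert (Hd2 : 0 < d ^ 2) by nra; assert (Ha2 : 0 < a ^ 2) by nra.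
rewrite sqrt_div_alt, sqrt_pow2 by lra.
assert (Hq : 0 <= a ^ 2 / (4 * d ^ 2)) by (apply Rdiv_le_0_compat; lra).
assert (He : exp (- (a ^ 2 / (4 * d ^ 2))) <= 4 * d ^ 2 / a ^ 2).
{ eapply Rle_trans; [apply exp_opp_le, Hq |].
  replace (4 * d ^ 2 / a ^ 2) with (/ (a ^ 2 / (4 * d ^ 2))) by (field; lra).
  apply Rinv_le_contravar; [apply Rdiv_lt_0_compat; lra | lra]. }
apply Rle_trans with (sqrt PI / d * (4 * d ^ 2 / a ^ 2)).
- apply Rmult_le_compat_l; [| exact He].
  apply Rdiv_le_0_compat; [apply sqrt_pos | exact Hd].
- apply Req_le; field; lra.
Qed.

(* AM-GM: [|a| / sqrt s <= 1 + a^2 / (4 s)] *)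
Lemma hk1_le (e s a : R) : 0 < e -> e <= s -> Rabs (hk1 s a) <= sqrt (PI / e) / sqrt e.
Proof.
intros He Hs; assert (Hs0 : 0 < s) by lra.
pose proof (sqrt_lt_R0 s Hs0) as Hr; pose proof (sqrt_sqrt s (Rlt_le _ _ Hs0)) as Hrr.
pose proof (sqrt_lt_R0 e He) as Hre.
pose proof PI_RGT_0.
unfold hk1, hk; rewrite !Rabs_mult, (Rabs_pos_eq (sqrt (PI / s))), (Rabs_pos_eq (exp _))
  by (apply sqrt_pos || (left; apply exp_pos)).
rewrite Rabs_Ropp, Rabs_div by lra; rewrite (Rabs_pos_eq (2 * s)) by lra.
set (r := sqrt s) in *; set (b := Rabs a).
assert (Hb : 0 <= b) by apply Rabs_pos.
assert (Hbb : a ^ 2 = b ^ 2) by (unfold b; now rewrite pow2_abs).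
assert (Hx : b / (2 * s) * exp (- (a ^ 2 / (4 * s))) <= / r).
{ assert (Hq : 0 <= a ^ 2 / (4 * s)) by (apply Rdiv_le_0_compat; [apply pow2_ge_0 | lra]).
  apply Rle_trans with (b / (2 * s) * / (1 + a ^ 2 / (4 * s))).
  - apply Rmult_le_compat_l; [apply Rdiv_le_0_compat; lra | now apply exp_opp_le].
  - rewrite Hbb, <- Hrr.
    assert (Hb2 := pow2_ge_0 b); assert (Hr2 : 0 < r * r) by nra.
    replace (b / (2 * (r * r)) * / (1 + b ^ 2 / (4 * (r * r))))
      with (2 * b / (4 * (r * r) + b ^ 2)) by (field; split; nra).
    apply (Rmult_le_reg_r (r * (4 * (r * r) + b ^ 2))); [apply Rmult_lt_0_compat; nra |].
    replace (2 * b / (4 * (r * r) + b ^ 2) * (r * (4 * (r * r) + b ^ 2))) with (2 * b * r)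
      by (field; nra).
    replace (/ r * (r * (4 * (r * r) + b ^ 2))) with (4 * (r * r) + b ^ 2) by (field; lra).
    pose proof (pow2_ge_0 (b - r)); nra. }
replace (b / (2 * s) * (sqrt (PI / s) * exp (- (a ^ 2 / (4 * s)))))
  with (sqrt (PI / s) * (b / (2 * s) * exp (- (a ^ 2 / (4 * s))))) by ring.
apply Rmult_le_compat.
- apply sqrt_pos.
- apply Rmult_le_pos; [apply Rdiv_le_0_compat; lra | left; apply exp_pos].
- apply sqrt_le_1_alt, Rmult_le_compat_l; [lra |]; apply Rinv_le_contravar; lra.
- eapply Rle_trans; [exact Hx |]; apply Rinv_le_contravar; [exact Hre |].
  unfold r; apply sqrt_le_1_alt, Hs.
Qed.

(** [2 PI] times the Dirichlet heat kernel of the half line: the image charge at [- y] makes it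
    vanish at [a = 0]. *)
Definition dirk (y s a : R) : R := hk s (y - a) - hk s (y + a).

Lemma dirk_dx (y s a : R) : 0 < s ->
  is_derive (dirk y s) a (- hk1 s (y - a) - hk1 s (y + a)).
Proof.
intros Hs; unfold dirk.
apply (is_derive_minus (V := R_NormedModule) (fun a => hk s (y - a)) (fun a => hk s (y + a))).
- replace (- hk1 s (y - a)) with (scal (-1) (hk1 s (y - a)))
    by (unfold scal; simpl; unfold mult; simpl; ring).
  apply (is_derive_comp (hk s) (fun a => y - a)); [now apply hk_dx | auto_derive; [easy | ring]].
- replace (hk1 s (y + a)) with (scal 1 (hk1 s (y + a)))
    by (unfold scal; simpl; unfold mult; simpl; ring).
  apply (is_derive_comp (hk s) (fun a => y + a)); [now apply hk_dx | auto_derive; [easy | ring]].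
Qed.

Lemma dirk1_dx (y s a : R) : 0 < s ->
  is_derive (fun a => - hk1 s (y - a) - hk1 s (y + a)) a (hk2 s (y - a) - hk2 s (y + a)).
Proof.
intros Hs.
apply (is_derive_minus (V := R_NormedModule) (fun a => - hk1 s (y - a)) (fun a => hk1 s (y + a))).
- replace (hk2 s (y - a)) with (opp (scal (-1) (hk2 s (y - a))))
    by (unfold opp, scal; simpl; unfold mult, opp; simpl; ring).
  apply (is_derive_opp (V := R_NormedModule) (fun a => hk1 s (y - a))).
  apply (is_derive_comp (hk1 s) (fun a => y - a)); [now apply hk1_dx | auto_derive; [easy | ring]].
- replace (hk2 s (y + a)) with (scal 1 (hk2 s (y + a)))
    by (unfold scal; simpl; unfold mult; simpl; ring).
  apply (is_derive_comp (hk1 s) (fun a => y + a)); [now apply hk1_dx | auto_derive; [easy | ring]].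
Qed.

Lemma dirk_dt (y s a : R) : 0 < s ->
  is_derive (fun s => dirk y s a) s (hk2 s (y - a) - hk2 s (y + a)).
Proof.
intros Hs; apply (is_derive_minus (V := R_NormedModule)); now apply hk_dt.
Qed.

Lemma dirk_le (y e s a : R) : 0 < e -> e <= s -> Cmod (dirk y s a) <= 2 * sqrt (PI / e).
Proof.
intros He Hs; rewrite Cmod_R; unfold dirk.
pose proof (hk_le e s (y - a) He Hs); pose proof (hk_le e s (y + a) He Hs).
pose proof (hk_pos s (y - a)); pose proof (hk_pos s (y + a)).
apply Rabs_le; lra.
Qed.

(** With [k] the Dirichlet kernel at time [t - tau], [k] solves the backward and [v] the forward
    equation, so the [tau]-derivative of [k v] is the [s]-derivative of [k v_s - k_s v]. Stopping at
    [t - e] avoids the singularity of the kernel at [tau = t]. *)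
Lemma heat_green (v v1 v2 : R -> R -> C) (t y M e : R) :
  0 < e < t -> 0 < y ->
  cts (fun q : R * R => v (fst q) (snd q)) -> cts (fun q : R * R => v1 (fst q) (snd q)) ->
  cts (fun q : R * R => v2 (fst q) (snd q)) ->
  (forall s tau, 0 <= s -> Cmod (v s tau) <= M / (1 + s ^ 2)) ->
  (forall s tau, 0 <= s -> Cmod (v1 s tau) <= M / (1 + s ^ 2)) ->
  (forall s tau, 0 < s -> 0 < tau < t -> is_derive_C (fun s => v s tau) s (v1 s tau)) ->
  (forall s tau, 0 < s -> 0 < tau < t -> is_derive_C (fun s => v1 s tau) s (v2 s tau)) ->
  (forall s tau, 0 < s -> 0 < tau < t -> is_derive_C (fun tau => v s tau) tau (v2 s tau)) ->
  (int half (fun s => dirk y e s * v s (t - e)%R) - int half (fun s => dirk y t s * v s 0%R))%C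
  = RIC (fun tau => RtoC (y / (t - tau) * hk (t - tau) y) * v 0%R tau)%C 0 (t - e).
Proof.
intros He Hy cv cv1 cv2 bv bv1 H1 H2 H3.
(* Agrees with [t - tau] up to the time [t - e] and stays at least [e], so that the kernels are
   continuous and bounded for all real [tau]. *)
set (sg := fun tau => Rmax e (t - tau)).
assert (psg : forall tau, 0 < sg tau) by (intros tau; pose proof (Rmax_l e (t - tau)); unfold sg; lra).
assert (csg : ctsR sg) by (unfold sg; cts_tac).
set (k := fun s tau => dirk y (sg tau) s).
set (k1 := fun s tau => - hk1 (sg tau) (y - s) - hk1 (sg tau) (y + s)).
set (k2 := fun s tau => hk2 (sg tau) (y - s) - hk2 (sg tau) (y + s)).
assert (ck : ctsR (fun q : R * R => k (fst q) (snd q))).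
{ unfold k, dirk; apply ctsR_minus; apply ctsR_hk; try (intros; apply psg); cts_tac. }
assert (ck1 : ctsR (fun q : R * R => k1 (fst q) (snd q))).
{ unfold k1; apply ctsR_minus; [apply ctsR_opp |]; apply ctsR_hk1; try (intros; apply psg); cts_tac. }
assert (ck2 : ctsR (fun q : R * R => k2 (fst q) (snd q))).
{ unfold k2; apply ctsR_minus; apply ctsR_hk2; try (intros; apply psg); cts_tac. }
set (P := fun s tau => (k s tau * v s tau)%C).
set (Q := fun s tau => (k s tau * v1 s tau - k1 s tau * v s tau)%C).
set (S := fun s tau => (k s tau * v2 s tau - k2 s tau * v s tau)%C).
assert (cP : cts (fun q : R * R => P (fst q) (snd q))).
{ unfold P; apply cts_mult; [apply cts_RtoC, ck | exact cv]. }
assert (cQ : cts (fun q : R * R => Q (fst q) (snd q))).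
{ unfold Q; apply cts_minus; apply cts_mult;
    [apply cts_RtoC, ck | exact cv1 | apply cts_RtoC, ck1 | exact cv]. }
assert (cS : cts (fun q : R * R => S (fst q) (snd q))).
{ unfold S; apply cts_minus; apply cts_mult;
    [apply cts_RtoC, ck | exact cv2 | apply cts_RtoC, ck2 | exact cv]. }
assert (bk : forall s tau, Cmod (k s tau) <= 2 * sqrt (PI / e)).
{ intros s tau; apply dirk_le; [lra | apply Rmax_l]. }
assert (bk1 : forall s tau, Cmod (k1 s tau) <= 2 * (sqrt (PI / e) / sqrt e)).
{ intros s tau; rewrite Cmod_R; unfold k1.
  pose proof (hk1_le e (sg tau) (y - s) ltac:(lra) (Rmax_l _ _)) as B1.
  pose proof (hk1_le e (sg tau) (y + s) ltac:(lra) (Rmax_l _ _)) as B2.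
  apply Rabs_le_between in B1; apply Rabs_le_between in B2; apply Rabs_le; lra. }
assert (bP : forall tau, dominated half (fun s => P s tau) (2 * sqrt (PI / e) * M)).
{ intros tau; apply dominated_mult; [intros; apply bk | intros s Hs; now apply bv]. }
set (K := 2 * sqrt (PI / e) * M + 2 * (sqrt (PI / e) / sqrt e) * M).
assert (bQ : forall s tau, 0 <= s -> Cmod (Q s tau) <= K / (1 + s ^ 2)).
{ intros s tau Hs; unfold Q, Cminus; eapply Rle_trans; [apply Cmod_triangle |].
  rewrite Cmod_opp, !Cmod_mult; unfold K.
  replace ((2 * sqrt (PI / e) * M + 2 * (sqrt (PI / e) / sqrt e) * M) / (1 + s ^ 2))
    with (2 * sqrt (PI / e) * (M / (1 + s ^ 2)) + 2 * (sqrt (PI / e) / sqrt e) * (M / (1 + s ^ 2)))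
    by (unfold Rdiv; ring).
  apply Rplus_le_compat; apply Rmult_le_compat; try apply Cmod_ge_0; auto. }
assert (dsg : forall tau, 0 < tau < t - e -> locally tau (fun z => t - z = sg z)).
{ intros tau Ht; assert (Hd : 0 < t - e - tau) by lra.
  exists (mkposreal _ Hd); intros z Hz; unfold ball in Hz; simpl in Hz.
  unfold AbsRing_ball, abs, minus, plus, opp in Hz; simpl in Hz; apply Rabs_def2 in Hz.
  unfold sg; rewrite Rmax_right; lra. }
assert (G := int_Green half P Q S 0 (t - e) (2 * sqrt (PI / e) * M) (2 * sqrt (PI / e) * M) (RIC (Q 0) 0 (t - e)) (RtoC 0)
  ltac:(lra) cP cQ cS).
(* At [s = 0] the Dirichlet kernel vanishes and the two terms of its derivative coincide, which
   gives the factor [y / (t - tau)]. *)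
rewrite <- (RIC_ext (fun tau => - Q 0 tau)%C).
2:{ intros tau Ht; rewrite Rmin_left, Rmax_right in Ht by lra.
  unfold Q, k, k1, dirk; rewrite <- (locally_singleton _ _ (dsg tau Ht)).
  unfold hk1; rewrite !Rplus_0_r, !Rminus_0_r, Rminus_diag.
  replace (- (- (y / (2 * (t - tau))) * hk (t - tau) y) - - (y / (2 * (t - tau))) * hk (t - tau) y)
    with (y / (t - tau) * hk (t - tau) y) by (field; lra).
  ring. }
rewrite (RIC_unique (fun tau => - Q 0 tau)%C 0 (t - e) (- RIC (Q 0) 0 (t - e))%C).
2:{ apply (is_RInt_opp (V := C_R_NormedModule)), RIC_correct.
    apply (cts_slice Q cQ). }
replace (- RIC (Q 0) 0 (t - e))%C with (0 - RIC (Q 0) 0 (t - e))%C by ring.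
rewrite <- G.
- apply (f_equal2 Cminus); apply int_ext; intros s _; unfold P, k, sg.
  + rewrite Rmax_left by lra; reflexivity.
  + rewrite Rmax_right, Rminus_0_r by lra; reflexivity.
- intros s tau Hs Ht; unfold P; eapply dC_eq.
  + apply dC_mult; [| apply H3; [exact Hs | lra]].
    apply dC_RtoC; unfold k.
    apply (is_derive_ext_loc (fun z => dirk y (t - z) s)).
    * eapply filter_imp; [| exact (dsg tau Ht)]; intros z Hz; now rewrite Hz.
    * apply (is_derive_comp (V := R_NormedModule) (fun z => dirk y z s) (fun z => t - z) tau
        (hk2 (t - tau) (y - s) - hk2 (t - tau) (y + s)) (-1)).
      -- apply dirk_dt; lra.
      -- auto_derive; [easy | ring].
  + unfold S, k2; rewrite <- (locally_singleton _ _ (dsg tau Ht)).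
    unfold scal; simpl; unfold mult; simpl; apply injective_projections; simpl; ring.
- intros s tau Hs Ht; unfold Q; eapply dC_eq.
  + apply dC_minus; apply dC_mult.
    * apply dC_RtoC, dirk_dx, psg.
    * apply H2; [exact Hs | lra].
    * apply dC_RtoC, dirk1_dx, psg.
    * apply H1; [exact Hs | lra].
  + unfold S, k, k1, k2; rewrite !RtoC_minus; ring.
- apply bP.
- apply bP.
- apply (filterlim_at_point (fun a => RIC (Q a) 0 (t - e))).
- apply (decay_lim_p _ (K * (t - e - 0))); intros s Hs.
  apply RIC_decay; [lra | exact cQ | intros; now apply bQ].
Qed.

Lemma hk_decr (s a b : R) : 0 < s -> 0 <= a <= b -> hk s b <= hk s a.
Proof.
intros Hs Hab; unfold hk; apply Rmult_le_compat_l; [apply sqrt_pos |]; apply exp_le.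
assert (a ^ 2 <= b ^ 2) by (apply pow_incr; lra).
assert (a ^ 2 / (4 * s) <= b ^ 2 / (4 * s))
  by (apply Rmult_le_compat_r; [left; apply Rinv_0_lt_compat |]; lra).
lra.
Qed.

(** The limit [e = d^2 -> 0] in [heat_green]. The direct kernel is tested against the even
    reflection of [v] on the whole line, where rescaling gives a function [Psi] continuous in [d].
    [H] stands for a continuous extension of the boundary kernel beyond [0 < tau < t]; in
    [representation] the contour integral provides one. *)
Lemma heat_half_line (v v1 v2 : R -> R -> C) (H : R -> C) (t y M : R) :
  0 < t -> 0 < y ->
  cts (fun q : R * R => v (fst q) (snd q)) -> cts (fun q : R * R => v1 (fst q) (snd q)) ->
  cts (fun q : R * R => v2 (fst q) (snd q)) ->
  (forall s tau, 0 <= s -> Cmod (v s tau) <= M / (1 + s ^ 2)) ->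
  (forall s tau, 0 <= s -> Cmod (v1 s tau) <= M / (1 + s ^ 2)) ->
  (forall s tau, 0 < s -> 0 < tau < t -> is_derive_C (fun s => v s tau) s (v1 s tau)) ->
  (forall s tau, 0 < s -> 0 < tau < t -> is_derive_C (fun s => v1 s tau) s (v2 s tau)) ->
  (forall s tau, 0 < s -> 0 < tau < t -> is_derive_C (fun tau => v s tau) tau (v2 s tau)) ->
  cts H -> (forall tau, 0 < tau < t -> H tau = RtoC (y / (t - tau) * hk (t - tau) y)) ->
  (2 * PI * v y t)%C
  = (int half (fun s => dirk y t s * v s 0%R) + RIC (fun tau => H tau * v 0%R tau) 0 t)%C.
Proof.
intros Ht Hy cv cv1 cv2 bv bv1 H1 H2 H3 cH EH; pose proof PI_RGT_0 as HPI.
assert (HM : 0 <= M).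
{ apply (dominated_nonneg half (fun s => v s 0)); intros s Hs; now apply bv. }
set (F := fun tau => (H tau * v 0%R tau)%C).
assert (cF : cts F) by (apply cts_mult; [exact cH | exact (cts_slice v cv 0)]).
set (A := int half (fun s => dirk y t s * v s 0%R)%C).
set (Psi := fun d => int line (fun w => RtoC (2 * sqrt PI)
   * (gauss1 w * v (Rabs (2 * d * w + y)) (t - d ^ 2)%R))%C).
assert (cg := cts_gauss1).
assert (cPsi : cts Psi).
{ apply (cts_int_unif line (fun d w => RtoC (2 * sqrt PI)
   * (gauss1 w * v (Rabs (2 * d * w + y)) (t - d ^ 2)%R))%C (2 * sqrt PI * (2 * M))).
  - cts_tac.
  - intros d; apply dominated_mult.
    + intros w _; rewrite Cmod_R, Rabs_pos_eq; [lra |]; pose proof (sqrt_pos PI); lra.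
    + apply dominated_mult_r; [apply gauss1_dominated |].
      intros w _; eapply Rle_trans; [apply bv, Rabs_pos | now apply div_weight_le]. }
assert (cR : cts (fun x => RIC F 0 x)).
{ apply (cts_of_dC _ F); intros x; now apply dC_RIC. }
assert (Z : (Psi 0 - A - RIC F 0 (t - 0 ^ 2)%R)%C = 0).
{ apply (cts_zero_of_bound (fun d => Psi d - A - RIC F 0 (t - d ^ 2)%R)%C
    (2 * (4 * sqrt PI / y ^ 2 * M * PI)) (sqrt t)).
  - apply cts_minus; [exact (cts_minus _ _ cPsi (cts_const A)) |].
    apply (cts_comp1 (fun x => RIC F 0 x)); [exact cR | cts_tac].
  - now apply sqrt_lt_R0.
  - intros d [Hd Hdt].
    assert (Hd2 : 0 < d ^ 2 < t).
    { split; [nra |]; rewrite <- (pow2_sqrt t) by lra.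
      pose proof (sqrt_pos t); nra. }
    set (e := d ^ 2) in *.
    pose proof (heat_green v v1 v2 t y M e Hd2 Hy cv cv1 cv2 bv bv1 H1 H2 H3) as G.
    fold A in G.
    assert (EF : RIC (fun tau => RtoC (y / (t - tau) * hk (t - tau) y) * v 0%R tau)%C 0 (t - e)
      = RIC F 0 (t - e)).
    { apply RIC_ext; intros tau Htau; rewrite Rmin_left, Rmax_right in Htau by lra.
      unfold F; rewrite EH by lra; reflexivity. }
    rewrite EF in G; rewrite <- G.
    set (B := int half (fun s => dirk y e s * v s (t - e)%R)%C).
    (* On the negative half line [f] reproduces the image term [g]. Thus the integral of [f] is that
       of [f0] plus that of [g], Green's identity contains the difference, and the gap of twice the
       integral of [g] is of order [d] because the image lies at distance at least [y]. *)
    set (f := fun s => (RtoC (hk e (y - s)) * v (Rabs s) (t - e)%R)%C).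
    set (g := fun s => (RtoC (hk e (y + s)) * v s (t - e)%R)%C).
    set (f0 := fun s => (RtoC (hk e (y - s)) * v s (t - e)%R)%C).
    assert (chk1 : ctsR (fun s => hk e (y - s)))
      by (apply ctsR_hk; [intros; lra | cts_tac | cts_tac]).
    assert (chk2 : ctsR (fun s => hk e (y + s)))
      by (apply ctsR_hk; [intros; lra | cts_tac | cts_tac]).
    assert (cf : cts f) by (apply cts_mult; [exact (cts_RtoC _ chk1) | cts_tac]).
    assert (cgg : cts g) by (apply cts_mult; [exact (cts_RtoC _ chk2) | cts_tac]).
    assert (cf0 : cts f0) by (apply cts_mult; [exact (cts_RtoC _ chk1) | cts_tac]).
    assert (bhk : forall a, Cmod (hk e a) <= sqrt (PI / e)).
    { intros a; rewrite Cmod_R, Rabs_pos_eq by (left; apply hk_pos; lra).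
      apply hk_le; lra. }
    assert (bf : dominated line f (sqrt (PI / e) * M)).
    { apply dominated_mult; [intros; apply bhk |].
      intros s _; rewrite <- (pow2_abs s); apply bv, Rabs_pos. }
    assert (bf0 : dominated half f0 (sqrt (PI / e) * M)).
    { apply dominated_mult; [intros; apply bhk |]; intros s Hs; now apply bv. }
    assert (bg : dominated half g (4 * sqrt PI / y ^ 2 * d * M)).
    { apply dominated_mult; [| intros s Hs; now apply bv].
      intros s Hs; simpl in Hs; rewrite Cmod_R, Rabs_pos_eq by (left; apply hk_pos; lra).
      eapply Rle_trans; [apply (hk_decr e y (y + s)); lra | now apply hk_small]. }
    pose proof (int_correct half f0 _ cf0 bf0) as If0.
    pose proof (int_correct half g _ cgg bg) as Ig.
    assert (EB : B = (int half f0 - int half g)%C).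
    { unfold B; apply is_int_unique.
      apply (is_int_ext half (fun s => f0 s - g s)%C); [| now apply is_int_minus].
      intros s _; unfold f0, g, dirk; rewrite RtoC_minus; ring. }
    assert (EL : int line f = (int half f0 + int half g)%C).
    { apply is_int_unique, is_int_line_halves.
      - apply (is_int_ext half f0); [| exact If0].
        intros s Hs; simpl in Hs; unfold f, f0; rewrite Rabs_pos_eq by lra; reflexivity.
      - apply (is_int_ext half g); [| exact Ig].
        intros s Hs; simpl in Hs; unfold f, g; rewrite Rabs_Ropp, Rabs_pos_eq by lra.
        replace (y - - s) with (y + s) by ring; reflexivity. }
    assert (EP : Psi d = int line f).
    { pose proof (is_int_line_scal f (2 * d) y _ ltac:(lra) (int_correct line f _ cf bf)) as I.
      refine (eq_trans _ (is_int_unique _ _ _ I)); unfold Psi; apply int_ext; intros w _.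
      unfold f, gauss1; fold e; rewrite !Cmult_assoc, <- !RtoC_mult; f_equal; f_equal.
      rewrite <- (gauss_scaled d w Hd); unfold hk; fold e.
      replace ((y - (2 * d * w + y)) ^ 2) with ((2 * d * w) ^ 2) by ring; ring. }
    replace (Psi d - A - (B - A))%C with (RtoC 2 * int half g)%C
      by (rewrite EP, EL, EB; ring).
    rewrite Cmod_mult, Cmod_R, (Rabs_pos_eq 2) by lra.
    pose proof (int_bound half g _ cgg bg) as Bg.
    replace (2 * (4 * sqrt PI / y ^ 2 * M * PI) * d)
      with (2 * (4 * sqrt PI / y ^ 2 * d * M * PI)) by ring.
    lra. }
assert (EPsi : Psi 0 = (2 * PI * v y t)%C).
{ rewrite <- int_line_gauss1_scal; unfold Psi; apply int_ext; intros w _.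
  replace (2 * 0 * w + y) with y by ring; rewrite (Rabs_pos_eq y) by lra.
  replace (t - 0 ^ 2) with t by ring; reflexivity. }
rewrite EPsi in Z; replace (t - 0 ^ 2) with t in Z by ring.
replace (2 * PI * v y t)%C with (2 * PI * v y t - A - RIC F 0 t + (A + RIC F 0 t))%C by ring.
rewrite Z; ring.
Qed.

(** * The partial Fourier transform *)

Definition cts3 (U : R -> R -> R -> C) : Prop :=
  cts (fun q : R * R * R => U (fst (fst q)) (snd (fst q)) (snd q)).

Definition xfourier (U : R -> R -> R -> C) (k s tau : R) : C := fourier (fun x => U x s tau) k.

Lemma cts_xfourier (U : R -> R -> R -> C) (M : R) : cts3 U ->
  (forall x y t, Cmod (U x y t) <= M / (1 + x ^ 2)) -> cts3 (xfourier U).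
Proof.
intros cU bU; unfold cts3 in *; unfold xfourier, fourier.
apply (cts_int_unif line (fun (q : R * R * R) x =>
  Cexp (- (Ci * x * fst (fst q))) * U x (snd (fst q)) (snd q))%C (1 * M)).
- cts_tac.
- intros q; apply dominated_mult; [| intros x _; apply bU].
  intros x _; rewrite Cmod_Cexp_imag by (simpl; ring); lra.
Qed.

(** Two integrations by parts in one: with [e x = exp (- i k x)], the derivative of [e (f' + i k f)]
    is [e (k^2 f + f'')], so the transforms of [k^2 f] and of [f''] cancel. *)
Lemma fourier_second_derivative (f f1 f2 : R -> C) (A k : R) :
  cts f -> cts f1 -> cts f2 ->
  (forall x, is_derive_C f x (f1 x)) -> (forall x, is_derive_C f1 x (f2 x)) ->
  dominated line f A -> dominated line f1 A -> dominated line f2 A ->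
  (1 + k ^ 2) * Cmod (fourier f k) <= 2 * A * PI.
Proof.
intros c0 c1 c2 d0 d1 b0 b1 b2.
set (e := fun x : R => Cexp (- (Ci * x * k))).
assert (ce : cts e) by (unfold e; cts_tac).
assert (be : forall x, Cmod (e x) = 1) by (intros x; apply Cmod_Cexp_imag; simpl; ring).
assert (de : forall x, is_derive_C e x (- (Ci * k) * e x)%C).
{ intros x; eapply dC_eq.
  - apply dC_Cexp, dC_opp, dC_mult; [| apply dC_const]; apply dC_mult; [apply dC_const |].
    apply dC_RtoC, (is_derive_id (K := R_AbsRing)).
  - unfold e; change (@one R_AbsRing) with 1; ring. }
assert (F : is_int line (fun x => e x * (RtoC (k ^ 2) * f x + f2 x))%C (0 - 0)%C).
{ assert (B : forall x, Cmod (e x * (f1 x + Ci * k * f x)) <= (A + Rabs k * A) / (1 + x ^ 2)).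
  { intros x; rewrite Cmod_mult, be, Rmult_1_l; eapply Rle_trans; [apply Cmod_triangle |].
    rewrite !Cmod_mult, Cmod_Ci, Cmod_R, Rmult_1_l.
    unfold Rdiv; rewrite Rmult_plus_distr_r, Rmult_assoc; apply Rplus_le_compat; [now apply b1 |].
    apply Rmult_le_compat_l; [apply Rabs_pos | now apply b0]. }
  apply (is_int_FTC line (fun x => e x * (f1 x + Ci * k * f x))%C).
  - cts_tac.
  - cts_tac.
  - intros x _; eapply dC_eq.
    + apply dC_mult; [apply de |]; apply dC_plus; [apply d1 |].
      apply dC_mult; [apply dC_const | apply d0].
    + rewrite RtoC_pow; replace (RtoC k ^ 2)%C with (- (Ci * k) * (Ci * k))%C; [ring |].
      apply injective_projections; simpl; ring.
  - apply (decay_lim_m _ (A + Rabs k * A)); auto.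
  - apply (decay_lim_p _ (A + Rabs k * A)); auto. }
assert (D0 : dominated line (fun x => e x * f x)%C (1 * A))
  by (apply dominated_mult; [intros x _; rewrite be; lra | exact b0]).
assert (D2 : dominated line (fun x => e x * f2 x)%C (1 * A))
  by (apply dominated_mult; [intros x _; rewrite be; lra | exact b2]).
assert (C0 : cts (fun x => e x * f x)%C) by cts_tac.
assert (C2 : cts (fun x => e x * f2 x)%C) by cts_tac.
pose proof (int_correct line _ _ C0 D0) as I0; pose proof (int_correct line _ _ C2 D2) as I2.
pose proof (is_int_plus line _ _ _ _ (is_int_Cmult line _ (RtoC (k ^ 2)) _ I0) I2) as I.
apply (is_int_ext line _ (fun x => e x * (RtoC (k ^ 2) * f x + f2 x))%C) in I; [| intros; ring].
pose proof (eq_trans (eq_sym (is_int_unique _ _ _ I)) (is_int_unique _ _ _ F)) as E.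
set (Z := int line (fun x => e x * f2 x)%C) in *.
change ((RtoC (k ^ 2) * fourier f k + Z)%C = (0 - 0)%C) in E.
assert (E' : (RtoC (1 + k ^ 2) * fourier f k)%C = (fourier f k - Z)%C).
{ rewrite RtoC_plus.
  replace ((1 + RtoC (k ^ 2)) * fourier f k)%C
    with (fourier f k + (RtoC (k ^ 2) * fourier f k + Z) - Z)%C by ring.
  rewrite E; ring. }
replace (1 + k ^ 2) with (Cmod (RtoC (1 + k ^ 2)))
  by (rewrite Cmod_R; apply Rabs_pos_eq; left; apply weight_pos).
rewrite <- Cmod_mult, E'; unfold Cminus; eapply Rle_trans; [apply Cmod_triangle |].
rewrite Cmod_opp.
pose proof (int_bound line _ _ C0 D0) as B0; pose proof (int_bound line _ _ C2 D2) as B2.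
change (Cmod (fourier f k) <= 1 * A * PI) in B0; change (Cmod Z <= 1 * A * PI) in B2.
lra.
Qed.

(** The pattern shared by the three terms of the formula. Here [r] parametrises the line or a ray,
    [s] is the space or time variable of the data, and [phi] is the transform of [f] in [kap].
    Exchanging [r] and [s] isolates a kernel [K] free of [kap]; exchanging [s] and [kap] then lets
    the inversion formula act on [phi]. *)
Lemma kernel_fubini (D1 D2 : int_domain) (k phi : R -> R -> C) (f : R -> C) (c Mk Mp Mf : R) :
  cts (fun q : R * R => k (fst q) (snd q)) -> cts (fun q : R * R => phi (fst q) (snd q)) ->
  cts f ->
  (forall r s, din D1 r -> din D2 s -> Cmod (k r s) <= Mk / (1 + r ^ 2)) ->
  (forall kap s, din D2 s -> Cmod (phi kap s) <= Mp / (1 + kap ^ 2) / (1 + s ^ 2)) ->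
  dominated D2 f Mf ->
  (forall s, din D2 s ->
     int line (fun kap => Cexp (Ci * kap * c) * phi kap s)%C = (2 * PI * f s)%C) ->
  let K s := int D1 (fun r => k r s) in
  (forall kap, is_int D1 (fun r => int D2 (fun s => k r s * phi kap s)%C)
     (int D2 (fun s => K s * phi kap s)%C)) /\
  is_int line (fun kap => Cexp (Ci * kap * c) * int D2 (fun s => K s * phi kap s))%C
    (2 * PI * int D2 (fun s => K s * f s))%C /\
  is_int D2 (fun s => K s * f s)%C (int D2 (fun s => K s * f s)%C).
Proof.
intros ck cp cf bk bp bf Hinv K.
pose proof (dret_cts D2) as cr.
(* [k] is bounded for [s] in the domain only; composed with the retraction, its integral [K'] is
   continuous and bounded on the whole line. *)
set (k' := fun s r => k r (dret D2 s)).
set (K' := fun s => int D1 (k' s)).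
assert (ck' : cts (fun q : R * R => k' (fst q) (snd q))) by (unfold k'; cts_tac).
assert (bk' : forall s, dominated D1 (k' s) Mk) by (intros s r Hr; apply bk; [exact Hr | apply dret_in]).
assert (cK' : cts K') by (apply (cts_int_unif D1 k' Mk); assumption).
assert (EK : forall s, din D2 s -> K' s = K s).
{ intros s Hs; unfold K', K, k'; rewrite dret_id by exact Hs; reflexivity. }
assert (bK' : forall s, Cmod (K' s) <= Mk * PI).
{ intros s; exact (int_bound D1 (k' s) Mk (cts_slice k' ck' s) (bk' s)). }
assert (HMk : 0 <= Mk) by exact (dominated_nonneg _ _ _ (bk' 0)).
assert (EKphi : forall kap, int D2 (fun s => K s * phi kap s)%C = int D2 (fun s => K' s * phi kap s)%C).
{ intros kap; apply int_ext_in; intros s Hs; rewrite EK by exact Hs; reflexivity. }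
assert (EKf : int D2 (fun s => K s * f s)%C = int D2 (fun s => K' s * f s)%C).
{ apply int_ext_in; intros s Hs; rewrite EK by exact Hs; reflexivity. }
assert (HMp : 0 <= Mp).
{ pose proof (bp 0 (dret D2 0) (dret_in D2 0)) as B.
  replace (1 + 0 ^ 2) with 1 in B by ring; rewrite Rdiv_1_r in B.
  apply (Rmult_le_reg_r (/ (1 + dret D2 0 ^ 2))); [apply Rinv_0_lt_compat, weight_pos |].
  rewrite Rmult_0_l; exact (Rle_trans _ _ _ (Cmod_ge_0 _) B). }
split; [| split].
- intros kap.
  pose proof (cts_slice phi cp kap) as cpk.
  assert (E : int D2 (fun s => K s * phi kap s)%C
    = int D2 (fun s => int D1 (fun r => k r s * phi kap s)%C)).
  { apply int_ext_in; intros s Hs; rewrite <- (EK s Hs), Cmult_comm.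
    unfold K', k'; rewrite <- (int_Cmult D1 _ _ Mk (cts_slice k' ck' s) (bk' s)).
    apply int_ext; intros r _; unfold k'; rewrite (dret_id D2 s Hs); ring. }
  rewrite E; apply (Fubini D1 D2 (fun r s => k r s * phi kap s)%C (Mk * Mp)).
  + apply cts_mult; [exact ck |]; apply (cts_comp1 (phi kap)); [exact cpk | cts_tac].
  + intros r s Hr Hs; rewrite Cmod_mult.
    replace (Mk * Mp / (1 + r ^ 2) / (1 + s ^ 2)) with (Mk / (1 + r ^ 2) * (Mp / (1 + s ^ 2)))
      by (unfold Rdiv; ring).
    apply Rmult_le_compat; try apply Cmod_ge_0; [now apply bk |].
    eapply Rle_trans; [now apply bp |].
    apply Rmult_le_compat_r; [left; apply Rinv_0_lt_compat, weight_pos | now apply div_weight_le].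
- rewrite EKf.
  apply (is_int_ext line (fun kap => int D2 (fun s => Cexp (Ci * kap * c) * (K' s * phi kap s)))%C).
  { intros kap _; rewrite EKphi.
    pose proof (cts_slice phi cp kap) as cpk.
    apply (int_Cmult D2 _ _ (Mk * PI * Mp)); [cts_tac |].
    apply dominated_mult; [intros; apply bK' |].
    intros s Hs; eapply Rle_trans; [now apply bp |].
    apply Rmult_le_compat_r; [left; apply Rinv_0_lt_compat, weight_pos | now apply div_weight_le]. }
  assert (E : (2 * PI * int D2 (fun s => K' s * f s))%C
    = int D2 (fun s => int line (fun kap => Cexp (Ci * kap * c) * (K' s * phi kap s)))%C).
  { rewrite <- (int_Cmult D2 (fun s => K' s * f s)%C (2 * PI)%C (Mk * PI * Mf)).
    - apply int_ext_in; intros s Hs.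
      transitivity (K' s * (2 * PI * f s))%C; [ring |]; rewrite <- (Hinv s Hs).
      rewrite <- (int_Cmult line (fun kap => Cexp (Ci * kap * c) * phi kap s)%C (K' s)
        (1 * (Mp / (1 + s ^ 2)))).
      + apply int_ext; intros kap _; ring.
      + pose proof (cts_slice (fun s kap => phi kap s) (cts_swap phi cp) s); cts_tac.
      + apply dominated_mult.
        * intros kap _; rewrite Cmod_Cexp_imag by (simpl; ring); lra.
        * intros kap _; eapply Rle_trans; [now apply bp | apply Req_le; unfold Rdiv; ring].
    - cts_tac.
    - apply dominated_mult; [intros; apply bK' | exact bf]. }
  rewrite E.
  apply (Fubini line D2 (fun kap s => Cexp (Ci * kap * c) * (K' s * phi kap s))%C (Mk * PI * Mp)).
  + apply cts_mult; [cts_tac |]; apply cts_mult; [| exact cp].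
    apply (cts_comp1 K'); [exact cK' | cts_tac].
  + intros kap s _ Hs; rewrite !Cmod_mult, Cmod_Cexp_imag, Rmult_1_l by (simpl; ring).
    replace (Mk * PI * Mp / (1 + kap ^ 2) / (1 + s ^ 2))
      with (Mk * PI * (Mp / (1 + kap ^ 2) / (1 + s ^ 2))) by (unfold Rdiv; ring).
    apply Rmult_le_compat; try apply Cmod_ge_0; [apply bK' | now apply bp].
- apply (is_int_ext D2 (fun s => K' s * f s)%C).
  { intros s Hs; rewrite EK by (apply dint_in, Hs); reflexivity. }
  rewrite EKf; apply (int_correct D2 _ (Mk * PI * Mf)); [cts_tac |].
  apply dominated_mult; [intros; apply bK' | exact bf].
Qed.

(** * Extension of the solution from the closed domain *)

(* Continuous on the whole space when [f] is continuous on the closed domain. *)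
Definition extend (T : R) (f : R -> R -> R -> C) (x y t : R) : C :=
  f x (Rabs y) (clamp 0 T t).

Lemma extend_in (T : R) (f : R -> R -> R -> C) (x y t : R) :
  closed_dom T x y t -> extend T f x y t = f x y t.
Proof.
intros [Hy Ht]; unfold extend; rewrite Rabs_pos_eq, clamp_id by assumption; reflexivity.
Qed.

Lemma closed_dom_clamp (T x y t : R) : 0 <= T -> closed_dom T x (Rabs y) (clamp 0 T t).
Proof. intros HT; split; [apply Rabs_pos | now apply clamp_in]. Qed.

Lemma cts_extend (T : R) (f : R -> R -> R -> C) : 0 <= T ->
  continuous_on_closed_dom T f -> cts3 (extend T f).
Proof.
intros HT Hf [[x y] t]; unfold extend; simpl.
set (phi := fun q : R * R * R => ((fst (fst q), Rabs (snd (fst q))), clamp 0 T (snd q))).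
assert (cphi : continuous phi (x, y, t)).
{ assert (C1 : cts (fun q : R * R * R => (fst (fst q), Rabs (snd (fst q))) : C)) by cts_tac.
  assert (C2 : ctsR (fun q : R * R * R => clamp 0 T (snd q))) by (apply ctsR_clamp; cts_tac).
  apply (continuous_comp_2 (fun q : R * R * R => (fst (fst q), Rabs (snd (fst q))) : C)
    (fun q : R * R * R => clamp 0 T (snd q)) (fun a b => (a, b))); [apply C1 | apply C2 |].
  apply (continuous_ext (fun q : C * R => q)); [now intros [a b] | apply continuous_id]. }
pose proof (Hf _ _ _ (closed_dom_clamp T x y t HT)) as L.
intros P HP; specialize (L P HP); unfold filtermap, within in L.
refine (filter_imp (F := locally ((x, y, t) : R * R * R)) _ _ _ (cphi _ L)).
intros [[x' y'] t'] H; apply H, closed_dom_clamp, HT.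
Qed.

(** The fourth power is a product of two squares, one above [1 + x^2] and the other above [1 + y^2].
    This product of weights is what [Fubini] requires. *)
Lemma extend_bound (T M : R) (f : R -> R -> R -> C) : 0 <= T ->
  (forall x y t, closed_dom T x y t -> Cmod (f x y t) <= M * / (1 + Rabs x + Rabs y) ^ 4) ->
  0 <= M /\ forall x y t, Cmod (extend T f x y t) <= M / (1 + x ^ 2) / (1 + y ^ 2).
Proof.
intros HT H.
assert (HM : 0 <= M).
{ specialize (H 0 0 0 ltac:(split; lra)); rewrite Rabs_R0 in H.
  replace (1 + 0 + 0) with 1 in H by ring; rewrite pow1, Rinv_1, Rmult_1_r in H.
  exact (Rle_trans _ _ _ (Cmod_ge_0 _) H). }
split; [exact HM |]; intros x y t; unfold extend.
eapply Rle_trans; [apply H, closed_dom_clamp, HT |].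
rewrite Rabs_Rabsolu; unfold Rdiv; rewrite Rmult_assoc, <- Rinv_mult.
apply Rmult_le_compat_l; [exact HM |].
pose proof (weight_pos x); pose proof (weight_pos y).
apply Rinv_le_contravar; [now apply Rmult_lt_0_compat |].
rewrite <- (pow2_abs x), <- (pow2_abs y).
pose proof (Rabs_pos x); pose proof (Rabs_pos y).
replace ((1 + Rabs x + Rabs y) ^ 4) with ((1 + Rabs x + Rabs y) ^ 2 * (1 + Rabs x + Rabs y) ^ 2) by ring.
apply Rmult_le_compat; nra.
Qed.

Lemma extend_dx (T x y t : R) (f f' : R -> R -> R -> C) : interior_dom T x y t ->
  is_derive_C (fun s => f s y t) x (f' x y t) ->
  is_derive_C (fun s => extend T f s y t) x (extend T f' x y t).
Proof.
intros [Hy Ht] H; rewrite extend_in by (split; lra).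
apply (dC_ext (fun s => f s y t)); [| exact H].
intros s; symmetry; apply extend_in; split; lra.
Qed.

Lemma dC_ext_loc (f g : R -> C) (x : R) (l : C) :
  locally x (fun t => f t = g t) -> is_derive_C f x l -> is_derive_C g x l.
Proof. apply (is_derive_ext_loc (V := C_R_NormedModule)). Qed.

Lemma locally_gt (a x : R) : a < x -> locally x (fun z => a < z).
Proof.
intros H; assert (Hd : 0 < x - a) by lra; exists (mkposreal _ Hd); intros z Hz.
unfold ball in Hz; simpl in Hz; unfold AbsRing_ball, abs, minus, plus, opp in Hz; simpl in Hz.
apply Rabs_def2 in Hz; lra.
Qed.

Lemma locally_lt (b x : R) : x < b -> locally x (fun z => z < b).
Proof.
intros H; assert (Hd : 0 < b - x) by lra; exists (mkposreal _ Hd); intros z Hz.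
unfold ball in Hz; simpl in Hz; unfold AbsRing_ball, abs, minus, plus, opp in Hz; simpl in Hz.
apply Rabs_def2 in Hz; lra.
Qed.

Lemma extend_dy (T x y t : R) (f f' : R -> R -> R -> C) : interior_dom T x y t ->
  is_derive_C (fun s => f x s t) y (f' x y t) ->
  is_derive_C (fun s => extend T f x s t) y (extend T f' x y t).
Proof.
intros [Hy Ht] H; rewrite extend_in by (split; lra).
apply (dC_ext_loc (fun s => f x s t)); [| exact H].
refine (filter_imp _ _ _ (locally_gt 0 y Hy)).
intros s Hs; symmetry; apply extend_in; split; lra.
Qed.

Lemma extend_dt (T x y t : R) (f f' : R -> R -> R -> C) : interior_dom T x y t ->
  is_derive_C (fun s => f x y s) t (f' x y t) ->
  is_derive_C (fun s => extend T f x y s) t (extend T f' x y t).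
Proof.
intros [Hy Ht] H; rewrite extend_in by (split; lra).
apply (dC_ext_loc (fun s => f x y s)); [| exact H].
refine (filter_imp _ _ _ (filter_and _ _ (locally_gt 0 t (proj1 Ht)) (locally_lt T t (proj2 Ht)))).
intros s Hs; symmetry; apply extend_in; split; lra.
Qed.

(** Differentiation along the lines [x - y = c], on which the spatial operator becomes a second
    derivative. Continuity of the partial derivative [fx] makes [f] differentiable in two
    variables. *)
Lemma chain_diag_R (f fx fy : R -> R -> R) (c s : R) :
  ctsR (fun q : R * R => fx (fst q) (snd q)) -> 0 < s ->
  (forall x y, 0 < y -> is_derive (fun z => f z y) x (fx x y)) ->
  (forall x y, 0 < y -> is_derive (fun z => f x z) y (fy x y)) ->
  is_derive (fun s => f (c + s) s) s (fx (c + s) s + fy (c + s) s).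
Proof.
intros cfx Hs Hx Hy.
assert (L : locally ((c + s, s) : R * R) (fun u => 0 < snd u)).
{ destruct (locally_gt 0 s Hs) as [d Hd]; exists d; intros [a b] [_ H]; apply Hd, H. }
assert (FD : filterdiff (fun u : R * R => f (fst u) (snd u)) (locally ((c + s, s) : R * R))
  (fun u : R * R => plus (scal (fst u) (fx (c + s) s)) (scal (snd u) (fy (c + s) s)))).
{ apply (is_derive_filterdiff f (c + s) s fx (fy (c + s) s)).
  - refine (filter_imp _ _ _ L); intros u Hu; now apply Hx.
  - now apply Hy.
  - apply cfx. }
unfold is_derive.
apply (filterdiff_ext_lin _ (fun y : R => plus (scal y (fx (c + s) s)) (scal y (fy (c + s) s)))).
- apply (filterdiff_comp'_2 (fun s : R => c + s) (fun s : R => s) f s (fun y => y) (fun y => y)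
    (fun a b => plus (scal a (fx (c + s) s)) (scal b (fy (c + s) s)))).
  + apply (filterdiff_ext_lin _ (fun y : R => scal y 1)).
    * assert (D : is_derive (fun s : R => c + s) s 1) by (auto_derive; [easy | ring]); exact D.
    * intros y; unfold scal; simpl; unfold mult; simpl; ring.
  + apply filterdiff_id.
  + exact FD.
- intros y; unfold plus, scal; simpl; unfold mult; simpl; ring.
Qed.

Lemma chain_diag (f fx fy : R -> R -> C) (c s : R) :
  cts (fun q : R * R => fx (fst q) (snd q)) -> 0 < s ->
  (forall x y, 0 < y -> is_derive_C (fun z => f z y) x (fx x y)) ->
  (forall x y, 0 < y -> is_derive_C (fun z => f x z) y (fy x y)) ->
  is_derive_C (fun s => f (c + s) s) s (fx (c + s)%R s + fy (c + s)%R s)%C.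
Proof.
intros cfx Hs Hx Hy.
apply (dC_ext (fun s => (fst (f (c + s) s), snd (f (c + s) s)))).
{ intros z; now destruct (f (c + z) z). }
apply dC_pair.
- apply (chain_diag_R (fun x y => fst (f x y)) (fun x y => fst (fx x y)) (fun x y => fst (fy x y)) c s).
  + apply (ctsR_fst _ cfx).
  + exact Hs.
  + intros x y H; exact (dC_fst _ _ _ (Hx x y H)).
  + intros x y H; exact (dC_fst _ _ _ (Hy x y H)).
- apply (chain_diag_R (fun x y => snd (f x y)) (fun x y => snd (fx x y)) (fun x y => snd (fy x y)) c s).
  + apply (ctsR_snd _ cfx).
  + exact Hs.
  + intros x y H; exact (dC_snd _ _ _ (Hx x y H)).
  + intros x y H; exact (dC_snd _ _ _ (Hy x y H)).
Qed.

(** [fourier_second_derivative] applies for [s > 0] and interior times; the resulting bound is a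
    closed condition and passes to the boundary, hence to all values of the retracted function. *)
Lemma xfourier_bound (T M : R) (f f1 f2 : R -> R -> R -> C) : 0 < T -> 0 <= M ->
  cts3 (extend T f) -> cts3 (extend T f1) -> cts3 (extend T f2) ->
  (forall x y t, Cmod (extend T f x y t) <= M / (1 + x ^ 2) / (1 + y ^ 2)) ->
  (forall x y t, Cmod (extend T f1 x y t) <= M / (1 + x ^ 2) / (1 + y ^ 2)) ->
  (forall x y t, Cmod (extend T f2 x y t) <= M / (1 + x ^ 2) / (1 + y ^ 2)) ->
  (forall x y t, interior_dom T x y t -> is_derive_C (fun s => f s y t) x (f1 x y t)) ->
  (forall x y t, interior_dom T x y t -> is_derive_C (fun s => f1 s y t) x (f2 x y t)) ->
  forall k s tau, Cmod (xfourier (extend T f) k s tau) <= 2 * M * PI / (1 + k ^ 2) / (1 + s ^ 2).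
Proof.
intros HT HM c0 c1 c2 b0 b1 b2 d0 d1 k s tau.
assert (slice : forall g y t, cts3 g -> cts (fun x => g x y t)).
{ intros g y t cg; unfold cts3 in cg; cts_tac. }
assert (cw : cts3 (xfourier (extend T f))).
{ apply (cts_xfourier _ M c0); intros x y t; eapply Rle_trans; [apply b0 |].
  apply div_weight_le, Rmult_le_pos; [exact HM | left; apply Rinv_0_lt_compat, weight_pos]. }
assert (Hint : forall s tau, 0 < s -> 0 < tau < T ->
  (1 + s ^ 2) * ((1 + k ^ 2) * Cmod (xfourier (extend T f) k s tau)) - 2 * M * PI <= 0).
{ clear s tau; intros s tau Hs Ht.
  assert (B : forall g, (forall x y t, Cmod (extend T g x y t) <= M / (1 + x ^ 2) / (1 + y ^ 2)) ->
     dominated line (fun x => extend T g x s tau) (M / (1 + s ^ 2))).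
  { intros g bg x _; eapply Rle_trans; [apply bg | apply Req_le; unfold Rdiv; ring]. }
  pose proof (fourier_second_derivative (fun x => extend T f x s tau)
    (fun x => extend T f1 x s tau) (fun x => extend T f2 x s tau) (M / (1 + s ^ 2)) k
    (slice _ _ _ c0) (slice _ _ _ c1) (slice _ _ _ c2)
    (fun x => extend_dx T x s tau f f1 (conj Hs Ht) (d0 x s tau (conj Hs Ht)))
    (fun x => extend_dx T x s tau f1 f2 (conj Hs Ht) (d1 x s tau (conj Hs Ht)))
    (B f b0) (B f1 b1) (B f2 b2)) as E.
  pose proof (weight_pos s) as Ws.
  apply (Rmult_le_compat_l (1 + s ^ 2)) in E; [| lra].
  replace ((1 + s ^ 2) * (2 * (M / (1 + s ^ 2)) * PI)) with (2 * M * PI) in E by (field; lra).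
  unfold xfourier; lra. }
set (t0 := clamp 0 T tau).
assert (Ht0 : 0 <= t0 <= T) by (apply clamp_in; lra).
assert (E0 : xfourier (extend T f) k s tau = xfourier (extend T f) k (Rabs s) t0).
{ unfold xfourier, fourier; apply int_ext; intros x _; unfold extend.
  rewrite Rabs_Rabsolu; unfold t0; rewrite (clamp_id 0 T (clamp 0 T tau)) by exact Ht0; reflexivity. }
(* For [0 < d < 1] the point has moved off the boundary: upwards in [s], and towards [T / 2] in
   time. *)
set (h := fun d => (1 + (Rabs s + d) ^ 2) *
  ((1 + k ^ 2) * Cmod (xfourier (extend T f) k (Rabs s + d) (t0 + d * (T / 2 - t0)))) - 2 * M * PI).
assert (H0 : h 0 <= 0).
{ apply (ctsR_closure h 1).
  - unfold h; unfold cts3 in cw; cts_tac.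
  - lra.
  - intros d Hd; apply Hint; [pose proof (Rabs_pos s); lra | nra]. }
unfold h in H0; rewrite Rplus_0_r, pow2_abs, Rmult_0_l, Rplus_0_r, <- E0 in H0.
pose proof (weight_pos s) as Ws; pose proof (weight_pos k) as Wk.
apply (Rmult_le_reg_l ((1 + s ^ 2) * (1 + k ^ 2))); [now apply Rmult_lt_0_compat |].
replace ((1 + s ^ 2) * (1 + k ^ 2) * (2 * M * PI / (1 + k ^ 2) / (1 + s ^ 2))) with (2 * M * PI)
  by (field; lra).
lra.
Qed.

(** * The three terms of the formula *)

Lemma cts3_slice1 (w : R -> R -> R -> C) (b c : R) : cts3 w -> cts (fun x => w x b c).
Proof.
intros cw; exact (cts_comp3 w (fun x => x) (fun _ => b) (fun _ => c) cw
  ctsR_id (ctsR_const b) (ctsR_const c)).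
Qed.

Lemma cts3_slice2 (w : R -> R -> R -> C) (a c : R) : cts3 w -> cts (fun x => w a x c).
Proof.
intros cw; exact (cts_comp3 w (fun _ => a) (fun x => x) (fun _ => c) cw
  (ctsR_const a) ctsR_id (ctsR_const c)).
Qed.

Lemma cts3_slice3 (w : R -> R -> R -> C) (a b : R) : cts3 w -> cts (fun x => w a b x).
Proof.
intros cw; exact (cts_comp3 w (fun _ => a) (fun _ => b) (fun x => x) cw
  (ctsR_const a) (ctsR_const b) ctsR_id).
Qed.

Definition rapid (U : R -> R -> R -> C) (M : R) : Prop :=
  forall x y t, Cmod (U x y t) <= M / (1 + x ^ 2) / (1 + y ^ 2).

Lemma rapid_le (U : R -> R -> R -> C) (M x y t : R) : 0 <= M -> rapid U M ->
  Cmod (U x y t) <= M / (1 + x ^ 2) /\ Cmod (U x y t) <= M / (1 + y ^ 2).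
Proof.
intros HM H; specialize (H x y t); split; (eapply Rle_trans; [exact H |]).
- apply div_weight_le, Rmult_le_pos; [exact HM | left; apply Rinv_0_lt_compat, weight_pos].
- apply Rmult_le_compat_r; [left; apply Rinv_0_lt_compat, weight_pos | now apply div_weight_le].
Qed.

Lemma Cmod_Cexp_le (z : C) : Re z <= 0 -> Cmod (Cexp z) <= 1.
Proof. intros H; rewrite Cmod_Cexp, <- exp_0; now apply exp_le. Qed.

(** The definition integrates in [y] first; Fubini brings the partial transform in [x] inside. The
    condition [Im lam <= 0] keeps the exponential bounded for [y >= 0]. *)
Lemma half_space_hat_formula (U : R -> R -> R -> C) (u0 : R -> R -> C) (M kap : R) (lam : C) :
  0 <= M -> cts3 U -> rapid U M -> (forall x y, 0 < y -> U x y 0 = u0 x y) -> Im lam <= 0 ->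
  ex_half_space_hat u0 kap lam /\
  half_space_hat u0 kap lam = int half (fun s => Cexp (- (Ci * s * lam)) * xfourier U kap s 0%R)%C.
Proof.
intros HM cU bU HU Hlam.
assert (cU' := cU); unfold cts3 in cU'.
set (G := fun x y : R => (Cexp (- (Ci * x * kap) - Ci * y * lam) * U x y 0%R)%C).
assert (cG : cts (fun q : R * R => G (fst q) (snd q))) by (unfold G; cts_tac).
assert (bG : forall x y, True -> 0 <= y -> Cmod (G x y) <= M / (1 + x ^ 2) / (1 + y ^ 2)).
{ intros x y _ Hy; unfold G; rewrite Cmod_mult, <- (Rmult_1_l (M / _ / _)).
  apply Rmult_le_compat; try apply Cmod_ge_0; [| apply bU].
  apply Cmod_Cexp_le; unfold Im in Hlam; simpl; nra. }
assert (EG : forall x y, 0 < y -> G x y = hat_integrand u0 kap lam x y).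
{ intros x y Hy; unfold G, hat_integrand; now rewrite HU. }
assert (I1 : forall x, is_int half (fun y => hat_integrand u0 kap lam x y) (int half (G x))).
{ intros x; apply (is_int_ext half (G x)); [intros y Hy; now apply EG |].
  apply (int_correct half (G x) (M / (1 + x ^ 2)) (cts_slice G cG x)).
  intros y Hy; now apply bG. }
assert (I2 : is_int line (fun x => int_pos (fun y => hat_integrand u0 kap lam x y))
   (int half (fun s => Cexp (- (Ci * s * lam)) * xfourier U kap s 0%R)%C)).
{ assert (E : int half (fun s => Cexp (- (Ci * s * lam)) * xfourier U kap s 0%R)%C
    = int half (fun y => int line (fun x => G x y))).
  { apply int_ext; intros s Hs; unfold xfourier, fourier.
    rewrite <- (int_Cmult line (fun x => Cexp (- (Ci * x * kap)) * U x s 0%R)%C _ (1 * M)).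
    - apply int_ext; intros x _; unfold G.
      replace (- (Ci * x * kap) - Ci * s * lam)%C
        with (- (Ci * s * lam) + - (Ci * x * kap))%C by ring.
      rewrite Cexp_plus; ring.
    - cts_tac.
    - apply dominated_mult; [intros x _; rewrite Cmod_Cexp_imag by (simpl; ring); lra |].
      intros x _; now apply rapid_le. }
  rewrite E; apply (is_int_ext line (fun x => int half (G x))).
  - intros x _; symmetry; exact (is_int_unique half _ _ (I1 x)).
  - apply (Fubini line half G M cG bG). }
split; [split |].
- intros x; exact (is_int_ex_pos _ _ (I1 x)).
- exact (is_int_ex_R _ _ I2).
- exact (is_int_unique line _ _ I2).
Qed.

Lemma t_tilde_formula (U : R -> R -> R -> C) (g0 : R -> R -> C) (T M t kap : R) (eta : C)
    (Ht : 0 <= t) :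
  0 <= M -> cts3 U -> rapid U M -> (forall x tau, 0 < tau < T -> U x 0 tau = g0 x tau) -> t < T ->
  ex_t_tilde g0 kap eta t /\
  t_tilde g0 kap eta t
    = int (seg 0 t Ht) (fun tau => Cexp (eta * tau) * xfourier U kap 0%R tau)%C.
Proof.
intros HM cU bU HU HtT.
assert (cU' := cU); unfold cts3 in cU'.
assert (cw : cts3 (xfourier U)) by (apply (cts_xfourier U M cU); intros; now apply rapid_le).
assert (I1 : forall tau, 0 < tau < T ->
  is_int line (fun x => x_integrand g0 kap tau x) (xfourier U kap 0 tau)).
{ intros tau Htau; apply (is_int_ext line (fun x => Cexp (- (Ci * x * kap)) * U x 0%R tau)%C).
  - intros x _; unfold x_integrand; now rewrite HU.
  - apply (int_correct line _ (1 * M)); [apply cts_mult; [cts_tac | now apply cts3_slice1] |].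
    apply dominated_mult; [intros x _; rewrite Cmod_Cexp_imag by (simpl; ring); lra |].
    intros x _; now apply rapid_le. }
set (F := fun tau : R => (Cexp (eta * tau) * xfourier U kap 0%R tau)%C).
assert (cF : cts F) by (apply cts_mult; [cts_tac | now apply cts3_slice3]).
assert (I2 : is_RIC (tilde_integrand g0 kap eta) 0 t (RIC F 0 t)).
{ apply (is_RInt_ext (V := C_R_NormedModule) F); [| now apply RIC_correct].
  intros tau Htau; rewrite Rmin_left, Rmax_right in Htau by lra.
  unfold F, tilde_integrand; f_equal; symmetry; apply (is_int_unique line), I1; lra. }
split; [split |].
- intros tau Htau; apply (is_int_ex_R _ (xfourier U kap 0 tau)), I1; lra.
- now exists (RIC F 0 t).
- rewrite int_seg by exact cF; exact (RIC_unique _ _ _ _ I2).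
Qed.

Lemma E_shift (kap x y t : R) (z : C) :
  E kap (z - kap)%C x y t = (Cexp (Ci * kap * (x - y)%R) * gker t y z)%C.
Proof.
unfold E, gker; rewrite <- Cexp_plus; f_equal; rewrite RtoC_minus; simpl; ring.
Qed.

(** The constant of [exp_weight] for the rate [y sin (PI / 4)]. *)
Definition ray2_const (y : R) : R := (1 + 3 / (y * sin (PI / 4))) ^ 3.

Lemma sin_PI4_pos : 0 < sin (PI / 4).
Proof. rewrite sin_PI4; apply sqrt2_inv_pos. Qed.

(** On the rays [z^2] is imaginary, so the bound is free of [t], unlike [ray_const], which blows up
    as [t] tends to 0. It therefore holds with [t - tau] for every real [tau]. *)
Lemma gker_ray_bound (t y a s r : R) : 0 < y -> y <= a -> s * s = 1 -> 0 <= r ->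
  (1 + r) * Cmod (gker t a (r * sdir s (PI / 4))%C) <= ray2_const y / (1 + r ^ 2).
Proof.
intros Hy Ha Hs Hr; pose proof sin_PI4_pos as Hq.
replace (r * sdir s (PI / 4))%C with ((r * (s * cos (PI / 4)), r * sin (PI / 4)) : C)
  by (unfold sdir; apply injective_projections; simpl; ring).
rewrite Cmod_gker.
replace (cos (PI / 4)) with (sin (PI / 4)) by now rewrite cos_PI4, sin_PI4.
eapply Rle_trans; [| apply (exp_weight (y * sin (PI / 4)) r); [now apply Rmult_lt_0_compat | exact Hr]].
apply Rmult_le_compat_l; [lra |]; apply exp_le.
replace ((r * (s * sin (PI / 4))) ^ 2) with ((r * sin (PI / 4)) ^ 2 * (s * s)) by ring.
rewrite Hs; assert (0 <= r * sin (PI / 4)) by (apply Rmult_le_pos; lra); nra.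
Qed.

Lemma gker_ray_bounds (t y a s r : R) : 0 < y -> y <= a -> s * s = 1 -> 0 <= r ->
  Cmod (sdir s (PI / 4) * gker t a (r * sdir s (PI / 4)))%C <= ray2_const y / (1 + r ^ 2) /\
  Cmod (sdir s (PI / 4) * (r * sdir s (PI / 4) * gker t a (r * sdir s (PI / 4))))%C
    <= ray2_const y / (1 + r ^ 2).
Proof.
intros Hy Ha Hs Hr; pose proof (gker_ray_bound t y a s r Hy Ha Hs Hr) as B.
rewrite !Cmod_mult, (Cmod_sdir _ _ Hs), Cmod_R, (Rabs_pos_eq r), !Rmult_1_l, Rmult_1_r by exact Hr.
pose proof (Cmod_ge_0 (gker t a (r * sdir s (PI / 4)))); split; nra.
Qed.

Lemma xfourier_inversion (U : R -> R -> R -> C) (M M' c s tau : R) :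
  0 <= M -> 0 <= M' -> cts3 U -> rapid U M -> rapid (xfourier U) M' ->
  int line (fun k => Cexp (Ci * k * c) * xfourier U k s tau)%C = (2 * PI * U c s tau)%C.
Proof.
intros HM HM' cU bU bw.
assert (cw : cts3 (xfourier U)) by (apply (cts_xfourier U M cU); intros; now apply rapid_le).
apply (fourier_inversion (fun x => U x s tau) c M M').
- now apply cts3_slice1.
- intros x _; now apply rapid_le.
- exact (cts3_slice1 (xfourier U) s tau cw).
- intros k _; exact (proj1 (rapid_le (xfourier U) M' k s tau HM' bw)).
Qed.

(** The transform in [c] of the initial data [U (c + s, s, 0)]; the phase comes from the translation
    by [s]. *)
Definition phi0 (U : R -> R -> R -> C) (k s : R) : C := (Cexp (Ci * k * s) * xfourier U k s 0%R)%C.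

Lemma hat_mult (U : R -> R -> R -> C) (u0 : R -> R -> C) (M M' kap : R) (q z : C) :
  0 <= M -> 0 <= M' -> cts3 U -> rapid U M -> rapid (xfourier U) M' ->
  (forall x y, 0 < y -> U x y 0 = u0 x y) -> Im z <= 0 ->
  (q * half_space_hat u0 kap (z - kap))%C
    = int half (fun s => q * Cexp (- (Ci * s * z)) * phi0 U kap s)%C.
Proof.
intros HM HM' cU bU bw HU Hz.
assert (cw : cts3 (xfourier U)) by (apply (cts_xfourier U M cU); intros; now apply rapid_le).
assert (Hz' : Im (z - kap)%C <= 0) by (unfold Im in *; simpl; lra).
destruct (half_space_hat_formula U u0 M kap (z - kap)%C HM cU bU HU Hz') as [_ E]; rewrite E.
rewrite <- (int_Cmult half _ q (1 * M')).
- apply int_ext; intros s _; unfold phi0.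
  replace (- (Ci * s * (z - kap)))%C with (- (Ci * s * z) + Ci * kap * s)%C by ring.
  rewrite Cexp_plus; ring.
- apply cts_mult; [cts_tac | now apply cts3_slice2].
- apply dominated_mult.
  + intros s Hs; apply Cmod_Cexp_le; unfold Im in Hz'; simpl in Hs, Hz' |- *; nra.
  + intros s _; exact (proj2 (rapid_le (xfourier U) M' kap s 0 HM' bw)).
Qed.

Lemma int_seg_Cmult (a b : R) (Hab : a <= b) (f : R -> C) (k : C) : cts f ->
  int (seg a b Hab) (fun x => k * f x)%C = (k * int (seg a b Hab) f)%C.
Proof.
intros Hf; rewrite !int_seg by (exact Hf || (apply cts_mult; [apply cts_const | exact Hf])).
apply RIC_unique, is_RIC_Cmult, RIC_correct, Hf.
Qed.

Lemma gker_exp (t a s : R) (z : C) :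
  (gker t a z * Cexp (Ci * s * z))%C = gker t (a + s) z.
Proof. unfold gker; rewrite <- Cexp_plus; f_equal; rewrite RtoC_plus; ring. Qed.

Lemma gker_exp_time (t tau a : R) (z : C) :
  (gker t a z * Cexp (z ^ 2 * tau))%C = gker (t - tau) a z.
Proof. unfold gker; rewrite <- Cexp_plus; f_equal; rewrite RtoC_minus; ring. Qed.

Lemma line_term (U : R -> R -> R -> C) (u0 : R -> R -> C) (M M' x y t kap : R) (L : C) :
  0 <= M -> 0 <= M' -> cts3 U -> rapid U M -> rapid (xfourier U) M' ->
  (forall x y, 0 < y -> U x y 0 = u0 x y) ->
  is_int line (fun z => int half (fun s => gker t (y - s) (RtoC z) * phi0 U kap s)%C) L ->
  is_int line (fun lam : R => E kap lam x y t * half_space_hat u0 kap lam)%C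
    (Cexp (Ci * kap * (x - y)%R) * L)%C.
Proof.
intros HM HM' cU bU bw HU H.
apply (is_int_Cmult _ _ (Cexp (Ci * kap * (x - y)%R))) in H.
(* For real [lambda] the substitution [z = lambda + kap] is a translation of the line. *)
apply (int_line_shift _ kap) in H.
revert H; apply is_int_ext; intros lam _.
replace (RtoC lam) with (RtoC (lam + kap) - RtoC kap)%C by (rewrite RtoC_plus; ring).
rewrite E_shift.
transitivity (Cexp (Ci * kap * (x - y)%R)
  * (gker t y (RtoC (lam + kap)) * half_space_hat u0 kap (RtoC (lam + kap) - kap)))%C;
  [f_equal | ring].
rewrite (hat_mult U u0 M M' kap _ (RtoC (lam + kap)) HM HM' cU bU bw HU) by (simpl; lra).
apply int_ext; intros s _; f_equal.
replace (- (Ci * s * RtoC (lam + kap)))%C with (Ci * RtoC (- s) * RtoC (lam + kap))%C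
  by (rewrite RtoC_opp; ring).
rewrite gker_exp; reflexivity.
Qed.

(** In terms of [z], the map from [lambda] to [- (lambda + 2 kappa)] is [z -> - z]. The transform
    then contributes [exp (i s z)], which moves the kernel to [y + s], the distance from the image
    charge. *)
Lemma ray_term (U : R -> R -> R -> C) (u0 : R -> R -> C) (M M' x y t kap theta s0 : R) (L : C) :
  0 <= M -> 0 <= M' -> cts3 U -> rapid U M -> rapid (xfourier U) M' ->
  (forall x y, 0 < y -> U x y 0 = u0 x y) -> sdir s0 (PI / 4) = dir theta ->
  is_int half (fun r => int half (fun s =>
    sdir s0 (PI / 4) * gker t (y + s) (r * sdir s0 (PI / 4)) * phi0 U kap s)%C) L ->
  is_int half (ray_integrand kap theta
      (fun lam => E kap lam x y t * half_space_hat u0 kap (- (lam + 2 * kap)))%C)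
    (Cexp (Ci * kap * (x - y)%R) * L)%C.
Proof.
intros HM HM' cU bU bw HU Hd H.
apply (is_int_Cmult _ _ (Cexp (Ci * kap * (x - y)%R))) in H.
revert H; apply is_int_ext; intros r Hr.
unfold ray_integrand, ray; rewrite <- Hd.
set (d := sdir s0 (PI / 4)).
replace (- kap + r * d)%C with (r * d - kap)%C by ring.
rewrite E_shift.
replace (- (r * d - kap + 2 * kap))%C with (- (r * d) - kap)%C by ring.
transitivity (Cexp (Ci * kap * (x - y)%R)
  * (d * gker t y (r * d) * half_space_hat u0 kap (- (r * d) - kap)))%C; [f_equal | ring].
rewrite (hat_mult U u0 M M' kap _ (- (r * d))%C HM HM' cU bU bw HU).
- apply int_ext; intros s _; f_equal.
  replace (- (Ci * s * - (r * d)))%C with (Ci * s * (r * d))%C by ring.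
  rewrite <- Cmult_assoc, gker_exp; reflexivity.
- pose proof sin_PI4_pos; unfold d, sdir, Im; simpl in Hr |- *; nra.
Qed.

(** The argument [(kappa + lambda)^2 = z^2] of the time transform turns the kernel at time [t] into
    the kernel at time [t - tau]. *)
Lemma ray_term_t (U : R -> R -> R -> C) (g0 : R -> R -> C) (T M M' x y t kap theta s0 : R) (L : C)
    (Ht : 0 <= t) :
  0 <= M -> 0 <= M' -> cts3 U -> rapid U M -> rapid (xfourier U) M' ->
  (forall x tau, 0 < tau < T -> U x 0 tau = g0 x tau) -> t < T -> sdir s0 (PI / 4) = dir theta ->
  is_int half (fun r => int (seg 0 t Ht) (fun tau =>
    sdir s0 (PI / 4) * (r * sdir s0 (PI / 4) * gker (t - tau) y (r * sdir s0 (PI / 4)))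
    * xfourier U kap 0%R tau)%C) L ->
  is_int half (ray_integrand kap theta
      (fun lam => (lam + kap) * E kap lam x y t * t_tilde g0 kap ((kap + lam) ^ 2) t)%C)
    (Cexp (Ci * kap * (x - y)%R) * L)%C.
Proof.
intros HM HM' cU bU bw HU HtT Hd H.
assert (cw : cts3 (xfourier U)) by (apply (cts_xfourier U M cU); intros; now apply rapid_le).
apply (is_int_Cmult _ _ (Cexp (Ci * kap * (x - y)%R))) in H.
revert H; apply is_int_ext; intros r Hr.
unfold ray_integrand, ray; rewrite <- Hd.
set (d := sdir s0 (PI / 4)).
replace (- kap + r * d)%C with (r * d - kap)%C by ring.
rewrite E_shift.
replace (kap + (r * d - kap))%C with (r * d)%C by ring.
replace (r * d - kap + kap)%C with (r * d)%C by ring.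
destruct (t_tilde_formula U g0 T M t kap ((r * d) ^ 2)%C Ht HM cU bU HU HtT) as [_ Et].
rewrite Et.
assert (cF : cts (fun tau : R => Cexp ((r * d) ^ 2 * tau) * xfourier U kap 0%R tau)%C)
  by (apply cts_mult; [cts_tac | now apply cts3_slice3]).
transitivity (Cexp (Ci * kap * (x - y)%R) * (d * (r * d * gker t y (r * d))
  * int (seg 0 t Ht) (fun tau => Cexp ((r * d) ^ 2 * tau) * xfourier U kap 0%R tau)))%C;
  [f_equal | ring].
rewrite <- (int_seg_Cmult 0 t Ht _ _ cF).
apply int_ext; intros tau _; rewrite <- gker_exp_time; ring.
Qed.

Lemma phi0_inversion (U : R -> R -> R -> C) (M M' c s : R) :
  0 <= M -> 0 <= M' -> cts3 U -> rapid U M -> rapid (xfourier U) M' ->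
  int line (fun k => Cexp (Ci * k * c) * phi0 U k s)%C = (2 * PI * U (c + s)%R s 0%R)%C.
Proof.
intros HM HM' cU bU bw.
rewrite <- (xfourier_inversion U M M' (c + s) s 0 HM HM' cU bU bw).
apply int_ext; intros k _; unfold phi0.
replace (Ci * k * (c + s)%R)%C with (Ci * k * c + Ci * k * s)%C by (rewrite RtoC_plus; ring).
rewrite Cexp_plus; ring.
Qed.

Lemma Cmod_phi0 (U : R -> R -> R -> C) (k s : R) : Cmod (phi0 U k s) = Cmod (xfourier U k s 0).
Proof. unfold phi0; rewrite Cmod_mult, Cmod_Cexp_imag by (simpl; ring); ring. Qed.

(** On a compact interval a constant is dominated by the weight, so [seg] fits the theory of
    dominated integrands. *)
Lemma seg_weight (t tau A : R) : 0 <= tau <= t -> 0 <= A -> A <= A * (1 + t ^ 2) / (1 + tau ^ 2).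
Proof.
intros Ht HA; pose proof (weight_pos tau).
apply (Rmult_le_reg_r (1 + tau ^ 2)); [assumption |].
replace (A * (1 + t ^ 2) / (1 + tau ^ 2) * (1 + tau ^ 2)) with (A * (1 + t ^ 2)) by (field; lra).
apply Rmult_le_compat_l; [exact HA |].
assert (tau ^ 2 <= t ^ 2) by (apply pow_incr; lra); lra.
Qed.

(** [V1] and [V2] are the first and second derivatives of [U] along the lines [x - y = c], and the
    last derivative condition is the heat equation on each line. Each term of the formula is
    evaluated as [2 PI] times an integral of data against a kernel, and [heat_half_line] assembles
    them. *)
Lemma representation (T M M' t x y : R) (U V1 V2 : R -> R -> R -> C) (u0 g0 : R -> R -> C) :
  0 <= M -> 0 <= M' -> 0 < t < T -> 0 < y ->
  cts3 U -> cts3 V1 -> cts3 V2 -> rapid U M -> rapid V1 M -> rapid (xfourier U) M' ->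
  (forall c s tau, 0 < s -> 0 < tau < T ->
     is_derive_C (fun s => U (c + s) s tau) s (V1 (c + s) s tau) /\
     is_derive_C (fun s => V1 (c + s) s tau) s (V2 (c + s) s tau) /\
     is_derive_C (fun tau => U (c + s) s tau) tau (V2 (c + s) s tau)) ->
  (forall x y, 0 < y -> U x y 0 = u0 x y) ->
  (forall x tau, 0 < tau < T -> U x 0 tau = g0 x tau) ->
  ex_int_R_R (fun (kappa : R) (lambda : C) =>
    (E kappa lambda x y t * half_space_hat u0 kappa lambda)%C) /\
  ex_int_R_contour (fun (kappa : R) (lambda : C) =>
    (E kappa lambda x y t * half_space_hat u0 kappa (- (lambda + 2 * kappa)))%C) /\
  ex_int_R_contour (fun (kappa : R) (lambda : C) =>
    ((lambda + kappa) * E kappa lambda x y t * t_tilde g0 kappa ((kappa + lambda) ^ 2) t)%C) /\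
  U x y t =
    (1 / (2 * PI) ^ 2 *
       int_R_R (fun (kappa : R) (lambda : C) =>
         E kappa lambda x y t * half_space_hat u0 kappa lambda)
     - 1 / (2 * PI) ^ 2 *
       int_R_contour (fun (kappa : R) (lambda : C) =>
         E kappa lambda x y t * half_space_hat u0 kappa (- (lambda + 2 * kappa)))
     - Ci / (2 * PI ^ 2) *
       int_R_contour (fun (kappa : R) (lambda : C) =>
         (lambda + kappa) * E kappa lambda x y t
         * t_tilde g0 kappa ((kappa + lambda) ^ 2) t))%C.
Proof.
intros HM HM' Ht Hy cU cV1 cV2 bU bV1 bw Hder HU0 HUg.
pose proof PI_RGT_0 as HPI.
assert (Ht0 : 0 <= t) by lra.
set (c := x - y).
assert (cw : cts3 (xfourier U)) by (apply (cts_xfourier U M cU); intros; now apply rapid_le).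
assert (diag : forall W, cts3 W -> cts (fun q : R * R => W (c + fst q)%R (fst q) (snd q))).
{ intros W cW; apply (cts_comp3 W (fun q : R * R => c + fst q) (fun q => fst q) (fun q => snd q) cW);
    cts_tac. }
assert (cphi : cts (fun q : R * R => phi0 U (fst q) (snd q))).
{ unfold phi0; apply cts_mult; [cts_tac |].
  apply (cts_comp3 (xfourier U) (fun q : R * R => fst q) (fun q => snd q) (fun _ => 0) cw); cts_tac. }
set (f := fun s => U (c + s) s 0).
set (g := fun tau => U c 0 tau).
assert (cf : cts f).
{ apply (cts_comp3 U (fun s => c + s) (fun s => s) (fun _ => 0) cU); cts_tac. }
assert (cg : cts g) by (now apply cts3_slice3).
assert (bf : dominated half f M) by (intros s _; now apply rapid_le).
assert (bphi : forall k s, Cmod (phi0 U k s) <= M' / (1 + k ^ 2) / (1 + s ^ 2)).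
{ intros k s; rewrite Cmod_phi0; apply bw. }
pose proof (fun s => phi0_inversion U M M' c s HM HM' cU bU bw) as inv0.
set (k1 := fun z s : R => gker t (y - s) (RtoC z)).
set (K1 := fun s => int line (fun z => k1 z s)).
assert (KF1 : (forall kap, is_int line (fun z => int half (fun s => k1 z s * phi0 U kap s)%C)
     (int half (fun s => K1 s * phi0 U kap s)%C)) /\
  is_int line (fun kap => Cexp (Ci * kap * c) * int half (fun s => K1 s * phi0 U kap s))%C
    (2 * PI * int half (fun s => K1 s * f s))%C /\
  is_int half (fun s => K1 s * f s)%C (int half (fun s => K1 s * f s)%C)).
{ apply (kernel_fubini line half k1 (phi0 U) f c (1 + / t) M' M).
  - unfold k1; apply cts_gker; cts_tac.
  - exact cphi.
  - exact cf.
  - intros r s _ _; unfold k1; rewrite Cmod_gker_real; apply gauss_weight; lra.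
  - intros k s _; apply bphi.
  - exact bf.
  - intros s _; apply inv0. }
destruct KF1 as [F1 [G1 J1]].
set (A1 := int half (fun s => K1 s * f s)%C) in *.
assert (T1 : forall kap, is_int line (fun lam : R => E kap lam x y t * half_space_hat u0 kap lam)%C
   (Cexp (Ci * kap * c) * int half (fun s => K1 s * phi0 U kap s))%C).
{ intros kap; exact (line_term U u0 M M' x y t kap _ HM HM' cU bU bw HU0 (F1 kap)). }
assert (O1 : is_int line (fun kap => int_R (fun lam : R => E kap lam x y t * half_space_hat u0 kap lam)%C)
   (2 * PI * A1)%C).
{ revert G1; apply is_int_ext; intros kap _; symmetry; exact (is_int_unique line _ _ (T1 kap)). }
(* For [s >= 0] the argument [y + s] is at least [y], so [ray2_const y] is a bound uniform in
   [s]. *)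
set (k2 := fun s0 r s : R => (sdir s0 (PI / 4) * gker t (y + s) (r * sdir s0 (PI / 4)))%C).
set (K2 := fun s0 s => int half (fun r => k2 s0 r s)).
assert (KF2 : forall s0, s0 * s0 = 1 ->
  (forall kap, is_int half (fun r => int half (fun s => k2 s0 r s * phi0 U kap s)%C)
     (int half (fun s => K2 s0 s * phi0 U kap s)%C)) /\
  is_int line (fun kap => Cexp (Ci * kap * c) * int half (fun s => K2 s0 s * phi0 U kap s))%C
    (2 * PI * int half (fun s => K2 s0 s * f s))%C /\
  is_int half (fun s => K2 s0 s * f s)%C (int half (fun s => K2 s0 s * f s)%C)).
{ intros s0 Hs0.
  apply (kernel_fubini half half (k2 s0) (phi0 U) f c (ray2_const y) M' M).
  - unfold k2; apply cts_mult; [apply cts_const |].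
    apply (cts_gker_ray (fun _ => t) (fun q : R * R => y + snd q) (fun q => fst q)
      (fun _ => sdir s0 (PI / 4))); try apply ctsR_const; try apply cts_const; cts_tac.
  - exact cphi.
  - exact cf.
  - intros r s Hr Hs; simpl in Hr, Hs; apply gker_ray_bounds; lra.
  - intros k s _; apply bphi.
  - exact bf.
  - intros s _; apply inv0. }
destruct (KF2 1 ltac:(ring)) as [F2 [G2 J2]]; destruct (KF2 (-1) ltac:(ring)) as [F2' [G2' J2']].
set (A2 := int half (fun s => K2 1 s * f s)%C) in *.
set (A2' := int half (fun s => K2 (-1) s * f s)%C) in *.
pose proof (fun kap => ray_term U u0 M M' x y t kap (PI / 4) 1 _ HM HM' cU bU bw HU0
  sdir_out (F2 kap)) as T2.
pose proof (fun kap => ray_term U u0 M M' x y t kap (3 * (PI / 4)) (-1) _ HM HM' cU bU bw HU0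
  sdir_in (F2' kap)) as T2'.
fold c in T2, T2'.
assert (O2 : is_int line (fun kap => contour_int kap (fun lam =>
    (E kap lam x y t * half_space_hat u0 kap (- (lam + 2 * kap)))%C)) (2 * PI * A2 - 2 * PI * A2')%C).
{ pose proof (is_int_minus line _ _ _ _ G2 G2') as H; revert H; apply is_int_ext; intros kap _.
  symmetry; apply (f_equal2 Cminus);
    [exact (is_int_unique half _ _ (T2 kap)) | exact (is_int_unique half _ _ (T2' kap))]. }
set (k3 := fun s0 r tau : R => (sdir s0 (PI / 4)
   * (r * sdir s0 (PI / 4) * gker (t - tau) y (r * sdir s0 (PI / 4))))%C).
set (K3 := fun s0 tau => int half (fun r => k3 s0 r tau)).
assert (ck3 : forall s0, cts (fun q : R * R => k3 s0 (fst q) (snd q))).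
{ intros s0; unfold k3; apply cts_mult; [apply cts_const |].
  apply cts_mult; [apply cts_mult; [cts_tac | apply cts_const] |].
  apply (cts_gker_ray (fun q : R * R => t - snd q) (fun _ => y) (fun q => fst q)
    (fun _ => sdir s0 (PI / 4))); try apply ctsR_const; try apply cts_const; cts_tac. }
assert (bk3 : forall s0 r tau, s0 * s0 = 1 -> 0 <= r -> Cmod (k3 s0 r tau) <= ray2_const y / (1 + r ^ 2)).
{ intros s0 r tau Hs0 Hr; apply gker_ray_bounds; lra. }
(* The bound on the rays is uniform in [tau], so [K3] is continuous through [tau = t]. *)
assert (cK3 : forall s0, s0 * s0 = 1 -> cts (K3 s0)).
{ intros s0 Hs0; apply (cts_int_unif half (fun tau r => k3 s0 r tau) (ray2_const y)).
  - apply (cts_swap (k3 s0)), ck3.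
  - intros tau r Hr; now apply bk3. }
assert (KF3 : forall s0, s0 * s0 = 1 ->
  (forall kap, is_int half (fun r => int (seg 0 t Ht0) (fun tau => k3 s0 r tau * xfourier U kap 0%R tau)%C)
     (int (seg 0 t Ht0) (fun tau => K3 s0 tau * xfourier U kap 0%R tau)%C)) /\
  is_int line (fun kap => Cexp (Ci * kap * c)
      * int (seg 0 t Ht0) (fun tau => K3 s0 tau * xfourier U kap 0%R tau))%C
    (2 * PI * int (seg 0 t Ht0) (fun tau => K3 s0 tau * g tau))%C /\
  is_int (seg 0 t Ht0) (fun tau => K3 s0 tau * g tau)%C
    (int (seg 0 t Ht0) (fun tau => K3 s0 tau * g tau)%C)).
{ intros s0 Hs0.
  apply (kernel_fubini half (seg 0 t Ht0) (k3 s0) (fun kap tau => xfourier U kap 0 tau) g c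
    (ray2_const y) (M' * (1 + t ^ 2)) (M * (1 + t ^ 2))).
  - apply ck3.
  - apply (cts_comp3 (xfourier U) (fun q : R * R => fst q) (fun _ => 0) (fun q => snd q) cw); cts_tac.
  - exact cg.
  - intros r tau Hr _; now apply bk3.
  - intros k tau Htau; simpl in Htau.
    eapply Rle_trans; [exact (proj1 (rapid_le (xfourier U) M' k 0 tau HM' bw)) |].
    eapply Rle_trans; [apply (seg_weight t tau _ Htau) |].
    + apply Rmult_le_pos; [exact HM' | left; apply Rinv_0_lt_compat, weight_pos].
    + apply Req_le; unfold Rdiv; ring.
  - intros tau Htau; simpl in Htau.
    apply Rle_trans with M; [| now apply seg_weight].
    eapply Rle_trans; [exact (proj1 (rapid_le U M c 0 tau HM bU)) | now apply div_weight_le].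
  - intros tau _; apply (xfourier_inversion U M M'); assumption. }
destruct (KF3 1 ltac:(ring)) as [F3 [G3 J3]]; destruct (KF3 (-1) ltac:(ring)) as [F3' [G3' J3']].
set (A3 := int (seg 0 t Ht0) (fun tau => K3 1 tau * g tau)%C) in *.
set (A3' := int (seg 0 t Ht0) (fun tau => K3 (-1) tau * g tau)%C) in *.
pose proof (fun kap => ray_term_t U g0 T M M' x y t kap (PI / 4) 1 _ Ht0 HM HM' cU bU bw HUg
  (proj2 Ht) sdir_out (F3 kap)) as T3.
pose proof (fun kap => ray_term_t U g0 T M M' x y t kap (3 * (PI / 4)) (-1) _ Ht0 HM HM' cU bU bw HUg
  (proj2 Ht) sdir_in (F3' kap)) as T3'.
fold c in T3, T3'.
assert (O3 : is_int line (fun kap => contour_int kap (fun lam =>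
    ((lam + kap) * E kap lam x y t * t_tilde g0 kap ((kap + lam) ^ 2) t)%C)) (2 * PI * A3 - 2 * PI * A3')%C).
{ pose proof (is_int_minus line _ _ _ _ G3 G3') as H; revert H; apply is_int_ext; intros kap _.
  symmetry; apply (f_equal2 Cminus);
    [exact (is_int_unique half _ _ (T3 kap)) | exact (is_int_unique half _ _ (T3' kap))]. }
split; [| split; [| split]].
- split; [intros kap; exact (is_int_ex_R _ _ (T1 kap)) | exact (is_int_ex_R _ _ O1)].
- split; [| exact (is_int_ex_R _ _ O2)].
  intros kap; split; [exact (is_int_ex_pos _ _ (T2 kap)) | exact (is_int_ex_pos _ _ (T2' kap))].
- split; [| exact (is_int_ex_R _ _ O3)].
  intros kap; split; [exact (is_int_ex_pos _ _ (T3 kap)) | exact (is_int_ex_pos _ _ (T3' kap))].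
- assert (V1' : int_R_R (fun (kappa : R) (lambda : C) =>
      (E kappa lambda x y t * half_space_hat u0 kappa lambda)%C) = (2 * PI * A1)%C)
    by exact (is_int_unique line _ _ O1).
  assert (V2' : int_R_contour (fun (kappa : R) (lambda : C) =>
      (E kappa lambda x y t * half_space_hat u0 kappa (- (lambda + 2 * kappa)))%C)
      = (2 * PI * A2 - 2 * PI * A2')%C)
    by exact (is_int_unique line _ _ O2).
  assert (V3' : int_R_contour (fun (kappa : R) (lambda : C) =>
      ((lambda + kappa) * E kappa lambda x y t * t_tilde g0 kappa ((kappa + lambda) ^ 2) t)%C)
      = (2 * PI * A3 - 2 * PI * A3')%C)
    by exact (is_int_unique line _ _ O3).
  rewrite V1', V2', V3'.
  (* The factor [- 2 i] turns the value [i y / (2 (t - tau)) hk (t - tau) y] of [contour_gauss_z]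
     into the boundary kernel of [heat_half_line]. *)
  set (H := fun tau => (- (2 * Ci) * (K3 1 tau - K3 (-1) tau))%C).
  assert (cH : cts H).
  { unfold H; apply cts_mult; [apply cts_const |].
    apply cts_minus; [apply (cK3 1) | apply (cK3 (-1))]; ring. }
  pose proof (heat_half_line (fun s tau => U (c + s) s tau) (fun s tau => V1 (c + s) s tau)
    (fun s tau => V2 (c + s) s tau) H t y M (proj1 Ht) Hy (diag U cU) (diag V1 cV1) (diag V2 cV2)
    (fun s tau _ => proj2 (rapid_le U M (c + s) s tau HM bU))
    (fun s tau _ => proj2 (rapid_le V1 M (c + s) s tau HM bV1))) as HH.
  assert (Hlt : forall tau, 0 < tau < t -> 0 < tau < T) by (intros; lra).
  specialize (HH (fun s tau Hs Htau => proj1 (Hder c s tau Hs (Hlt tau Htau)))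
    (fun s tau Hs Htau => proj1 (proj2 (Hder c s tau Hs (Hlt tau Htau))))
    (fun s tau Hs Htau => proj2 (proj2 (Hder c s tau Hs (Hlt tau Htau)))) cH).
  assert (EH : forall tau, 0 < tau < t -> H tau = RtoC (y / (t - tau) * hk (t - tau) y)).
  { intros tau Htau; unfold H, K3, k3.
    rewrite (contour_gauss_z (t - tau) y ltac:(lra) Hy); fold (hk (t - tau) y).
    replace (y / (t - tau) * hk (t - tau) y) with (2 * (y / (2 * (t - tau)) * hk (t - tau) y))
      by (field; lra).
    rewrite (RtoC_mult 2); apply injective_projections; simpl; ring. }
  specialize (HH EH); cbv beta in HH.
  (* [K1] is the direct heat kernel and the difference of the two [K2] its image; together they form
     [dirk]. *)
  assert (X1 : int half (fun s => dirk y t s * U (c + s)%R s 0%R)%C = (A1 - (A2 - A2'))%C).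
  { apply is_int_unique.
    pose proof (is_int_minus half _ _ _ _ J1 (is_int_minus half _ _ _ _ J2 J2')) as I.
    revert I; apply is_int_ext; intros s Hs; simpl in Hs.
    assert (Q1 : K1 s = RtoC (hk t (y - s))) by exact (is_int_unique line _ _ (gauss_FT t (y - s) (proj1 Ht))).
    assert (Q2 : (K2 1 s - K2 (-1) s)%C = RtoC (hk t (y + s))) by (apply contour_gauss; lra).
    transitivity ((K1 s - (K2 1 s - K2 (-1) s)) * f s)%C; [ring |].
    rewrite Q1, Q2, <- RtoC_minus; reflexivity. }
  assert (cHg : cts (fun tau => H tau * U (c + 0)%R 0%R tau)%C).
  { apply cts_mult; [exact cH | now apply cts3_slice3]. }
  assert (X2 : RIC (fun tau => H tau * U (c + 0)%R 0%R tau)%C 0 t = (- (2 * Ci) * (A3 - A3'))%C).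
  { rewrite <- (int_seg 0 t Ht0) by exact cHg; apply is_int_unique.
    pose proof (is_int_Cmult _ _ (- (2 * Ci))%C _ (is_int_minus (seg 0 t Ht0) _ _ _ _ J3 J3')) as I.
    revert I; apply is_int_ext; intros tau _; unfold H, g; rewrite Rplus_0_r; ring. }
  rewrite X1, X2 in HH.
  replace (c + y) with x in HH by (unfold c; ring).
  assert (HP : RtoC PI <> 0) by (intros Z; apply RtoC_inj in Z; lra).
  assert (H2P : (2 * RtoC PI)%C <> 0).
  { rewrite <- RtoC_mult; intros Z; apply RtoC_inj in Z; lra. }
  replace (U x y t) with (/ (2 * RtoC PI) * (2 * PI * U x y t))%C by (field; exact HP).
  rewrite HH; field; exact HP.
Qed.

Theorem mainTheorem1 :
  exists N : nat,
  forall (T : R) (u : R -> R -> R -> C)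
         (Du : nat -> nat -> nat -> R -> R -> R -> C)
         (u0 g0 : R -> R -> C),
  0 < T ->
  CN_up_to_boundary N T u Du ->
  decays N T Du ->
  (forall x y t : R, interior_dom T x y t ->
     (Du 0%nat 0%nat 1%nat x y t - Du 2%nat 0%nat 0%nat x y t
      - 2 * Du 1%nat 1%nat 0%nat x y t - Du 0%nat 2%nat 0%nat x y t)%C = RtoC 0) ->
  (forall x t : R, 0 < t < T -> u x 0 t = g0 x t) ->
  (forall x y : R, 0 < y -> u x y 0 = u0 x y) ->
  (forall (kappa : R) (lambda : C), Im lambda <= 0 ->
     ex_half_space_hat u0 kappa lambda) /\
  (forall (kappa : R) (eta : C) (t : R), 0 < t < T -> ex_t_tilde g0 kappa eta t) /\
  (forall x y t : R, 0 < y -> 0 < t < T ->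
     ex_int_R_R (fun (kappa : R) (lambda : C) =>
       (E kappa lambda x y t * half_space_hat u0 kappa lambda)%C) /\
     ex_int_R_contour (fun (kappa : R) (lambda : C) =>
       (E kappa lambda x y t * half_space_hat u0 kappa (- (lambda + 2 * kappa)))%C) /\
     ex_int_R_contour (fun (kappa : R) (lambda : C) =>
       ((lambda + kappa) * E kappa lambda x y t
        * t_tilde g0 kappa ((kappa + lambda) ^ 2) t)%C) /\
     u x y t =
       (1 / (2 * PI) ^ 2 *
          int_R_R (fun (kappa : R) (lambda : C) =>
            E kappa lambda x y t * half_space_hat u0 kappa lambda)
        - 1 / (2 * PI) ^ 2 *
          int_R_contour (fun (kappa : R) (lambda : C) =>
            E kappa lambda x y t * half_space_hat u0 kappa (- (lambda + 2 * kappa)))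
        - Ci / (2 * PI ^ 2) *
          int_R_contour (fun (kappa : R) (lambda : C) =>
            (lambda + kappa) * E kappa lambda x y t
            * t_tilde g0 kappa ((kappa + lambda) ^ 2) t))%C).
Proof.
(* Decay of order 4 supplies the product of the weights of [x] and [y]; the derivatives that occur
   have order at most 2. *)
exists 4%nat.
intros T u Du u0 g0 HT [Hu [Hcont Hder]] [M Hdec] Hpde Hg Hu0.
set (D := fun i j k => extend T (Du i j k)).
assert (HT0 : 0 <= T) by lra.
assert (cD : forall i j k, (i + j + k <= 4)%nat -> cts3 (D i j k)).
{ intros i j k H; apply cts_extend; [exact HT0 | now apply Hcont]. }
assert (bD : forall i j k, (i + j + k <= 4)%nat -> 0 <= M /\ rapid (D i j k) M).
{ intros i j k H; apply extend_bound; [exact HT0 | now apply Hdec]. }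
assert (HM : 0 <= M) by (apply (bD 0%nat 0%nat 0%nat); lia).
set (U := D 0%nat 0%nat 0%nat).
assert (cU : cts3 U) by (apply cD; lia).
assert (bU : rapid U M) by (apply bD; lia).
assert (HU : forall x y t, closed_dom T x y t -> U x y t = u x y t).
{ intros x y t H; unfold U, D; rewrite extend_in by exact H; now apply Hu. }
assert (HU0 : forall x y, 0 < y -> U x y 0 = u0 x y).
{ intros x y Hy; rewrite HU by (split; lra); now apply Hu0. }
assert (HUg : forall x tau, 0 < tau < T -> U x 0 tau = g0 x tau).
{ intros x tau Htau; rewrite HU by (split; lra); now apply Hg. }
assert (HM' : 0 <= 2 * M * PI) by (pose proof PI_RGT_0; apply Rmult_le_pos; lra).
assert (bw : rapid (xfourier U) (2 * M * PI)).
{ intros k s tau.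
  apply (xfourier_bound T M (Du 0 0 0)%nat (Du 1 0 0)%nat (Du 2 0 0)%nat HT HM);
    try (apply cD; lia); try (apply bD; lia).
  - intros x y t H; apply (Hder 0 0 0)%nat; [lia | exact H].
  - intros x y t H; apply (Hder 1 0 0)%nat; [lia | exact H]. }
set (V1 := fun x y t => (D 1%nat 0%nat 0%nat x y t + D 0%nat 1%nat 0%nat x y t)%C).
(* The square of the sum of the derivatives in [x] and [y]; the two mixed derivatives coincide
   because [Du] is indexed by orders. *)
set (V2 := fun x y t => (D 2%nat 0%nat 0%nat x y t + D 1%nat 1%nat 0%nat x y t
  + (D 1%nat 1%nat 0%nat x y t + D 0%nat 2%nat 0%nat x y t))%C).
assert (cV1 : cts3 V1) by (apply cts_plus; apply cD; lia).
assert (cV2 : cts3 V2) by (apply cts_plus; apply cts_plus; apply cD; lia).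
assert (bV1 : rapid V1 (2 * M)).
{ intros x y t; unfold V1; eapply Rle_trans; [apply Cmod_triangle |].
  pose proof (proj2 (bD 1 0 0 ltac:(lia))%nat x y t) as B1.
  pose proof (proj2 (bD 0 1 0 ltac:(lia))%nat x y t) as B2.
  unfold Rdiv in *; lra. }
(* [representation] takes one constant for [U] and [V1], and [V1] is a sum of two terms. *)
assert (bU' : rapid U (2 * M)).
{ intros x y t; eapply Rle_trans; [apply bU |]; unfold Rdiv.
  repeat (apply Rmult_le_compat_r; [left; apply Rinv_0_lt_compat, weight_pos |]); lra. }
assert (chain : forall i j, (i + j < 4)%nat -> forall c s tau, 0 < s -> 0 < tau < T ->
  is_derive_C (fun s => D i j 0%nat (c + s) s tau) s
    (D (S i) j 0%nat (c + s)%R s tau + D i (S j) 0%nat (c + s)%R s tau)%C).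
{ intros i j H c s tau Hs Htau.
  apply (chain_diag (fun x y => D i j 0%nat x y tau) (fun x y => D (S i) j 0%nat x y tau)
    (fun x y => D i (S j) 0%nat x y tau)).
  - apply (cts_comp3 (D (S i) j 0%nat) (fun q : R * R => fst q) (fun q => snd q) (fun _ => tau));
      [apply cD; lia | cts_tac | cts_tac | cts_tac].
  - exact Hs.
  - intros x y Hy; apply extend_dx; [now split |]; apply (Hder i j 0%nat); [lia | now split].
  - intros x y Hy; apply extend_dy; [now split |]; apply (Hder i j 0%nat); [lia | now split]. }
split; [| split].
- intros kap lam Hlam; now apply (half_space_hat_formula U u0 M).
- intros kap eta t Ht.
  now apply (t_tilde_formula U g0 T M t kap eta (Rlt_le _ _ (proj1 Ht))).
- intros x y t Hy Ht.
  rewrite <- (HU x y t) by (split; lra).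
  apply (representation T (2 * M) (2 * M * PI) t x y U V1 V2); try assumption; try lra.
  intros c s tau Hs Htau; split; [| split].
  + apply (chain 0 0)%nat; [lia | exact Hs | exact Htau].
  + apply dC_plus; [apply (chain 1 0)%nat | apply (chain 0 1)%nat]; (lia || assumption).
  + eapply dC_eq.
    * apply extend_dt; [now split |]; apply (Hder 0 0 0)%nat; [lia | now split].
    * unfold V2, D; rewrite !extend_in by (split; lra).
      assert (HI : interior_dom T (c + s) s tau) by now split.
      pose proof (Hpde _ _ _ HI) as P.
      set (a := Du 0%nat 0%nat 1%nat (c + s) s tau) in *.
      set (b := Du 2%nat 0%nat 0%nat (c + s) s tau) in *.
      set (e := Du 1%nat 1%nat 0%nat (c + s) s tau) in *.
      set (d := Du 0%nat 2%nat 0%nat (c + s) s tau) in *.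
      replace a with (a - b - 2 * e - d + (b + 2 * e + d))%C by ring.
      rewrite P; ring.
Qed.
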